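(* For a tree $\Upsilon$ the following are equivalent: (1) $C_0(\Upsilon)$ admits an equivalent norm which is $C^\infty$ (infinitely Fréchet differentiable) on $C_0(\Upsilon)\setminus\{0\}$; (2) $C_0(\Upsilon)$ admits an equivalent norm which is Fréchet differentiable on $C_0(\Upsilon)\setminus\{0\}$; (3) there is an increasing function $\rho:\Upsilon\to\mathbb{R}$ which has no bad points and is constant on no ever-branching subset of $\Upsilon$; (4) $\Upsilon$ admits a Talagrand operator.
   Context: A tree is a partially ordered set $(\Upsilon,\preceq)$ such that for each $t\in\Upsilon$ the set $\{s: s\preceq t\}$ is well-ordered by $\preceq$. Write $(0,t]=\{s:s\preceq t\}$, $(0,t)=\{s:s\prec t\}$, $[t,\infty)=\{u:t\preceq u\}$, and let $r(t)$ be the order type of $(0,t)$. All trees are assumed Hausdorff: if $r(t)$ is a limit ordinal and $(0,t)=(0,t')$ then $t=t'$. $\Upsilon$ carries the coarsest topology in which every $(0,t]$ is open and closed (a locally compact Hausdorff topology). $C_0(\Upsilon)$ is the Banach space of continuous $f:\Upsilon\to\mathbb{R}$ such that $\{t:|f(t)|\ge\epsilon\}$ is compact for every $\epsilon>0$, with the supremum norm $\|\cdot\|_\infty$. The set $t^+$ of immediate successors of $t$ consists of those $u$ with $(0,u)=(0,t]$. A function $\rho:\Upsilon\to\mathbb{R}$ is increasing if $s\preceq t$ implies $\rho(s)\le\rho(t)$. For increasing $\rho$, a point $t$ is good for $\rho$ if there is a finite $F\subseteq t^+$ with $\inf_{u\in t^+\setminus F}\rho(u)>\rho(t)$ (an infimum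 over the empty set is $+\infty$); otherwise $t$ is bad for $\rho$. A subset $\Gamma\subseteq\Upsilon$ is ever-branching if it is non-empty and for every $t\in\Gamma$ the set $\Gamma\cap[t,\infty)$ is not totally ordered. For a locally compact space $L$, a Talagrand operator for $L$ is a bounded linear operator $T:C_0(L)\to c_0(L\times M)$, for some set $M$, such that for every non-zero $f\in C_0(L)$ there exist $t\in L$ and $u\in M$ with $|f(t)|=\|f\|_\infty$ and $(Tf)(t,u)\neq0$. *)

(* Defs.v *)
From HB Require Import structures.
From mathcomp Require Import all_boot all_order all_algebra.
From mathcomp Require Import all_classical all_reals topology normedtype.
From mathcomp Require Import Rstruct Rstruct_topology.
From Stdlib Require List.

Set Implicit Arguments.
Unset Strict Implicit.
Unset Printing Implicit Defensive.
Import Order.TTheory GRing.Theory Num.Theory numFieldTopology.Exports numFieldNormedType.Exports.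
Local Open Scope classical_set_scope.
Local Open Scope ring_scope.

Section Trees.
Variable T : Type.
Variable le : T -> T -> Prop.

Definition tlt (s t : T) : Prop := le s t /\ s <> t.

Definition down (t : T) : set T := [set s | le s t].

(* r(t) is a non-zero limit ordinal: (0,t) is non-empty and has no maximum *)
Definition limit_height (t : T) : Prop :=
  (exists s, tlt s t) /\ (forall s, tlt s t -> exists s', tlt s s' /\ tlt s' t).

(* Hausdorff tree: partial order, every (0,t] well-ordered, Hausdorff condition *)
Definition is_tree : Prop :=
  [/\ (forall t, le t t) /\
      (forall s t, le s t -> le t s -> s = t) /\
      (forall r s t, le r s -> le s t -> le r t),
      (forall t s1 s2, le s1 t -> le s2 t -> le s1 s2 \/ le s2 s1),
      (forall t (A : set T), A `<=` down t -> A !=set0 ->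
          exists m, A m /\ forall a, A a -> le m a) &
      (forall t t', limit_height t -> (forall s, tlt s t <-> tlt s t') -> t = t')].

(* The coarsest topology in which each (0,t] is clopen: generated by the
   subbasis { (0,t] } u { complement of (0,t] }. *)
Definition sb_index : Type := (bool * T)%type.

Definition subbasic (p : sb_index) : set T :=
  if p.1 then down p.2 else ~` down p.2.

Definition tree_open (U : set T) : Prop :=
  forall x, U x -> exists ps : seq sb_index,
    (forall p, List.In p ps -> subbasic p x) /\
    (forall y, (forall p, List.In p ps -> subbasic p y) -> U y).

Definition tree_compact (K : set T) : Prop :=
  forall F : set (set T), (forall U, F U -> tree_open U) ->
    (forall x, K x -> exists U, F U /\ U x) ->
    exists fs : seq (set T), (forall U, List.In U fs -> F U) /\
      (forall x, K x -> exists U, List.In U fs /\ U x).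

Definition tree_continuous (R : realType) (f : T -> R) : Prop :=
  forall V : set R, open V -> tree_open (f @^-1` V).

Definition C0 (R : realType) (f : T -> R) : Prop :=
  tree_continuous f /\
  forall eps : R, 0 < eps -> tree_compact [set t | eps <= `|f t|].

Definition succ (t u : T) : Prop := forall s, tlt s u <-> le s t.

Definition increasing (R : realType) (rho : T -> R) : Prop :=
  forall s t, le s t -> rho s <= rho t.

(* t is good for rho: finite F in t^+ with inf_{u in t^+ \ F} rho u > rho t
   (inf of the empty set = +oo); the strict inequality with the infimum is
   written out as the existence of c > rho t bounding rho below there. *)
Definition good (R : realType) (rho : T -> R) (t : T) : Prop :=
  exists (F : seq T) (c : R), (forall u, List.In u F -> succ t u) /\ rho t < c /\
    forall u, succ t u -> ~ List.In u F -> c <= rho u.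

Definition bad (R : realType) (rho : T -> R) (t : T) : Prop := ~ good rho t.

Definition ever_branching (G : set T) : Prop :=
  G !=set0 /\
  forall t, G t -> exists u v, [/\ G u /\ G v, le t u, le t v, ~ le u v & ~ le v u].

Definition constant_on (R : realType) (rho : T -> R) (G : set T) : Prop :=
  exists c, forall t, G t -> rho t = c.

End Trees.

Section Analysis.
Variable R : realType.

Definition supn (S : Type) (f : S -> R) : R := sup [set `|f s| | s in [set: S]].

Definition fadd (S : Type) (f g : S -> R) : S -> R := fun s => f s + g s.
Definition fscale (S : Type) (a : R) (f : S -> R) : S -> R := fun s => a * f s.

Definition c0 (S : Type) (g : S -> R) : Prop :=
  forall eps : R, 0 < eps -> finite_set [set s | eps <= `|g s|].

Variable T : Type.
Variable le : T -> T -> Prop.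
Local Notation C0 := (@C0 T le R).

Definition nonzero (f : T -> R) : Prop := exists t, f t != 0.

Definition equiv_norm (N : (T -> R) -> R) : Prop :=
  [/\ (forall f g, C0 f -> C0 g -> N (fadd f g) <= N f + N g),
      (forall a f, C0 f -> N (fscale a f) = `|a| * N f),
      (forall f, C0 f -> N f = 0 -> forall t, f t = 0) &
      exists a b : R, [/\ 0 < a, 0 < b &
        forall f, C0 f -> a * supn f <= N f /\ N f <= b * supn f]].

Definition bounded_linear_functional (L : (T -> R) -> R) : Prop :=
  (forall a f g, C0 f -> C0 g -> L (fadd (fscale a f) g) = a * L f + L g) /\
  exists C : R, forall h, C0 h -> `|L h| <= C * supn h.

Definition frechet_away_from_0 (N : (T -> R) -> R) : Prop :=
  forall f, C0 f -> nonzero f ->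
    exists L, bounded_linear_functional L /\
      forall eps : R, 0 < eps -> exists delta : R, 0 < delta /\
        forall h, C0 h -> supn h < delta ->
          `|N (fadd f h) - N f - L h| <= eps * supn h.

(* bounded k-linear forms on C_0(T), represented on lists of length k *)
Definition bounded_multilinear (k : nat) (A : seq (T -> R) -> R) : Prop :=
  (forall (pre post : seq (T -> R)) a x y,
     size pre + size post + 1 = k ->
     (forall h, List.In h pre -> C0 h) -> (forall h, List.In h post -> C0 h) ->
     C0 x -> C0 y ->
     A (pre ++ fadd (fscale a x) y :: post) =
       a * A (pre ++ x :: post) + A (pre ++ y :: post)) /\
  exists C : R, forall hs, size hs = k -> (forall h, List.In h hs -> C0 h) ->
     `|A hs| <= C * \prod_(h <- hs) supn h.

(* N is C^oo (infinitely Frechet differentiable) on C_0(T) \ {0}: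
   D k f is the k-th Frechet derivative of N at f, a bounded k-linear form,
   and D (k+1) f is the Frechet derivative at f of g |-> D k g (measured in
   the operator norm of k-linear forms). *)
Definition smooth_away_from_0 (N : (T -> R) -> R) : Prop :=
  exists D : nat -> (T -> R) -> seq (T -> R) -> R,
  [/\ (forall f, C0 f -> nonzero f -> D 0%N f [::] = N f),
      (forall k f, C0 f -> nonzero f -> bounded_multilinear k (D k f)) &
      (forall k f, C0 f -> nonzero f ->
        forall eps : R, 0 < eps -> exists delta : R, 0 < delta /\
          forall h, C0 h -> supn h < delta ->
          forall hs, size hs = k -> (forall g, List.In g hs -> C0 g) ->
            `|D k (fadd f h) hs - D k f hs - D k.+1 f (h :: hs)|
              <= eps * supn h * \prod_(g <- hs) supn g)].

Definition talagrand_operator (M : Type) (Op : (T -> R) -> ((T * M)%type -> R)) : Prop :=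
  [/\ (forall f, C0 f -> c0 (Op f)),
      (forall a f g, C0 f -> C0 g -> forall p,
          Op (fadd (fscale a f) g) p = a * Op f p + Op g p),
      (exists C : R, forall f, C0 f -> supn (Op f) <= C * supn f) &
      (forall f, C0 f -> nonzero f ->
          exists t u, `|f t| = supn f /\ Op f (t, u) != 0)].

Definition admits_talagrand_operator : Prop :=
  exists (M : Type) (Op : (T -> R) -> ((T * M)%type -> R)), talagrand_operator Op.

End Analysis.

(* Main.v *)
(* The proof is the cycle smooth => Frechet => increasing function => Talagrand
   operator => smooth.

   Frechet norm N to rho.  For g in C_0 let J g w be the infimum of N over the
   functions that agree with g off the points above w.  Starting from a limit
   node l, extend g by its value g l up a branch and follow J until it jumps; the
   nodes reached without a jump form the plateau of l.  If the plateau has a bad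
   node or contains an ever-branching set, averages of almost optimal functions
   show that the infimum J g l is attained.  At a minimiser, differentiability
   makes the effects on N of adding and of subtracting a small segment (p, l]
   opposite up to first order: either subtracting lowers J by a fixed amount, or
   adding costs little compared with the gain in g l.  As gains at small cost are
   bounded (a Bishop-Phelps argument on limits of step functions), either some g
   has a good plateau, or lowering a fixed step function by any segment below l
   drops J by a fixed amount.  A recursion cuts the tree into good plateaux; each
   node carries a code in nat recording rational approximations of the data that
   cause a jump, and a code cannot occur twice below jumps on one branch.  So
   rho t = sum of 2^-(n+1) over the codes n of the jumps below t increases strictly
   at every jump, and is constant along a branch only within a good plateau.

   rho to Talagrand operator.  Make rho left continuous at limits.  Only finitely
   many immediate successors u of m have rho u = rho m; for these take
   f m - sum f u, suitably weighted.  As no ever-branching set lies in a level set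
   of rho, a successor function nxt can be chosen so that below every node only
   finitely many t of the same level are left by another successor than nxt t; the
   coordinate (t, m) of the operator carries the weighted difference at m when
   t = m, or t < m has the level of m and m is not above nxt t.

   Talagrand operator to smooth norm.  With psi v = v exp(-1/v) for v > 0 and 0
   otherwise, the admissible l > |f| are those for which the sum over the pairs
   p = (t, m) of psi ((Tf)(p)^2 / (l^2 - f(t)^2) - 1) is at most 1, and the norm is
   their infimum.  Convexity of psi gives the triangle inequality.  Since T is a
   Talagrand operator, the norm exceeds |f| strictly, so that near f only finitely
   many terms matter and the norm is given implicitly by a smooth equation. *)
Require Import Defs.
From HB Require Import structures.
From mathcomp Require Import all_boot all_order all_algebra.
From mathcomp Require Import all_classical all_reals topology normedtype.
From mathcomp Require Import Rstruct Rstruct_topology.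
From mathcomp Require Import sequences exp.
From mathcomp Require Import ring lra.
From Stdlib Require Rdefinitions.
From Stdlib Require List.

Set Implicit Arguments.
Unset Strict Implicit.
Unset Printing Implicit Defensive.
Import Order.TTheory GRing.Theory Num.Theory numFieldTopology.Exports numFieldNormedType.Exports.
Local Open Scope classical_set_scope.
Local Open Scope ring_scope.

(** * Trees and C_0 *)

Section TreeOrder.
Variables (T : Type) (le : T -> T -> Prop) (Htree : is_tree le).
Local Notation lt := (tlt le).

Lemma le_refl t : le t t. Proof. by have [[h _] _ _ _] := Htree. Qed.

Lemma le_anti s t : le s t -> le t s -> s = t.
Proof. by have [[_ [h _]] _ _ _] := Htree; apply: h. Qed.

Lemma le_tr s r t : le r s -> le s t -> le r t.
Proof. by have [[_ [_ h]] _ _ _] := Htree; apply: h. Qed.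

Lemma below_total t r s : le r t -> le s t -> le r s \/ le s r.
Proof. by have [_ h _ _] := Htree; apply: h. Qed.

Lemma tree_haus t t' : limit_height le t -> (forall s, lt s t <-> lt s t') -> t = t'.
Proof. by have [_ _ _ h] := Htree; apply: h. Qed.

Lemma tltW s t : lt s t -> le s t. Proof. by case. Qed.

Lemma lt_irr t : ~ lt t t. Proof. by case. Qed.

Lemma lt_le s r t : lt r s -> le s t -> lt r t.
Proof.
move=> [rs nrs] st; split; first exact: le_tr rs st.
by move=> E; subst r; apply: nrs; apply: le_anti.
Qed.

Lemma le_lt s r t : le r s -> lt s t -> lt r t.
Proof.
move=> rs [st nst]; split; first exact: le_tr rs st.
by move=> E; subst r; apply: nst; apply: le_anti.
Qed.

Lemma lt_tr s r t : lt r s -> lt s t -> lt r t.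
Proof. by move=> rs [st _]; apply: lt_le rs st. Qed.

Lemma lt_nle s t : lt s t -> ~ le t s.
Proof. by move=> [st n] ts; apply: n; apply: le_anti. Qed.

Lemma nle_lt t r s : le r t -> le s t -> ~ le r s -> lt s r.
Proof.
move=> rt st n; case: (below_total rt st) => // sr; split=> // E.
by subst s; apply: n.
Qed.

Lemma le_eq_lt s t : le s t -> s = t \/ lt s t.
Proof. by move=> st; case: (pselect (s = t)) => [->|n]; [left|right]. Qed.

Lemma ex_least t (A : set T) : (forall a, A a -> le a t) -> A !=set0 ->
  exists m, A m /\ forall a, A a -> le m a.
Proof. by have [_ _ h _] := Htree => hA; apply: (h t). Qed.

Lemma tlt_wf : well_founded lt.
Proof.
move=> t; apply: contrapT => nt.
pose A := [set s | le s t /\ ~ Acc lt s].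
have [m [[mt nm] hm]] : exists m, A m /\ forall a, A a -> le m a.
  by apply: (ex_least (t := t)) => [a []//|]; exists t; split=> //; apply: le_refl.
apply: nm; constructor => s sm; apply: contrapT => ns.
apply: (lt_nle sm); apply: hm; split=> //; exact: le_tr (tltW sm) mt.
Qed.

Lemma tlt_ind (P : T -> Prop) :
  (forall t, (forall s, lt s t -> P s) -> P t) -> forall t, P t.
Proof. by move=> h t; elim/(well_founded_ind tlt_wf): t. Qed.

Lemma succ_lt s u : succ le s u -> lt s u.
Proof. by move=> h; apply/h; apply: le_refl. Qed.

Lemma succ_le s u r : succ le s u -> lt r u -> le r s.
Proof. by move=> h /h. Qed.

Lemma succ_pred_uniq p p' u : succ le p u -> succ le p' u -> p = p'.
Proof.
move=> h h'; apply: le_anti; first exact: succ_le h' (succ_lt h).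
exact: succ_le h (succ_lt h').
Qed.

Lemma next_ex s t : lt s t -> exists u, succ le s u /\ le u t.
Proof.
move=> st.
have [u [[su ut] hu]] : exists m, (lt s m /\ le m t) /\
    forall a, (lt s a /\ le a t) -> le m a.
  apply: (@ex_least t [set x | lt s x /\ le x t]) => [a []//|].
  by exists t; split=> //; apply: le_refl.
exists u; split=> // r; split=> [ru|rs]; last exact: le_lt rs su.
apply: contrapT => nrs; apply: (lt_nle ru); apply: hu; split.
  by apply: (nle_lt (t := t)) nrs; [exact: le_tr (tltW ru) ut|exact: tltW].
exact: le_tr (tltW ru) ut.
Qed.

Lemma succ_next_uniq s u v t : succ le s u -> succ le s v -> le u t -> le v t -> u = v.
Proof.
move=> hu hv ut vt; case: (below_total ut vt) => h.
  case: (le_eq_lt h) => // h'.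
  by case: (lt_nle (succ_lt hu)); apply: succ_le hv h'.
case: (le_eq_lt h) => // h'.
by case: (lt_nle (succ_lt hv)); apply: succ_le hu h'.
Qed.

Lemma succ_le_next s u t r : succ le s u -> le u t -> lt s r -> le r t -> le u r.
Proof.
move=> hu ut sr rt; case: (pselect (le u r)) => // nur.
by case: (lt_nle sr); apply: succ_le hu _; apply: (nle_lt ut rt nur).
Qed.

Lemma tree_cases t :
  [\/ forall s, ~ lt s t, exists p, succ le p t | limit_height le t].
Proof.
case: (pselect (exists s, lt s t)) => [[s st]|n]; last first.
  by apply: Or31 => s st; apply: n; exists s.
case: (pselect (forall s, lt s t -> exists s', lt s s' /\ lt s' t)) => [h|n].
  by apply: Or33; split=> //; exists s.
apply: Or32; move/existsNP: n => [p /not_implyP [pt n]]; exists p => r.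
split=> [rt|rp]; last exact: le_lt rp pt.
apply: contrapT => nrp; apply: n; exists r; split=> //.
exact: (nle_lt (tltW rt) (tltW pt)).
Qed.

Lemma limit_not_succ p t : limit_height le t -> ~ succ le p t.
Proof.
move=> [_ h] hp; have [r [pr rt]] := h _ (succ_lt hp).
exact: (lt_nle pr (succ_le hp rt)).
Qed.

(** The Hausdorff condition enters here: if all of (0,l) lay below p and p were not below l, the
    least node below p outside (0,l) would have the same strict predecessors as l, hence be l
    itself. *)
Lemma limit_sep l p : limit_height le l -> ~ le l p ->
  exists r, lt r l /\ ~ le r p.
Proof.
move=> hl nlp; apply: contrapT => n.
have hlow x : lt x l -> le x p.
  by move=> xl; apply: contrapT => nxp; apply: n; exists x.
case: (pselect (le p l)) => [pl|npl].
  have [q [pq ql]] := hl.2 p (conj pl (fun E => nlp (eq_ind p (le l) (eq_ind_r (fun z => le l z) (le_refl l) E) p erefl))).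
  exact: (lt_nle pq (hlow _ ql)).
have [m [[mp nm] hm]] : exists m, (le m p /\ ~ lt m l) /\
    forall a, (le a p /\ ~ lt a l) -> le m a.
  apply: (@ex_least p [set x | le x p /\ ~ lt x l]) => [a []//|].
  by exists p; split; [exact: le_refl|move=> /tltW].
apply: nlp; rewrite (@tree_haus l m hl) // => s; split=> [sl|sm].
  apply: (nle_lt mp (hlow _ sl)) => ms; apply: nm; exact: le_lt ms sl.
apply: contrapT => nsl; apply: (lt_nle sm); apply: hm; split=> //.
exact: le_tr (tltW sm) mp.
Qed.

Lemma max_below l r1 r2 : lt r1 l -> lt r2 l -> exists r, [/\ lt r l, le r1 r & le r2 r].
Proof.
move=> h1 h2; case: (below_total (tltW h1) (tltW h2)) => h.
  by exists r2; split=> //; exact: le_refl.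
by exists r1; split=> //; exact: le_refl.
Qed.

Lemma seq_sep l (ts : seq T) : limit_height le l ->
  exists r, lt r l /\ forall t, List.In t ts -> ~ le l t -> ~ le r t.
Proof.
move=> hl; elim: ts => [|t ts [r [rl hr]]].
  by have [s sl] := hl.1; exists s; split.
case: (pselect (le l t)) => [lt_|nlt].
  by exists r; split=> // x [<-|] //; apply: hr.
have [r' [r'l nr']] := limit_sep hl nlt.
have [q [ql rq r'q]] := max_below rl r'l.
exists q; split=> // x [<- _ qt|/hr h /h n qx]; first by apply: nr'; exact: le_tr r'q qt.
by apply: n; exact: le_tr rq qx.
Qed.

(** Allows passing from an ever-branching set to one made of successor nodes, where the behaviour at
    limits does not matter. For incomparable b1, b2 above a, the least u below b1 but not below b2
    is no limit by [limit_sep], so the two branches part at its predecessor. *)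
Lemma ever_branching_split (G : set T) : ever_branching le G ->
  ever_branching le [set u | exists p a b, [/\ G a, G b, le a p, succ le p u & le u b]].
Proof.
have split2 a : ever_branching le G -> G a -> exists p u v, [/\ le a p,
    (exists b, G b /\ le u b), (exists b, G b /\ le v b), succ le p u /\ succ le p v & u <> v].
  move=> [_ hG] Ga; have [b1 [b2 [[G1 G2] a1 a2 n12 n21]]] := hG a Ga.
  have [u [[u1 nu2] hu]] : exists m, (le m b1 /\ ~ le m b2) /\
      forall x, (le x b1 /\ ~ le x b2) -> le m x.
    apply: (@ex_least b1 [set x | le x b1 /\ ~ le x b2]) => [x []//|].
    by exists b1; split=> //; exact: le_refl.
  have ulow x : lt x u -> le x b2.
    move=> xu; apply: contrapT => n; apply: (lt_nle xu); apply: hu; split=> //.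
    exact: le_tr (tltW xu) u1.
  have au : lt a u by apply: (nle_lt u1 a1) => ua; apply: nu2; exact: le_tr ua a2.
  case: (tree_cases u) => [nu|[p pu]|lu].
  - by case: (nu a).
  - have p2 : lt p b2.
      split; first by apply: ulow; exact: succ_lt.
      by move=> E; subst p; apply: n21; exact: le_tr (tltW (succ_lt pu)) u1.
    have [v [pv v2]] := next_ex p2.
    exists p, u, v; split=> //.
    + exact: succ_le pu au.
    + by exists b1.
    + by exists b2.
    + by move=> E; subst v.
  - have [r [ru nr]] := limit_sep lu nu2.
    by case: nr; exact: ulow.
move=> EB; split.
  have [[a Ga] _] := EB; have [p [u [v [ap [b [Gb ub]] _ [pu _] _]]]] := split2 a EB Ga.
  by exists u, p, a, b.
move=> t [p [a [b [Ga Gb ap pt tb]]]].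
have [q [u [v [bq [c [Gc uc]] [d [Gd vd]] [qu qv] nuv]]]] := split2 b EB Gb.
exists u, v; split.
- by split; [exists q, b, c|exists q, b, d].
- exact: le_tr tb (le_tr bq (tltW (succ_lt qu))).
- exact: le_tr tb (le_tr bq (tltW (succ_lt qv))).
- by move=> uv; apply: nuv; exact: succ_next_uniq qu qv uv (le_refl v).
- by move=> vu; apply: nuv; exact: succ_next_uniq qu qv (le_refl u) vu.
Qed.

End TreeOrder.

(** * Membership in C_0 through continuity and finite covers by segments *)

Section C0Theory.
Variables (T : Type) (le : T -> T -> Prop) (Htree : is_tree le) (R : realType).
Local Notation lt := (tlt le).
Implicit Types (f g : T -> R) (x y t : T).

Definition basic_nbhs (ps : seq (sb_index T)) x := forall p, List.In p ps -> subbasic le p x.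

Definition pcont f := forall x (e : R), 0 < e ->
  exists ps, basic_nbhs ps x /\ forall y, basic_nbhs ps y -> `|f y - f x| < e.

(** Elementary substitute for compactness: for continuous f the set where |f| >= e is closed, so it
    is compact once finitely many segments (0,t] cover it. *)
Definition chain_bounded f := forall e : R, 0 < e ->
  exists ts : seq T, forall x, e <= `|f x| -> exists t, List.In t ts /\ le x t.

Lemma basic_nbhs_cat ps qs x :
  basic_nbhs (ps ++ qs) x <-> basic_nbhs ps x /\ basic_nbhs qs x.
Proof.
split=> [h|[h1 h2] p]; last by rewrite List.in_app_iff => -[/h1|/h2].
by split=> p hp; apply: h; rewrite List.in_app_iff; [left|right].
Qed.

Lemma tree_contP f : tree_continuous le f <-> pcont f.
Proof.
split=> [h x e e0|h V oV x Vx].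
  have [|ps [h1 h2]] := h (ball (f x) e) _ x (ballxx _ e0).
    exact: ball_open.
  by exists ps; split=> // y /h2; rewrite /ball /= distrC.
have /nbhs_ballP[e e0 he] : nbhs (f x) V by apply: open_nbhs_nbhs; split.
have [ps [h1 h2]] := h x e e0.
by exists ps; split=> // y /h2 hy; apply: he; rewrite /ball /= distrC.
Qed.

Lemma basic_nbhs_left ps x s : basic_nbhs ps x -> lt s x ->
  exists r, lt r x /\ forall y, lt r y -> le y x -> basic_nbhs ps y.
Proof.
move=> hx sx; case: (tree_cases Htree x) => [n|[p px]|lx].
- by case: (n s).
- exists p; split=> [|y py yx]; first exact: (succ_lt Htree px).
  suff -> : y = x by [].
  by case: (le_eq_lt yx) => // yx1; case: (lt_nle Htree py (succ_le px yx1)).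
have [r [rx hr]] := seq_sep Htree (List.map snd ps) lx.
exists r; split=> // y ry yx p ip; have := hx p ip; rewrite /subbasic.
case: ifP => [_ xp|_ nxp yp]; first exact: (le_tr Htree yx (xp : le x p.2)).
apply: (hr p.2 _ nxp); first exact: List.in_map.
exact: (le_tr Htree (tltW ry) (yp : le y p.2)).
Qed.

(** Transfinite induction: the member of the cover that contains t contains some interval (r,t], and
    (0,r] is finitely covered already. *)
Lemma down_compact t : tree_compact le (Defs.down le t).
Proof.
apply: (tlt_ind Htree (P := fun t => tree_compact le (Defs.down le t))) t => t IH F oF cF.
have [U [FU Ut]] := cF t (le_refl Htree t).
have [ps [h1 h2]] := oF U FU t Ut.
case: (pselect (exists s, lt s t)) => [[s st]|n]; last first.
  exists [:: U]; split=> [V [<-|]//|x xt]; exists U; split; first by left.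
  by case: (le_eq_lt (xt : le x t)) => [->//|xt1]; case: n; exists x.
have [r [rt hr]] := basic_nbhs_left h1 st.
have [fs [hF hc]] : exists fs : seq (set T), (forall U, List.In U fs -> F U) /\
      (forall x, Defs.down le r x -> exists U, List.In U fs /\ U x).
  by apply: IH => // x xr; apply: cF; exact: (le_tr Htree (xr : le x r) (tltW rt)).
exists (U :: fs); split=> [V [<-//|]|x xt]; first exact: hF.
case: (pselect (le x r)) => [/hc[V [iV Vx]]|nxr]; first by exists V; split=> //; right.
exists U; split; first by left.
by apply: h2; apply: hr => //; exact: (nle_lt Htree (xt : le x t) (tltW rt)).
Qed.

Lemma chain_bounded_compact (K : set T) (ts : seq T) :
  (forall x, K x -> exists t, List.In t ts /\ le x t) -> tree_open le (~` K) ->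
  tree_compact le K.
Proof.
move=> hK oK F oF cF.
have cov (us : seq T) : exists fs, (forall U, List.In U fs -> F U) /\
   (forall x, K x -> (exists t, List.In t us /\ le x t) -> exists U, List.In U fs /\ U x).
  elim: us => [|t us [fs [h1 h2]]]; first by exists [::]; split=> // x _ [t []].
  (* The complement of K completes the cover to one of the whole segment and is discarded
     afterwards. *)
  pose F' := fun U => F U \/ U = ~` K.
  have [|x xt|gs [g1 g2]] := @down_compact t F'.
  - by move=> U [/oF//|->].
  - case: (pselect (K x)) => [/cF[U [FU Ux]]|nK]; first by exists U; split=> //; left.
    by exists (~` K); split=> //; right.
  pose gs' := [seq U <- gs | `[< F U >]].
  exists (fs ++ gs'); split=> [U|x Kx [s [[<-|isu] xs]]].
  - rewrite List.in_app_iff => -[/h1//|]; rewrite /gs'.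
    elim: (gs) => //= V l IHl; case: ifP => [/asboolP FV|_ /IHl//].
    by case=> [<-//|/IHl].
  - have [U [iU Ux]] := g2 x xs.
    exists U; split=> //; rewrite List.in_app_iff; right.
    have FU : F U by case: (g1 U iU) => // E; subst U.
    rewrite /gs'; elim: (gs) iU => //= V l IHl [E|/IHl h].
      by subst V; case: ifP => [_|/asboolP//]; left.
    by case: ifP => _ //; right.
  - have [U [iU Ux]] := h2 x Kx (ex_intro _ s (conj isu xs)).
    by exists U; split=> //; rewrite List.in_app_iff; left.
have [fs [h1 h2]] := cov ts.
by exists fs; split=> // x Kx; apply: h2 => //; exact: hK.
Qed.

Lemma C0P f : C0 le f <-> pcont f /\ chain_bounded f.
Proof.
split=> [[/tree_contP cf h]|[cf h]].
  split=> // e e0.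
  have [|x hx|fs [h1 h2]] := h e e0 [set U | exists t, U = Defs.down le t].
  - move=> U [t ->] x xt; exists [:: (true, t)]; split=> [p [<-|]//|y hy].
    by apply: (hy (true, t)); left.
  - by exists (Defs.down le x); split; [exists x|exact: (le_refl Htree x)].
  have [ts hts] : exists ts : seq T, forall U, List.In U fs ->
      exists t, List.In t ts /\ U = Defs.down le t.
    elim: (fs) h1 => [_|U l IHl hl]; first by exists [::].
    have [|ts hts] := IHl; first by move=> V hV; apply: hl; right.
    have [t Ut] := hl U (or_introl erefl).
    exists (t :: ts) => V [<-|/hts[t' [it' Vt']]]; first by exists t; split=> //; left.
    by exists t'; split=> //; right.
  exists ts => x /h2[U [/hts[t [it ->]] Ux]]; by exists t.
split=> [|e e0]; first exact/tree_contP.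
have [ts hts] := h e e0; apply: (chain_bounded_compact (ts := ts)) => // x /= nx.
have fx : `|f x| < e by rewrite ltNge; apply/negP.
have [ps [h1 h2]] := cf x (e - `|f x|) (eqbRL (subr_gt0 _ _) fx).
exists ps; split=> // y /h2 hy; apply/negP; rewrite -ltNge.
have := ler_normD (f y - f x) (f x); rewrite subrK => h3.
by apply: (le_lt_trans h3); rewrite -ltrBrDr.
Qed.

Lemma C0_lin a f g : C0 le f -> C0 le g -> C0 le (fadd (fscale a f) g).
Proof.
move=> /C0P[cf bf] /C0P[cg bg]; apply/C0P; split=> [x e e0|e e0].
  have a1 : 0 < `|a| + 1 by rewrite ltr_wpDl.
  have [ps [p1 p2]] := cf x (e / 2 / (`|a| + 1)) (divr_gt0 (divr_gt0 e0 (ltr0Sn _ _)) a1).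
  have [qs [q1 q2]] := cg x (e / 2) (divr_gt0 e0 (ltr0Sn _ _)).
  exists (ps ++ qs); split=> [|y /basic_nbhs_cat[/p2 hp /q2 hq]].
    by apply/basic_nbhs_cat.
  rewrite /fadd /fscale.
  have -> : a * f y + g y - (a * f x + g x) = a * (f y - f x) + (g y - g x) by ring.
  apply: (le_lt_trans (ler_normD _ _)); rewrite normrM (splitr e) ltr_leD //; last exact: ltW.
  rewrite ltr_pdivlMr // in hp.
  apply: le_lt_trans hp; rewrite mulrC; apply: ler_wpM2l => //; by rewrite lerDl.
have a1 : 0 < `|a| + 1 by rewrite ltr_wpDl.
have [ts hts] := bf (e / 2 / (`|a| + 1)) (divr_gt0 (divr_gt0 e0 (ltr0Sn _ _)) a1).
have [us hus] := bg (e / 2) (divr_gt0 e0 (ltr0Sn _ _)).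
exists (ts ++ us) => x hx.
case: (leP (e / 2) `|g x|) => [/hus[t [it xt]]|gx].
  by exists t; split=> //; rewrite List.in_app_iff; right.
have [|t [it xt]] := hts x.
  rewrite ler_pdivrMr // leNgt; apply/negP => fx; move: hx; rewrite leNgt => /negP; apply.
  rewrite /fadd /fscale; apply: (le_lt_trans (ler_normD _ _)).
  rewrite normrM (splitr e) ler_ltD //; apply/ltW/le_lt_trans/fx.
  by rewrite mulrC; apply: ler_wpM2l => //; rewrite lerDl.
by exists t; split=> //; rewrite List.in_app_iff; left.
Qed.

Lemma C0_0 : C0 le (fun _ => 0 : R).
Proof.
apply/C0P; split=> [x e e0|e e0]; first by exists [::]; split=> // y _; rewrite subrr normr0.
by exists [::] => x; rewrite normr0 leNgt e0.
Qed.

Lemma C0_ext f g : (forall x, f x = g x) -> C0 le f -> C0 le g.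
Proof. by move=> h; rewrite (_ : f = g) //; apply: funext. Qed.

Lemma C0_add f g : C0 le f -> C0 le g -> C0 le (fadd f g).
Proof.
move=> hf hg; apply: C0_ext (C0_lin 1 hf hg) => x.
by rewrite /fadd /fscale mul1r.
Qed.

Lemma C0_scale a f : C0 le f -> C0 le (fscale a f).
Proof.
move=> hf; apply: C0_ext (C0_lin a hf C0_0) => x.
by rewrite /fadd /fscale addr0.
Qed.

Definition ind t : T -> R := fun x => if `[< le x t >] then 1 else 0.

Lemma ind_in t x : le x t -> ind t x = 1. Proof. by rewrite /ind => h; rewrite asboolT. Qed.
Lemma ind_out t x : ~ le x t -> ind t x = 0. Proof. by rewrite /ind => h; rewrite asboolF. Qed.

Lemma C0_ind t : C0 le (ind t).
Proof.
apply/C0P; split=> [x e e0|e e0]; last first.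
  exists [:: t] => x; rewrite /ind; case: asboolP => [xt _|_]; first by exists t; split=> //; left.
  by rewrite normr0 leNgt e0.
case: (pselect (le x t)) => h.
  exists [:: (true, t)]; split=> [p [<-|]//|y /(_ (true, t) (or_introl erefl)) hy].
  by rewrite !ind_in // subrr normr0.
exists [:: (false, t)]; split=> [p [<-|]//|y /(_ (false, t) (or_introl erefl)) hy].
by rewrite !ind_out // subrr normr0.
Qed.

Lemma C0_left f l e : C0 le f -> 0 < e -> limit_height le l ->
  exists r, lt r l /\ forall y, lt r y -> le y l -> `|f y - f l| < e.
Proof.
move=> /C0P[cf _] e0 ll; have [ps [h1 h2]] := cf l e e0.
have [s sl] := ll.1; have [r [rl hr]] := basic_nbhs_left h1 sl.
by exists r; split=> // y ry yl; apply: h2; exact: hr.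
Qed.

(** The limit is taken pointwise as the supremum of the lower bounds [f m x - e m], each of which is
    at most [f n x + e n] for every n. *)
Lemma C0_ulim (f : nat -> T -> R) (e : nat -> R) :
  (forall n, C0 le (f n)) -> (forall (n m : nat) x, (n <= m)%N -> `|f m x - f n x| <= e n) ->
  (forall d : R, 0 < d -> exists n, e n < d) ->
  exists g, C0 le g /\ forall n x, `|g x - f n x| <= e n.
Proof.
move=> hf he e0.
have en n x : 0 <= e n by apply: le_trans (he n n x (leqnn n)).
pose S x := [set f m x - e m | m in [set: nat]].
have ub n x : ubound (S x) (f n x + e n).
  move=> _ [m _ <-]; case: (leqP n m) => h.
    have := he n m x h; rewrite ler_norml => /andP[_].
    by have := en m x; lra.
  have := he m n x (ltnW h); rewrite ler_norml => /andP[h1 _].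
  by have := en n x; lra.
have S0 x : S x !=set0 by exists (f 0%N x - e 0%N); exists 0%N.
pose g x := sup (S x).
have gf n x : `|g x - f n x| <= e n.
  rewrite ler_norml; apply/andP; split.
    have : f n x - e n <= g x.
      apply: sup_upper_bound; first by split=> //; exists (f 0%N x + e 0%N); exact: ub.
      by exists n.
    by lra.
  have : g x <= f n x + e n by apply: ge_sup.
  by lra.
exists g; split=> //; apply/C0P; split=> [x d d0|d d0].
  have [n hn] := e0 (d / 3) (divr_gt0 d0 (ltr0Sn _ _)).
  have /C0P[cf _] := hf n.
  have [ps [h1 h2]] := cf x (d / 3) (divr_gt0 d0 (ltr0Sn _ _)).
  exists ps; split=> // y /h2; have := gf n x; have := gf n y.
  rewrite !ler_norml !ltr_norml => /andP[? ?] /andP[? ?] /andP[? ?].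
  by apply/andP; split; lra.
have [n hn] := e0 (d / 2) (divr_gt0 d0 (ltr0Sn _ _)).
have /C0P[_ bf] := hf n.
have [ts hts] := bf (d / 2) (divr_gt0 d0 (ltr0Sn _ _)).
exists ts => x hx; apply: hts.
have := gf n x; have := ler_normD (g x - f n x) (f n x); rewrite subrK; lra.
Qed.

End C0Theory.

Section Supn.
Variable R : realType.

Lemma supn_ge0 (S : Type) (f : S -> R) : 0 <= supn f.
Proof.
rewrite /supn; case: (pselect (has_sup [set `|f s| | s in [set: S]])) => [h|h].
  have [[y [s _ ys]] _] := h.
  by apply: le_trans (normr_ge0 (f s)) _; apply: sup_upper_bound => //; exists s.
by rewrite sup_out.
Qed.

Lemma supn_le (S : Type) (f : S -> R) (B : R) : 0 <= B -> (forall s, `|f s| <= B) -> supn f <= B.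
Proof.
move=> B0 h; rewrite /supn.
case: (pselect ([set `|f s| | s in [set: S]] !=set0)) => [ne|/nonemptyPn ne].
  by apply: ge_sup => // _ [s _ <-].
by rewrite ne sup0.
Qed.

Lemma supn_ub (S : Type) (f : S -> R) (B : R) s : (forall s, `|f s| <= B) -> `|f s| <= supn f.
Proof.
move=> h; apply: sup_upper_bound; last by exists s.
by split; [exists `|f s|; exists s|exists B => _ [r _ <-]].
Qed.

End Supn.

(** * Boundedness, attained suprema and maximal nodes *)

Section C0Sup.
Variables (T : Type) (le : T -> T -> Prop) (Htree : is_tree le) (R : realType).
Local Notation lt := (tlt le).
Implicit Types (f g : T -> R) (x y t : T).

(** Compactness of (0,t] in the form of an induction. [P] is the class of permitted bounds: all
    reals give boundedness, the reals in [0, sup) give attainment of the supremum. *)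
Lemma down_bounded (P : R -> Prop) (phi : T -> R) :
  (forall a b, P a -> P b -> P (Order.max a b)) ->
  (forall x, exists ps b, [/\ P b, basic_nbhs le ps x &
     forall y, basic_nbhs le ps y -> phi y <= b]) ->
  forall t, exists b, P b /\ forall y, le y t -> phi y <= b.
Proof.
move=> Pmax h; apply: (tlt_ind Htree) => t IH.
have [ps [b [Pb h1 h2]]] := h t.
case: (pselect (exists s, lt s t)) => [[s st]|n]; last first.
  exists b; split=> // y yt; case: (le_eq_lt yt) => [->|yt']; first exact: h2.
  by case: n; exists y.
have [r [rt hr]] := basic_nbhs_left Htree h1 st.
have [c [Pc hc]] := IH r rt.
exists (Order.max b c); split=> [|y yt]; first exact: Pmax.
rewrite le_max; case: (pselect (le y r)) => [/hc ->|nyr]; first by rewrite orbT.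
by rewrite h2 //; apply: hr => //; exact: (nle_lt Htree yt (tltW rt)).
Qed.

Lemma C0_bounded_below f (P : R -> Prop) (e : R) : C0 le f -> 0 < e -> P e ->
  (forall a b, P a -> P b -> P (Order.max a b)) ->
  (forall x, exists d : R, 0 < d /\ P (`|f x| + d)) ->
  exists b, P b /\ forall x, `|f x| <= b.
Proof.
move=> /C0P-/(_ Htree)[cf bf] e0 Pe Pmax h.
have [ts hts] := bf e e0.
have down_b t : exists b, P b /\ forall y, le y t -> `|f y| <= b.
  apply: (@down_bounded P (fun x => `|f x|)) => // x.
  have [d [d0 Pd]] := h x; have [ps [h1 h2]] := cf x d d0.
  exists ps, (`|f x| + d); split=> // y /h2 hy.
  have := ler_normD (f y - f x) (f x); rewrite subrK; lra.
have [b [Pb hb]] : exists b, P b /\ forall t, List.In t ts -> forall y, le y t -> `|f y| <= b.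
  elim: (ts) => [|t us [b [Pb hb]]]; first by exists e; split.
  have [c [Pc hc]] := down_b t.
  exists (Order.max b c); split=> [|u [<- y /hc|iu y yu]]; first exact: Pmax.
    by rewrite le_max => ->; rewrite orbT.
  by rewrite le_max (hb _ iu).
exists (Order.max e b); split=> [|x]; first exact: Pmax.
rewrite le_max; case: (leP `|f x| e) => //= /ltW /hts[t [it xt]].
exact: hb xt.
Qed.

Lemma C0_bounded f : C0 le f -> exists B : R, forall x, `|f x| <= B.
Proof.
move=> hf; have [|b [_ hb]] := @C0_bounded_below f (fun _ => True) 1 hf ltr01 I (fun _ _ _ _ => I).
  by move=> x; exists 1; split.
by exists b.
Qed.

Lemma C0_le_supn f x : C0 le f -> `|f x| <= supn f.
Proof. by move=> /C0_bounded[B hB]; apply: supn_ub hB. Qed.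

Lemma C0_supn_gt0 f : C0 le f -> nonzero f -> 0 < supn f.
Proof.
move=> hf [t nt]; apply: lt_le_trans (C0_le_supn t hf); by rewrite normr_gt0.
Qed.

Lemma C0_supn_attained f : C0 le f -> nonzero f -> exists t, `|f t| = supn f.
Proof.
move=> hf nf; have s0 := C0_supn_gt0 hf nf; apply: contrapT => n.
have hlt x : `|f x| < supn f.
  by rewrite lt_neqAle C0_le_supn // andbT; apply/eqP => E; apply: n; exists x.
have [||||b [Pb hb]] := @C0_bounded_below f (fun b => 0 <= b < supn f) (supn f / 2) hf.
- by rewrite divr_gt0.
- by lra.
- move=> a b /andP[a0 aS] /andP[b0 bS]; case: (leP a b) => _; apply/andP; split=> //.
- move=> x; exists ((supn f - `|f x|) / 2); have := hlt x; have := normr_ge0 (f x).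
  by move=> ? ?; split; [lra|apply/andP; split; lra].
case/andP: Pb => b0 bS; have := supn_le b0 hb; lra.
Qed.

Lemma supn_add f g : C0 le f -> C0 le g -> supn (fadd f g) <= supn f + supn g.
Proof.
move=> hf hg; apply: supn_le => [|x]; first by rewrite addr_ge0 // supn_ge0.
by rewrite /fadd (le_trans (ler_normD _ _)) // lerD // C0_le_supn.
Qed.

Lemma supn_scale a f : C0 le f -> supn (fscale a f) = `|a| * supn f.
Proof.
have aux b g : C0 le g -> supn (fscale b g) <= `|b| * supn g.
  move=> hg; apply: supn_le => [|x]; first by rewrite mulr_ge0 // supn_ge0.
  by rewrite /fscale normrM ler_wpM2l // C0_le_supn.
move=> hf; apply/eqP; rewrite eq_le aux //=.
case: (eqVneq a 0) => [->|a0]; first by rewrite normr0 mul0r supn_ge0.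
have := aux a^-1 _ (C0_scale Htree a hf).
have -> : fscale a^-1 (fscale a f) = f.
  by apply: funext => x; rewrite /fscale mulrA mulVf // mul1r.
by rewrite normfV ler_pdivlMl // normr_gt0.
Qed.

(** Zorn's lemma: a chain in A lies below one of the finitely many nodes t that cover the set |f| >=
    e, hence has a least upper bound, which is either reached by the chain or a limit of members of
    A. *)
Lemma C0_max f (e : R) (A : set T) : C0 le f -> 0 < e -> (forall x, A x -> e <= `|f x|) ->
  A !=set0 ->
  (forall l, limit_height le l ->
     (forall r, lt r l -> exists a, [/\ A a, lt r a & lt a l]) -> A l) ->
  exists m, A m /\ forall x, A x -> le m x -> x = m.
Proof.
move=> /C0P-/(_ Htree)[_ bf] e0 hA [a0 Aa0] lA.
have [ts hts] := bf e e0.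
pose S := {x : T | A x}.
pose r (s t : S) := `[< le (sval s) (sval t) >].
have [s|x y z /asboolP h1 /asboolP h2|x y /asboolP h1 /asboolP h2|B totB|m hm] := @Zorn S r.
- apply/asboolP; exact: (le_refl Htree).
- apply/asboolP; exact (le_tr Htree h1 h2).
- case: x h1 h2 => x Ax; case: y => y Ay /= h1 h2.
  have E := le_anti Htree h1 h2; subst y; congr exist; exact: Prop_irrelevance.
- case: (pselect (B !=set0)) => [[b0 Bb0]|nB]; last first.
    by exists (exist _ a0 Aa0) => s Bs; case: nB; exists s.
  (* Otherwise choose for each t of the finite list a member of the chain not below t; the largest
     of these is below no t, although it lies in A. *)
  have [t [it ht]] : exists t, List.In t ts /\ forall b, B b -> le (sval b) t.
    apply: contrapT => n.
    have [b [Bb hb]] : exists b, B b /\ forall t, List.In t ts -> ~ le (sval b) t.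
      have {n} : forall t, List.In t ts -> exists b, B b /\ ~ le (sval b) t.
        move=> t it; apply: contrapT => n'; apply: n; exists t; split=> // b Bb.
        by apply: contrapT => nb; apply: n'; exists b.
      elim: (ts) => [|t us IH] h; first by exists b0.
      have [|b [Bb hb]] := IH; first by move=> u iu; apply: h; right.
      have [c [Bc hc]] := h t (or_introl erefl).
      case: (totB b c Bb Bc) => /asboolP bc.
        exists c; split=> // u [<-//|iu] cu; apply: (hb u iu); exact (le_tr Htree bc cu).
      exists b; split=> // u [<-|iu] bu; last exact: (hb u iu).
      apply: hc; exact (le_tr Htree bc bu).
    by have [t [it bt]] := hts _ (hA _ (svalP b)); exact: (hb t it).
  have [l [hl1 hl2]] : exists m, (le m t /\ forall b, B b -> le (sval b) m) /\
      forall a, (le a t /\ forall b, B b -> le (sval b) a) -> le m a.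
    apply: (ex_least Htree (t := t) (A := [set a | le a t /\ forall b, B b -> le (sval b) a])).
      by move=> a [].
    by exists t; split=> //; exact: le_refl Htree t.
  suff Al : A l by exists (exist _ l Al) => s Bs; apply/asboolP; exact: hl1.2.
  case: (pselect (exists b, B b /\ sval b = l)) => [[b [_ <-]]|nb]; first exact: svalP.
  have dense q : lt q l -> exists a, [/\ A a, lt q a & lt a l].
    move=> ql.
    have [b [Bb nbq]] : exists b, B b /\ ~ le (sval b) q.
      apply: contrapT => n; apply: (lt_nle Htree ql); apply: hl2; split.
        exact (le_tr Htree (tltW ql) hl1.1).
      by move=> b Bb; apply: contrapT => n'; apply: n; exists b.
    exists (sval b); split; first exact: svalP.
      exact: (nle_lt Htree (hl1.2 _ Bb) (tltW ql)).
    by split; [exact: hl1.2|move=> E; apply: nb; exists b].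
  apply: lA => //; case: (tree_cases Htree l) => [n|[p pl]|//].
    case: (le_eq_lt (hl1.2 _ Bb0)) => [E|bl]; last by case: (n (sval b0)).
    by case: nb; exists b0.
  have [a [_ pa al]] := dense p (succ_lt Htree pl).
  by case: (lt_nle Htree pa (succ_le pl al)).
case: m hm => m Am hm; exists m; split=> // x Ax mx.
by have := hm (exist _ x Ax); rewrite /r /= => -/(_ (asboolT mx)) [].
Qed.

End C0Sup.

(** * From a Frechet differentiable norm to an increasing function *)

Lemma pow2_neq0 (R : realType) (n : nat) : 2 ^+ n != 0 :> R.
Proof. by rewrite expf_neq0 // pnatr_eq0. Qed.

Lemma div_pow2_lt (R : realType) (c d : R) : 0 <= c -> 0 < d -> exists n : nat, c / 2 ^+ n < d.
Proof.
move=> c0 d0; exists (Num.bound (c / d)); rewrite ltr_pdivrMr ?exprn_gt0 //.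
rewrite -ltr_pdivrMl // mulrC; apply: lt_trans (archi_boundP _) _.
  by rewrite divr_ge0 // ltW.
by rewrite -natrX ltr_nat ltn_expl.
Qed.

(** * Quotient norms along a branch, and when their infimum is attained *)

Section QuotientNorm.
Variables (T : Type) (le : T -> T -> Prop) (Htree : is_tree le) (R : realType).
Local Notation lt := (tlt le).
Local Notation C0 := (C0 le).
Local Notation ind := (@ind T le R).
Variables (N : (T -> R) -> R) (a b : R).
Hypothesis Ntri : forall f g, C0 f -> C0 g -> N (fadd f g) <= N f + N g.
Hypothesis Nscale : forall c f, C0 f -> N (fscale c f) = `|c| * N f.
Hypothesis a0 : 0 < a.
Hypothesis b0 : 0 < b.
Hypothesis Nlow : forall f, C0 f -> a * supn f <= N f.
Hypothesis Nup : forall f, C0 f -> N f <= b * supn f.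
Implicit Types (f g : T -> R) (x y t l w s u : T).

Lemma N_ge0 f : C0 f -> 0 <= N f.
Proof. by move=> hf; apply: le_trans (Nlow hf); rewrite mulr_ge0 ?supn_ge0 // ltW. Qed.

Lemma N_ge_val f x : C0 f -> a * `|f x| <= N f.
Proof.
by move=> hf; apply: le_trans (Nlow hf); rewrite ler_pM2l // (C0_le_supn Htree).
Qed.

Lemma N_lip f g (d : R) : C0 f -> C0 g -> 0 <= d -> (forall x, `|f x - g x| <= d) ->
  N f <= N g + b * d.
Proof.
move=> hf hg d0 h; pose k := fadd (fscale (-1) g) f.
have hk : C0 k by exact: C0_lin.
have -> : f = fadd g k by apply: funext => x; rewrite /k /fadd /fscale; ring.
apply: le_trans (Ntri hg hk) _; rewrite lerD2l; apply: le_trans (Nup hk) _.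
rewrite ler_pM2l //; apply: supn_le => // x.
by rewrite /k /fadd /fscale mulN1r addrC.
Qed.

Definition cls g w f := C0 f /\ forall x, ~ lt w x -> f x = g x.

(** The quotient norm of g modulo the functions supported strictly above w. *)
Definition J g w : R := inf [set N f | f in [set f | cls g w f]].

Lemma J_le g w f : cls g w f -> J g w <= N f.
Proof.
move=> hf; apply: ge_inf; last by exists f.
by exists 0 => y [k [hk _] <-]; exact: N_ge0.
Qed.

Lemma J_ge g w (c : R) : C0 g -> (forall f, cls g w f -> c <= N f) -> c <= J g w.
Proof.
move=> hg h; apply: lb_le_inf; first by exists (N g); exists g.
by move=> y [k hk <-]; exact: h.
Qed.

Lemma J_near g w (e : R) : C0 g -> 0 < e -> exists f, cls g w f /\ N f < J g w + e.
Proof.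
move=> hg e0; have [|y [f hf <-] h] := @inf_adherent _ [set N f | f in [set f | cls g w f]] e e0.
  split; first by exists (N g); exists g.
  by exists 0 => y [k [hk _] <-]; exact: N_ge0.
by exists f.
Qed.

Lemma J_mono g g' w w' : le w w' -> C0 g' -> (forall x, ~ lt w x -> g' x = g x) ->
  J g w <= J g' w'.
Proof.
move=> ww' hg' h; apply: J_ge => // f [hf fg]; apply: J_le; split=> // x nwx.
by rewrite fg ?h // => w'x; apply: nwx; exact: (le_lt Htree ww' w'x).
Qed.

Lemma J_ge_val g w : C0 g -> a * `|g w| <= J g w.
Proof.
move=> hg; apply: J_ge => // f [hf fg]; rewrite -fg; last exact: lt_irr.
exact: N_ge_val.
Qed.

Lemma J_lip g g' w (d : R) : C0 g -> C0 g' -> 0 <= d -> (forall x, `|g x - g' x| <= d) ->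
  J g w <= J g' w + b * d.
Proof.
move=> hg hg' d0 h; rewrite -lerBlDr; apply: J_ge => // f [hf fg].
rewrite lerBlDr.
pose k := fadd f (fadd (fscale (-1) g') g).
have hk : C0 k by apply: C0_add => //; exact: C0_lin.
have ck : cls g w k.
  by split=> // x nx; rewrite /k /fadd /fscale fg //; ring.
apply: le_trans (J_le ck) _; apply: N_lip => // x.
by rewrite /k /fadd /fscale addrC addKr mulN1r addrC.
Qed.

(** Adds g(l) on the segment (l,w]. For g vanishing above l, as the limits of step functions used
    below do, this prolongs g by its value at l. *)
Definition ext g l w : T -> R := fun x => g x + g l * (ind w x - ind l x).

Lemma C0_ext_shape g l w : C0 g -> C0 (ext g l w).
Proof.
move=> hg; apply: C0_add => //; apply: (C0_scale Htree (g l)).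
apply: (C0_ext (f := fadd (fscale (-1) (ind l)) (ind w))) => [x|].
  by rewrite /fadd /fscale; ring.
by apply: C0_lin => //; exact: C0_ind.
Qed.

Lemma ext_self g l : ext g l l = g.
Proof. by apply: funext => x; rewrite /ext subrr mulr0 addr0. Qed.

Lemma ext_agree g l w w' x : le l w -> le w w' -> ~ lt w x -> ext g l w' x = ext g l w x.
Proof.
move=> lw ww' nx; rewrite /ext; congr (_ + _ * (_ - _)).
case: (pselect (le x w)) => [xw|nxw].
  by rewrite !ind_in //; exact: (le_tr Htree xw ww').
rewrite !ind_out // => xw'; apply: nx; exact: (nle_lt Htree xw' ww').
Qed.

Lemma ext_mono g l w w' : C0 g -> le l w -> le w w' ->
  J (ext g l w) w <= J (ext g l w') w'.
Proof.
move=> hg lw ww'; apply: J_mono => //; first exact: C0_ext_shape.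
by move=> x; apply: ext_agree.
Qed.

Lemma ext_cls g l w w' f : le l w -> le w w' -> cls (ext g l w') w' f -> cls (ext g l w) w f.
Proof.
move=> lw ww' [hf h]; split=> // x nx; rewrite h; first exact: ext_agree.
by move=> w'x; apply: nx; exact: (le_lt Htree ww' w'x).
Qed.

(* The functions almost realising the infimum at infinitely many immediate
   successors of s differ from the extended shape on disjoint sets, so their
   averages converge to it uniformly. *)
Lemma attained_bad g l s m : C0 g -> le l s ->
  (forall (eta : R) (F : seq T), 0 < eta ->
     exists u, [/\ succ le s u, ~ List.In u F & J (ext g l u) u < m + eta]) ->
  N (ext g l s) <= m.
Proof.
move=> hg ls h; set gs := ext g l s.
have hgs : C0 gs by exact: C0_ext_shape.
apply/ler_addgt0Pr => e e0.
have e20 : 0 < e / 2 by rewrite divr_gt0.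
have [B hB] := C0_bounded Htree hgs.
have m0 : 0 <= m + e / 2.
  have [u [_ _ /ltW hu]] := h (e / 2) [::] e20; apply: le_trans hu.
  apply: le_trans (J_ge_val _ _); last exact: C0_ext_shape.
  by rewrite mulr_ge0 // ltW.
pose C := (m + e / 2) / a + B.
have C0' : 0 <= C.
  apply: addr_ge0; first by rewrite divr_ge0 // ltW.
  exact: le_trans (normr_ge0 (gs s)) (hB s).
have [F hF] : exists F : nat -> T -> R, forall k, [/\ C0 (F k), N (F k) <= k%:R * (m + e / 2) &
    forall x, `|F k x - k%:R * gs x| <= C].
  (* The list of successors already used is carried along: the sum equals [k%:R * gs] off the nodes
     above them, so a summand at a fresh successor deviates on a new set and the deviation stays
     below C. *)
  suff H k : exists Fus : (T -> R) * seq T, [/\ C0 Fus.1, N Fus.1 <= k%:R * (m + e / 2),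
      forall x, `|Fus.1 x - k%:R * gs x| <= C,
      (forall u, List.In u Fus.2 -> succ le s u) &
      forall x, Fus.1 x <> k%:R * gs x -> exists u, List.In u Fus.2 /\ le u x].
    have [F hF] := boolp.choice H; exists (fun k => (F k).1) => k; by have [] := hF k.
  elim: k => [|k [[f us] /= [hf Nf fC uss fus]]].
    exists ((fun _ => 0), [::]); split=> //= [||x|x].
    - exact: C0_0.
    - rewrite mul0r; apply: le_trans (Nup (C0_0 Htree R)) _.
      apply: (le_trans (y := b * 0)); last by rewrite mulr0.
      by rewrite ler_pM2l //; apply: supn_le => // x; rewrite normr0.
    - by rewrite mul0r subrr normr0.
    - by rewrite mul0r.
  have [u [su nu Ju]] := h (e / 2) us e20.
  have gap : 0 < m + e / 2 - J (ext g l u) u by rewrite subr_gt0.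
  have [k' [[hk' k'E] Nk']] := J_near u (C0_ext_shape l u hg) gap.
  have Nk : N k' <= m + e / 2 by apply: ltW; move: Nk'; rewrite subrKC.
  have k'C x : `|k' x - gs x| <= C.
    apply: le_trans (ler_normB _ _) _; rewrite /C lerD //.
    by rewrite ler_pdivlMr // mulrC; apply: le_trans (N_ge_val x hk') Nk.
  have k'0 x : ~ le u x -> k' x = gs x.
    move=> nux; rewrite k'E; last by move=> [ux _]; exact: nux.
    rewrite /gs /ext; congr (_ + _ * (_ - _)).
    case: (pselect (le x u)) => [xu|nxu].
      rewrite !ind_in //; apply: (succ_le su); split=> // E; subst x.
      by apply: nux; exact: le_refl.
    rewrite !ind_out // => xs; apply: nxu; exact: (le_tr Htree xs (tltW (succ_lt Htree su))).
  have f0 x : le u x -> f x = k%:R * gs x.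
    move=> ux; apply: contrapT => nE; have [v [iv vx]] := fus x nE.
    apply: nu; by rewrite (succ_next_uniq Htree su (uss _ iv) ux vx).
  exists (fadd f k', u :: us); split=> //= [||x|v [<-//|/uss//]|x].
  - exact: C0_add.
  - rewrite -natr1 mulrDl mul1r; apply: le_trans (Ntri hf hk') _; exact: lerD.
  - rewrite /fadd -natr1 mulrDl mul1r.
    have -> : f x + k' x - (k%:R * gs x + gs x) = (f x - k%:R * gs x) + (k' x - gs x) by ring.
    case: (pselect (le u x)) => [ux|nux]; first by rewrite f0 // subrr add0r.
    by rewrite (k'0 x nux) subrr addr0.
  - rewrite /fadd -natr1 mulrDl mul1r.
    case: (pselect (le u x)) => [ux _|nux]; first by exists u; split=> //; left.
    rewrite (k'0 x nux) => nE; have [|v [iv vx]] := fus x; first by move=> E; apply: nE; rewrite E.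
    by exists v; split=> //; right.
(* After division by k the deviation costs at most b C / k, which is less than e / 2. *)
pose k := (Num.bound (b * C / (e / 2))).+1.
have kb : b * C / (e / 2) < k%:R.
  apply: lt_le_trans (archi_boundP _) _.
    by apply: divr_ge0; [apply: mulr_ge0 => //; exact: ltW|exact: ltW].
  by rewrite ler_nat.
have k0 : 0 < k%:R :> R by rewrite ltr0n.
have [hFk NF FC] := hF k.
have : N (fscale k%:R gs) <= N (F k) + b * C.
  by apply: N_lip => //; [exact: C0_scale|move=> x; rewrite distrC; exact: FC].
rewrite Nscale // normr_nat => H1.
have H2 : k%:R * N gs <= k%:R * (m + e).
  apply: le_trans H1 _; apply: le_trans (lerD NF (lexx _)) _.
  have : b * C <= k%:R * (e / 2) by rewrite -ler_pdivrMr //; exact: ltW.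
  by rewrite (_ : k%:R * (m + e) = k%:R * (m + e / 2) + k%:R * (e / 2)); [lra|field].
by rewrite ler_pM2l in H2.
Qed.


(** * Dyadic averages over an ever-branching set *)

Section Dyadic.
Variables (g : T -> R) (l : T) (G : set T) (m : R) (lft rgt : T -> T).
Hypothesis hg : C0 g.
Hypothesis hG : forall s, G s -> [/\ le l s, G (lft s) /\ G (rgt s), le s (lft s) /\ le s (rgt s),
  ~ le (lft s) (rgt s) & ~ le (rgt s) (lft s)].

Fixpoint avg (F : T -> T -> R) k s : T -> R :=
  if k is k'.+1 then fun x => (avg F k' (lft s) x + avg F k' (rgt s) x) / 2 else F s.

Definition adapted (F : T -> T -> R) :=
  forall s x, G s -> ~ lt s x -> F s x = ext g l s x.

Lemma avg_adapted F k : adapted F -> adapted (avg F k).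
Proof.
move=> hF; elim: k => [//|k IH] s x Gs nx /=.
have [ls [GL GR] [sL sR] _ _] := hG Gs.
have nL : ~ lt (lft s) x by move=> h; apply: nx; exact: (le_lt Htree sL h).
have nR : ~ lt (rgt s) x by move=> h; apply: nx; exact: (le_lt Htree sR h).
rewrite !IH // (ext_agree g ls sL nx) (ext_agree g ls sR nx); by field.
Qed.

Lemma avgS F k : avg F k.+1 = avg (avg F 1) k.
Proof.
elim: k => [//|k IH]; apply: funext => s; apply: funext => x.
by change (avg F k.+2 s x) with ((avg F k.+1 (lft s) x + avg F k.+1 (rgt s) x) / 2); rewrite IH.
Qed.

Lemma avg_C0 F k s : (forall s, G s -> C0 (F s)) -> G s -> C0 (avg F k s).
Proof.
move=> hF; elim: k s => [s Gs|k IH s Gs]; first exact: hF.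
have [_ [GL GR] _ _ _] := hG Gs.
apply: (C0_ext (f := fscale 2^-1 (fadd (avg F k (lft s)) (avg F k (rgt s))))).
  by move=> x; rewrite /fscale /fadd mulrC.
by apply: C0_scale => //; apply: C0_add => //; exact: IH.
Qed.

Lemma avg_N F k s c : (forall s, G s -> C0 (F s) /\ N (F s) <= c) -> G s -> N (avg F k s) <= c.
Proof.
move=> hF; elim: k s => [s Gs|k IH s Gs]; first by have [] := hF s Gs.
have [_ [GL GR] _ _ _] := hG Gs.
have hC s' : G s' -> C0 (avg F k s') by apply: avg_C0 => t /hF[].
have -> : avg F k.+1 s = fscale 2^-1 (fadd (avg F k (lft s)) (avg F k (rgt s))).
  by apply: funext => x; rewrite /fscale /fadd mulrC.
rewrite Nscale; last by apply: C0_add => //; exact: hC.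
rewrite ger0_norm ?invr_ge0 // ler_pdivrMl //; apply: le_trans (Ntri (hC _ GL) (hC _ GR)) _.
by have := IH _ GL; have := IH _ GR; lra.
Qed.

(** As [lft s] and [rgt s] are incomparable, at most one of the two averaged differences is non-zero
    at a given x; so each level halves the bound. *)
Lemma avg_close F F' K k s x : adapted F -> adapted F' -> 0 <= K ->
  (forall s x, G s -> `|F s x - F' s x| <= K) -> G s ->
  `|avg F k s x - avg F' k s x| <= K / 2 ^+ k.
Proof.
move=> aF aF' K0 h; elim: k s x => [s x Gs|k IH s x Gs]; first by rewrite divr1; exact: h.
have [_ [GL GR] [sL sR] nLR nRL] := hG Gs; rewrite /=.
have zero s' : G s' -> ~ lt s' x -> avg F k s' x - avg F' k s' x = 0.
  by move=> Gs' ns'; rewrite !avg_adapted // subrr.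
have -> : (avg F k (lft s) x + avg F k (rgt s) x) / 2 - (avg F' k (lft s) x + avg F' k (rgt s) x) / 2
  = ((avg F k (lft s) x - avg F' k (lft s) x) + (avg F k (rgt s) x - avg F' k (rgt s) x)) / 2 by field.
have -> : K / 2 ^+ k.+1 = K / 2 ^+ k / 2 by rewrite exprS; field; exact: pow2_neq0.
rewrite normrM [`|2^-1|]ger0_norm ?invr_ge0 //; apply: ler_wpM2r; first by rewrite invr_ge0.
case: (pselect (lt (lft s) x)) => [Lx|nLx]; last by rewrite zero // add0r; exact: IH.
rewrite (zero _ GR) ?addr0; first exact: IH.
by move=> Rx; case: (below_total Htree (tltW Lx) (tltW Rx)).
Qed.

End Dyadic.

(** The averages of the shapes [ext g l s] converge uniformly to some f. Averaging instead, at depth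
    n, functions of norm at most m + 2^-n gives norm at most m + 2^-n, and this average differs from
    that of the shapes by at most C / 2^n. Hence N f <= m. *)
Lemma attained_branching g l (G : set T) m s0 : C0 g -> G s0 ->
  (forall s, G s -> [/\ le l s, J (ext g l s) s <= m &
     exists u v, [/\ G u /\ G v, le s u, le s v, ~ le u v & ~ le v u]]) ->
  exists f, cls (ext g l s0) s0 f /\ N f <= m.
Proof.
move=> hg G0 hG.
have /boolp.choice[lr hlr] : forall s, exists p : T * T, G s -> [/\ le l s, G p.1 /\ G p.2,
    le s p.1 /\ le s p.2, ~ le p.1 p.2 & ~ le p.2 p.1].
  move=> s; case: (pselect (G s)) => [Gs|nG]; last by exists (s, s).
  by have [ls _ [u [v [? ? ? ? ?]]]] := hG s Gs; exists (u, v).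
pose lft s := (lr s).1; pose rgt s := (lr s).2.
have [phi hphi] : exists phi : nat -> T -> T -> R, forall n s, G s ->
    cls (ext g l s) s (phi n s) /\ N (phi n s) <= m + 1 / 2 ^+ n.
  have /boolp.choice[phi hphi] : forall p : nat * T, exists f, G p.2 ->
      cls (ext g l p.2) p.2 f /\ N f <= m + 1 / 2 ^+ p.1.
    move=> [n s] /=.
    case: (pselect (G s)) => [Gs|nG]; last by exists g.
    have [ls Js _] := hG s Gs.
    have [f [cf Nf]] := @J_near (ext g l s) s (1 / 2 ^+ n) (C0_ext_shape l s hg) (divr_gt0 ltr01 (exprn_gt0 _ (ltr0Sn _ _))).
    by exists f => _; split=> //; apply: ltW; lra.
  by exists (fun n s => phi (n, s)) => n s; exact: (hphi (n, s)).
have [B hB] := C0_bounded Htree hg.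
have B0 : 0 <= B by exact: le_trans (normr_ge0 (g s0)) (hB s0).
have extB s x : `|ext g l s x| <= 3 * B.
  rewrite /ext; apply: le_trans (ler_normD _ _) _; rewrite normrM.
  have := hB x; have := hB l; have := normr_ge0 (g l).
  have : `|ind s x - ind l x| <= 1.
    by rewrite /ind; case: asboolP; case: asboolP => _ _;
      rewrite ?subrr ?subr0 ?sub0r ?normrN ?normr0 ?normr1.
  have := normr_ge0 (ind s x - ind l x); nra.
pose E s := ext g l s.
pose A := avg lft rgt E.
have adE : adapted g l G E by [].
have CE s : G s -> C0 (E s) by move=> _; exact: C0_ext_shape.
have GA k s : G s -> C0 (A k s) by exact: (avg_C0 hlr).
(* An average of depth k+1 is one of depth k of one-step averages, and these differ from the shapes
   by at most 3B + 3B. *)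
have step k x : `|A k.+1 s0 x - A k s0 x| <= 6 * B / 2 ^+ k.
  rewrite /A avgS; apply: (avg_close hlr) => //.
  - exact: (avg_adapted hlr).
  - by rewrite mulr_ge0.
  - move=> s y Gs; rewrite /= /E.
    have := extB (lft s) y; have := extB (rgt s) y; have := extB s y.
    rewrite !ler_norml => /andP[? ?] /andP[? ?] /andP[? ?]; apply/andP; split; lra.
have cauchy n k x : `|A (n + k)%N s0 x - A n s0 x| <= 12 * B / 2 ^+ n - 12 * B / 2 ^+ (n + k)%N.
  elim: k => [|k IH]; first by rewrite addn0 !subrr normr0.
  rewrite addnS.
  have -> : A (n + k).+1 s0 x - A n s0 x = (A (n + k).+1 s0 x - A (n + k)%N s0 x) + (A (n + k)%N s0 x - A n s0 x) by ring.
  apply: le_trans (ler_normD _ _) _; have := step (n + k)%N x.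
  have -> : 12 * B / 2 ^+ (n + k).+1 = 6 * B / 2 ^+ (n + k)%N.
    by rewrite exprS; field; exact: pow2_neq0.
  have -> : 6 * B / 2 ^+ (n + k)%N = 12 * B / 2 ^+ (n + k)%N / 2 by field; exact: pow2_neq0.
  lra.
have pw n : 0 <= 12 * B / 2 ^+ n by rewrite divr_ge0 ?mulr_ge0 // exprn_ge0.
have [||d d0|f [hf fA]] := @C0_ulim _ _ Htree R (fun k => A k s0) (fun k => 12 * B / 2 ^+ k).
- by move=> n; exact: GA.
- move=> n k x nk; rewrite -(subnKC nk); apply: le_trans (cauchy _ _ _) _.
  by rewrite lerBlDr lerDl.
- by apply: div_pow2_lt => //; rewrite mulr_ge0.
have fE x : ~ lt s0 x -> f x = ext g l s0 x.
  move=> nx; apply/eqP; rewrite -subr_eq0 -normr_le0; apply/ler_addgt0Pr => e e0.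
  have [n hn] := @div_pow2_lt R (12 * B) e (mulr_ge0 (ler0n _ _) B0) e0.
  have := fA n x; rewrite /A (avg_adapted hlr n adE) //; lra.
exists f; split=> //; apply/ler_addgt0Pr => e e0.
have m0 : 0 <= m.
  by have [ls Js _] := hG s0 G0; apply: le_trans Js; apply: le_trans (J_ge_val _ (C0_ext_shape l s0 hg)); rewrite mulr_ge0 // ltW.
pose C := (m + 1) / a + 3 * B.
have C0' : 0 <= C by apply: addr_ge0; [apply: divr_ge0; [lra|exact: ltW]|rewrite mulr_ge0].
have [n hn] := @div_pow2_lt R (1 + b * (12 * B + C)) e (addr_ge0 ler01 (mulr_ge0 (ltW b0) (addr_ge0 (mulr_ge0 (ler0n _ _) B0) C0'))) e0.
have pn : 1 / 2 ^+ n <= 1 :> R by rewrite ler_pdivrMr ?exprn_gt0 // mul1r exprn_ege1 // ler1n.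
have phiC s x : G s -> `|phi n s x - E s x| <= C.
  move=> Gs; have [[hp _] Np] := hphi n s Gs.
  apply: le_trans (ler_normB _ _) _; rewrite /C lerD //.
  rewrite ler_pdivlMr // mulrC; apply: le_trans (N_ge_val x hp) _; lra.
have adphi : adapted g l G (phi n).
  by move=> s x Gs nx; have [[_ h] _] := hphi n s Gs; exact: h.
have NB : N (avg lft rgt (phi n) n s0) <= m + 1 / 2 ^+ n.
  by apply: (avg_N hlr) => // s Gs; have [[? _] ?] := hphi n s Gs.
have CB : C0 (avg lft rgt (phi n) n s0).
  by apply: (avg_C0 hlr) => // s Gs; have [[? _] ?] := hphi n s Gs.
have NF : N f <= N (avg lft rgt (phi n) n s0) + b * (12 * B / 2 ^+ n + C / 2 ^+ n).
  apply: N_lip => // [|x]; first by rewrite addr_ge0 // divr_ge0 // exprn_ge0.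
  have -> : f x - avg lft rgt (phi n) n s0 x = (f x - A n s0 x) + (A n s0 x - avg lft rgt (phi n) n s0 x) by ring.
  apply: le_trans (ler_normD _ _) _; rewrite lerD //.
  by rewrite distrC /A; apply: (avg_close hlr n x adphi adE C0' _ G0) => s y; exact: phiC.
apply: le_trans NF _.
have -> : b * (12 * B / 2 ^+ n + C / 2 ^+ n) = (1 + b * (12 * B + C)) / 2 ^+ n - 1 / 2 ^+ n.
  by field; exact: pow2_neq0.
lra.
Qed.

(** * Plateaux and tameness *)

Local Notation I g l w := (J (ext g l w) w).

(** The equality is required at successor nodes only; these are the nodes supplied by
    [ever_branching_split] and by the recursion for roots. *)
Definition plateau g l : set T :=
  [set w | le l w /\ forall p s, lt l s -> le s w -> succ le p s -> I g l s = J g l].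

(** Mirrors what is wanted of rho: every node of the plateau is good for the values of J reached
    from it, and the plateau contains no ever-branching set. *)
Definition tame g l :=
  (forall s, plateau g l s -> exists (eta : R) (F : seq T), 0 < eta /\
     forall u, succ le s u -> (I g l u = J g l /\ List.In u F) \/ J g l + eta <= I g l u) /\
  (forall G, G `<=` plateau g l -> ~ ever_branching le G).

(** A bad node yields the minimiser [ext g l s] through [attained_bad]; an ever-branching set yields
    one through [attained_branching], after passing to its splitting successors. *)
Lemma not_tame_attained g l : C0 g -> ~ tame g l -> exists f, cls g l f /\ N f <= J g l.
Proof.
move=> hg nt; apply: contrapT => nf; apply: nt; split=> [s [ls hs]|G GC EB].
  apply: contrapT => nEF.
  have ge_m u : succ le s u -> J g l <= I g l u.
    move=> su; rewrite -{1}(ext_self g l); apply: ext_mono => //; first exact: le_refl.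
    exact: (le_tr Htree ls (tltW (succ_lt Htree su))).
  apply: nf; exists (ext g l s); split.
    split=> [|x nx]; first exact: C0_ext_shape.
    by rewrite (ext_agree g (le_refl Htree l) ls nx) ext_self.
  apply: attained_bad => // eta F eta0; apply: contrapT => nu; apply: nEF.
  have hF u : succ le s u -> List.In u F \/ J g l + eta <= I g l u.
    move=> su; case: (leP (J g l + eta) (I g l u)) => [|lu]; first by right.
    by left; apply: contrapT => nF; apply: nu; exists u.
  (* Members of F may have values strictly between J g l and J g l + eta; being finitely many, they
     are excluded by shrinking eta. *)
  have [eta' [e0 [e1 e2]]] : exists eta' : R, 0 < eta' /\ eta' <= eta /\
      forall u, List.In u F -> succ le s u -> I g l u = J g l \/ J g l + eta' <= I g l u.
    elim: (F) => [|v F' [c [c0 [c1 c2]]]]; first by exists eta; split=> //; split.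
    case: (pselect (succ le s v)) => [sv|nsv]; last first.
      exists c; split=> //; split=> // u [<-|]; [by []|exact: c2].
    case: (eqVneq (I g l v) (J g l)) => [E|n].
      by exists c; split=> //; split=> // u [<-|iu su]; [left|exact: c2].
    have gap : 0 < I g l v - J g l by rewrite subr_gt0 lt_neqAle eq_sym n ge_m.
    exists (Order.min c (I g l v - J g l)); split; first by rewrite lt_min c0 gap.
    split=> [|u [<- _|iu su]]; first by rewrite ge_min c1.
      by right; rewrite -lerBrDl ge_min lexx orbT.
    case: (c2 u iu su) => [|h]; first by left.
    by right; apply: le_trans h; rewrite lerD2l ge_min lexx.
  exists eta', F; split=> // u su; case: (hF u su) => [iu|h].
    by case: (e2 u iu su) => [E|h]; [left|right].
  by right; apply: le_trans h; rewrite lerD2l.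
have [[s0 Gs0] EB2] := ever_branching_split Htree EB.
have hS u : [set u | exists p a b, [/\ G a, G b, le a p, succ le p u & le u b]] u ->
    lt l u /\ I g l u = J g l.
  move=> [p [x [y [Gx Gy xp pu uy]]]].
  have lu : lt l u.
    exact: (le_lt Htree (GC _ Gx).1 (le_lt Htree xp (succ_lt Htree pu))).
  by split=> //; exact: ((GC _ Gy).2 p).
have [|f [cf Nf]] := @attained_branching g l _ (J g l) s0 hg Gs0.
  move=> s Gs; have [ls Is] := hS s Gs; split; first exact: tltW.
    by rewrite Is.
  exact: EB2.
apply: nf; exists f; split=> //; rewrite -(ext_self g l).
by apply: ext_cls cf => //; [exact: le_refl|exact: tltW (hS s0 Gs0).1].
Qed.

(** * Step functions on a chain, and the alternative at a limit node *)

Definition step (L : seq (rat * T)) w : T -> R :=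
  fun x => \sum_(z <- L) ratr z.1 * (ind w x - ind z.2 x).

Lemma C0_step L w : C0 (step L w).
Proof.
elim: L => [|z L IH].
  by apply: (C0_ext (f := fun _ => 0)) (C0_0 Htree R) => x; rewrite /step big_nil.
have hz : C0 (fadd (fscale (-1) (ind z.2)) (ind w)) by apply: C0_lin => //; exact: C0_ind.
apply: C0_ext (C0_lin Htree (ratr z.1) hz IH) => x.
rewrite /step big_cons /fadd /fscale; congr (_ * _ + _); ring.
Qed.

Lemma step_agree L w w' x : (forall z, List.In z L -> lt z.2 w) -> le w w' -> ~ lt w x ->
  step L w' x = step L w x.
Proof.
move=> hL ww' nx; rewrite /step; elim: L hL => [|z L IH] hL; first by rewrite !big_nil.
rewrite !big_cons IH; last by move=> z' iz'; apply: hL; right.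
congr (_ * (_ - _) + _).
case: (pselect (le x w)) => [xw|nxw].
  by rewrite !ind_in //; exact: (le_tr Htree xw ww').
by rewrite !ind_out // => xw'; apply: nx; exact: (nle_lt Htree xw' ww').
Qed.

Lemma ext_step L l w : (forall z, List.In z L -> lt z.2 l) -> ext (step L l) l w = step L w.
Proof.
move=> hL; apply: funext => x; rewrite /ext /step.
elim: L hL => [|z L IH] hL; first by rewrite !big_nil mul0r addr0.
have {}IH := IH (fun z' iz' => hL z' (or_intror iz')).
rewrite !big_cons -IH (ind_in R (le_refl Htree l)) (ind_out R (lt_nle Htree (hL z (or_introl erefl)))); ring.
Qed.

(** The approximating step functions have rational coefficients, so that later a node can record one
    by means of countable data and the codes of lower nodes. *)
Definition approximable (P : set T) l g :=
  C0 g /\ forall d : R, 0 < d -> exists L : seq (rat * T),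
    (forall z, List.In z L -> P z.2) /\ forall x, `|g x - step L l x| <= d.

Definition add_seg g (th : R) p l : T -> R := fun x => g x + th * (ind l x - ind p x).

Lemma C0_seg p l : C0 (fun x => ind l x - ind p x).
Proof.
apply: (C0_ext (f := fadd (fscale (-1) (ind p)) (ind l))) => [x|].
  by rewrite /fadd /fscale; ring.
by apply: C0_lin => //; exact: C0_ind.
Qed.

Lemma C0_add_seg g th p l : C0 g -> C0 (add_seg g th p l).
Proof. by move=> hg; apply: C0_add => //; exact: (C0_scale Htree th (C0_seg p l)). Qed.

Lemma seg_le1 p l x : `|ind l x - ind p x| <= 1.
Proof.
by rewrite /ind; case: asboolP; case: asboolP => _ _;
  rewrite ?subrr ?subr0 ?sub0r ?normrN ?normr0 ?normr1.
Qed.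

Lemma approximable_add_seg P l g th p : approximable P l g -> P p ->
  approximable P l (add_seg g th p l).
Proof.
move=> [hg ag] Pp; split=> [|d d0]; first exact: C0_add_seg.
have [L [LP hL]] := ag (d / 2) (divr_gt0 d0 (ltr0Sn _ _)).
have [q] := @rat_in_itvoo R (th - d / 2) (th + d / 2) ltac:(lra).
rewrite in_itv /= => /andP[q1 q2].
exists ((q, p) :: L); split=> [z [<-//|]|x]; first exact: LP.
rewrite /step big_cons /add_seg /=.
have -> : g x + th * (ind l x - ind p x) - (ratr q * (ind l x - ind p x) +
   \sum_(j <- L) ratr j.1 * (ind l x - ind j.2 x))
  = (g x - step L l x) + (th - ratr q) * (ind l x - ind p x) by rewrite /step; ring.
apply: le_trans (ler_normD _ _) _; rewrite (splitr d) lerD // normrM.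
have h1 : `|th - ratr q| <= d / 2 by rewrite ler_norml; apply/andP; split; lra.
rewrite -(mulr1 (d / 2)); apply: ler_pM => //; exact: seg_le1.
Qed.

(** The same L, th and tau serve every p in P; hence the drop can be recorded at l before it is
    known which p will be needed. *)
Definition droppable (P : set T) l := exists (L : seq (rat * T)) (th tau : R),
  [/\ (forall z, List.In z L -> P z.2), 0 < tau &
      forall p, P p -> J (add_seg (step L l) (- th) p l) l <= J (step L l) l - tau].

Hypothesis Nfre : frechet_away_from_0 le N.

(** Take a minimiser f and the derivative of N at f. If the derivative is at most a/4 on some
    segment (p,l], adding th times this segment is cheap. Otherwise subtracting th lowers N by a
    fixed amount for all p at once, because th depends on f only; this drop passes to a step
    function near g. *)
Lemma growth (P : set T) l g : ~ droppable P l -> (forall p, P p -> lt p l) ->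
  approximable P l g -> ~ tame g l -> 1 <= g l -> P !=set0 ->
  exists th p, [/\ 0 < th, P p & J (add_seg g th p l) l <= J g l + a / 2 * th].
Proof.
move=> nd Pl [hg ag] nt g1 [p0 Pp0].
have [f [[hf fg] Nf]] := not_tame_attained hg nt.
have nzf : nonzero f.
  by exists l; rewrite fg; [rewrite gt_eqF //; exact: lt_le_trans g1|exact: lt_irr].
have [L [[Llin _] hL]] := Nfre hf nzf.
have L0 : L (fun _ => 0) = 0.
  have := Llin 1 _ _ (C0_0 Htree R) (C0_0 Htree R).
  have -> : fadd (fscale 1 (fun _ : T => 0)) (fun _ => 0) = (fun _ => 0 : R).
    by apply: funext => x; rewrite /fadd /fscale mulr0 addr0.
  by lra.
have Lscale c h : C0 h -> L (fscale c h) = c * L h.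
  move=> hh; have := Llin c h _ hh (C0_0 Htree R); rewrite L0 addr0 => <-.
  by congr L; apply: funext => x; rewrite /fadd addr0.
have k0 : 0 < a / 2 / 4 by rewrite !divr_gt0.
have [d [d0 hd]] := hL (a / 2 / 4) k0.
pose th := d / 2; have th0 : 0 < th by rewrite divr_gt0.
have key c p : `|c| = th -> `|N (add_seg f c p l) - N f - c * L (fun x => ind l x - ind p x)|
    <= a / 2 / 4 * th.
  move=> cth; rewrite -Lscale; last exact: C0_seg.
  have s1 : supn (fscale c (fun x => ind l x - ind p x)) <= th.
    apply: supn_le => [|x]; first exact: ltW.
    rewrite /fscale normrM cth -[leRHS]mulr1 ler_pM2l //; exact: seg_le1.
  apply: le_trans (hd _ (C0_scale Htree c (C0_seg p l)) _) _.
    by apply: le_lt_trans s1 _; rewrite /th; lra.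
  by rewrite ler_pM2l.
have cseg c p : cls (add_seg g c p l) l (add_seg f c p l).
  by split=> [|x nx]; [exact: C0_add_seg|rewrite /add_seg fg].
case: (pselect (exists p, P p /\ L (fun x => ind l x - ind p x) <= a / 2 / 2)) => [[p [Pp hp]]|nL].
  exists th, p; split=> //; apply: le_trans (J_le (cseg th p)) _.
  have := key th p (gtr0_norm th0); rewrite ler_norml => /andP[_ h].
  have : th * L (fun x => ind l x - ind p x) <= th * (a / 2 / 2) by rewrite ler_pM2l.
  have : 0 < a * th by rewrite mulr_gt0.
  lra.
case: nd.
(* Subtraction lowers J g l by at least a th / 8; replacing g twice by a step function costs 2 b e =
   a th / 16, which leaves the drop tau = a th / 16. *)
pose e := th * (a / 2) / 16 / b.
have e0 : 0 < e by rewrite !divr_gt0 // mulr_gt0 // divr_gt0.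
have be : b * e = th * (a / 2) / 16 by rewrite /e; field; rewrite gt_eqF.
have [L' [L'P hL']] := ag e e0.
exists L', th, (th * (a / 2) / 8); split=> // [|p Pp]; first by rewrite divr_gt0 // mulr_gt0 // divr_gt0.
have Lp : a / 2 / 2 <= L (fun x => ind l x - ind p x).
  by rewrite leNgt; apply/negP => h; apply: nL; exists p; split=> //; exact: ltW.
have := key (- th) p; rewrite normrN gtr0_norm // => /(_ erefl).
rewrite ler_norml => /andP[_ h].
have h2 : th * (a / 2 / 2) <= th * L (fun x => ind l x - ind p x) by rewrite ler_pM2l.
have h3 := J_le (cseg (- th) p).
have h4 : J (add_seg (step L' l) (- th) p l) l <= J (add_seg g (- th) p l) l + b * e.
  apply: J_lip => [|||x]; [exact: C0_add_seg (C0_step _ _)|exact: C0_add_seg|exact: ltW|].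
  by rewrite /add_seg opprD addrACA subrr addr0 distrC.
have h5 : J g l <= J (step L' l) l + b * e.
  by apply: J_lip => //; [exact: C0_step|exact: ltW].
have : 0 < a * th by rewrite mulr_gt0.
rewrite be in h4 h5; lra.
Qed.

(* Bishop-Phelps: a function that cannot be raised any further at l is reached
   after countably many raises, the total raise being bounded. *)
Lemma tame_or_droppable (P : set T) l : (forall p, P p -> lt p l) -> P !=set0 ->
  (exists g, approximable P l g /\ tame g l) \/ droppable P l.
Proof.
move=> Pl P0; apply: contrapT => /not_orP[nG nd].
have grow g : approximable P l g -> 1 <= g l ->
    exists th p, [/\ 0 < th, P p & J (add_seg g th p l) l <= J g l + a / 2 * th].
  move=> ag g1; apply: growth => // tg; apply: nG; by exists g.
(* The Bishop-Phelps order: the change is controlled by the gain at l, and J rises by at most a/2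
   per unit of gain. *)
pose ord g g' := [/\ approximable P l g', (forall x, `|g' x - g x| <= g' l - g l) &
  J g' l <= J g l + a / 2 * (g' l - g l)].
have ord_refl g : approximable P l g -> ord g g.
  by move=> ag; split=> // [x|]; rewrite ?subrr ?normr0 ?mulr0 ?addr0.
have ord_tr g1 g2 g3 : ord g1 g2 -> ord g2 g3 -> ord g1 g3.
  move=> [_ h2 h3] [k1 k2 k3]; split=> // [x|]; last by lra.
  have -> : g3 x - g1 x = (g3 x - g2 x) + (g2 x - g1 x) by ring.
  by apply: le_trans (ler_normD _ _) _; have := h2 x; have := k2 x; lra.
(* J is at least a times the value at l, but rises by only a/2 per unit of gain; so the total gain
   is bounded. *)
have ordJ g g' : 1 <= g l -> ord g g' -> a / 2 * g' l <= J g l.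
  move=> g1 [[hg' _] h2 h3].
  have g'0 : 0 <= g' l by have := h2 l; have := normr_ge0 (g' l - g l); lra.
  have := J_ge_val l hg'; rewrite ger0_norm //.
  have : 0 <= a / 2 * g l by rewrite mulr_ge0 // ?divr_ge0 // ltW // (lt_le_trans _ g1).
  lra.
have a20 : 0 < a / 2 by rewrite divr_gt0.
pose S g := [set g' l - g l | g' in ord g].
have Sub g : 1 <= g l -> ubound (S g) (J g l / (a / 2)).
  move=> g1 _ [g' /= o <-]; rewrite ler_pdivlMr // mulrC; have := ordJ g g' g1 o.
  have : 0 <= a / 2 * g l by rewrite mulr_ge0 // ?ltW // (lt_le_trans _ g1).
  lra.
(* A greedy choice: each raise realises at least half of the largest possible gain. *)
have /boolp.choice[nx hnx] : forall g, exists g', approximable P l g -> 1 <= g l ->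
    ord g g' /\ sup (S g) <= 2 * (g' l - g l).
  move=> g; case: (pselect (approximable P l g /\ 1 <= g l)) => [[ag g1]|n]; last first.
    by exists g => ? ?; case: n.
  have hS : has_sup (S g).
    by split; [exists (g l - g l); exists g => //; exact: ord_refl|exists (J g l / (a / 2)); exact: Sub].
  have S0 : 0 <= sup (S g).
    by apply: sup_upper_bound => //; exists g; [exact: ord_refl|rewrite subrr].
  case: (eqVneq (sup (S g)) 0) => [E|n0].
    by exists g => _ _; split; [exact: ord_refl|rewrite E subrr mulr0].
  have Sp : 0 < sup (S g) by rewrite lt_neqAle eq_sym n0.
  have [_ [g' o <-] h] := sup_adherent (divr_gt0 Sp (ltr0Sn _ 1)) hS.
  by exists g' => _ _; split=> //; lra.
have [p0 Pp0] := P0.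
pose g0 := add_seg (fun _ => 0) 1 p0 l.
have ag0 : approximable P l g0.
  apply: approximable_add_seg => //; split=> [|d d0]; first exact: C0_0.
  by exists [::]; split=> // x; rewrite /step big_nil subrr normr0 ltW.
have g0l : g0 l = 1.
  by rewrite /g0 /add_seg (ind_in R (le_refl Htree l)) (ind_out R (lt_nle Htree (Pl _ Pp0))); ring.
pose gs n := iter n nx g0.
have ordS n : [/\ approximable P l (gs n), 1 <= gs n l, ord (gs n) (gs n.+1) &
    sup (S (gs n)) <= 2 * (gs n.+1 l - gs n l)].
  elim: n => [|n [ag g1 [k1 k2 k3] _]].
    have g01 : 1 <= g0 l by rewrite g0l.
    by have [h1 h2] := hnx g0 ag0 g01.
  have g1' : 1 <= gs n.+1 l by have := k2 l; have := normr_ge0 (gs n.+1 l - gs n l); lra.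
  by have [h1 h2] := hnx (gs n.+1) k1 g1'.
have ord_le n m : (n <= m)%N -> ord (gs n) (gs m).
  move=> nm; rewrite -(subnKC nm); elim: (m - n)%N => [|k IH].
    by rewrite addn0; apply: ord_refl; have [] := ordS n.
  by rewrite addnS; apply: ord_tr IH _; have [] := ordS (n + k)%N.
pose t n := gs n l.
have tS : has_sup [set t n | n in [set: nat]].
  split; first by exists (t 0%N); exists 0%N.
  exists (J g0 l / (a / 2)) => _ [n _ <-]; rewrite ler_pdivlMr // mulrC.
  by apply: (ordJ g0 (gs n)); [rewrite g0l|exact: (ord_le 0%N n (leq0n n))].
pose tt := sup [set t n | n in [set: nat]].
have t_tt n : t n <= tt by apply: sup_upper_bound => //; exists n.
have t_mono n m : (n <= m)%N -> t n <= t m.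
  by move=> /ord_le[_ h _]; have := h l; have := normr_ge0 (gs m l - gs n l); rewrite /t; lra.
have t_near (d : R) : 0 < d -> exists n, tt - t n < d.
  by move=> d0; have [_ [n _ <-] h] := sup_adherent d0 tS; exists n; rewrite -/tt in h; lra.
have [|n m x nm||gi [hgi giE]] := @C0_ulim _ _ Htree R gs (fun n => tt - t n).
- by move=> n; have [[? _] _ _ _] := ordS n.
- by have [_ h _] := ord_le n m nm; apply: le_trans (h x) _; have := t_tt m; rewrite /t; lra.
- exact: t_near.
have gil : gi l = tt.
  apply/eqP; rewrite -subr_eq0 -normr_le0; apply/ler_addgt0Pr => e e0.
  have [n hn] := t_near (e / 2) (divr_gt0 e0 (ltr0Sn _ _)).
  have := giE n l; rewrite -/(t n) !ler_norml => /andP[h1 h2]; have := t_tt n.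
  by move=> ?; apply/andP; split; lra.
have agi : approximable P l gi.
  split=> // d d0; have [n hn] := t_near (d / 2) (divr_gt0 d0 (ltr0Sn _ _)).
  have [[_ ag] _ _ _] := ordS n.
  have [L [LP hL]] := ag (d / 2) (divr_gt0 d0 (ltr0Sn _ _)).
  exists L; split=> // x.
  have -> : gi x - step L l x = (gi x - gs n x) + (gs n x - step L l x) by ring.
  by apply: le_trans (ler_normD _ _) _; have := giE n x; have := hL x; lra.
have ordi n : ord (gs n) gi.
  split=> // [x|]; first by rewrite gil; exact: giE.
  apply/ler_addgt0Pr => e e0.
  have [m hm] := t_near (e / b) (divr_gt0 e0 b0).
  pose k := maxn n m.
  have [_ _ h1] := ord_le n k (leq_maxl n m).
  have [[hk _] _ _ _] := ordS k.
  have e1 : tt - t k < e / b by have := t_mono m k (leq_maxr n m); lra.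
  have h2 : J gi l <= J (gs k) l + b * (tt - t k).
    by apply: J_lip => //; rewrite subr_ge0.
  have h3 : b * (tt - t k) <= e by rewrite ltr_pdivlMr // in e1; rewrite mulrC ltW.
  have h4 : a / 2 * (gs k l - gs n l) <= a / 2 * (gi l - gs n l).
    by rewrite ler_pM2l // gil lerD2r; exact: t_tt.
  lra.
have gi1 : 1 <= gi l by rewrite gil -g0l; exact: (t_tt 0%N).
have [th [p [th0 Pp hth]]] := grow gi agi gi1.
have segl : ind l l - ind p l = 1.
  by rewrite (ind_in R (le_refl Htree l)) (ind_out R (lt_nle Htree (Pl _ Pp))) subr0.
have oth : ord gi (add_seg gi th p l).
  have E : add_seg gi th p l l - gi l = th by rewrite /add_seg segl; ring.
  split; [exact: approximable_add_seg|move=> x|by rewrite E].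
  rewrite E /add_seg addrC addKr normrM gtr0_norm // -[leRHS]mulr1 ler_pM2l //.
  exact: seg_le1.
(* At stage n a gain of th + (tt - t n) is possible through the limit, but the greedy choice bounds
   every gain by 2 (tt - t n); this fails once tt - t n < th. *)
have [n hn] := t_near th th0.
have [_ g1 _ hs] := ordS n.
have : add_seg gi th p l l - gs n l <= sup (S (gs n)).
  apply: sup_upper_bound; last by exists (add_seg gi th p l) => //; exact: ord_tr (ordi n) oth.
  split; first by exists (gs n l - gs n l); exists (gs n) => //; apply: ord_refl; have [] := ordS n.
  by exists (J (gs n) l / (a / 2)); exact: Sub.
have E : add_seg gi th p l l = gi l + th by rewrite /add_seg segl; ring.
rewrite E gil; have := t_tt n.+1; rewrite /t in hn *; lra.
Qed.
End QuotientNorm.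

(** * Cutting the tree into pieces, each with a root *)

Section Roots.
Variables (T : Type) (le : T -> T -> Prop) (Htree : is_tree le).
Local Notation lt := (tlt le).

Definition rooted (root : T -> Prop) c t :=
  [/\ le c t, root c & forall y, lt c y -> le y t -> ~ root y].

Definition turns (root : T -> Prop) (c : T) : set T :=
  [set p | exists u, [/\ succ le p u, le u c & root u]].

(** A recursive equation: [stay c P t] says that the piece with root c, whose branch has jumped at
    the nodes of P, continues to t. Only roots strictly below t are consulted, as [root_spec_ext]
    confirms, so well-founded recursion solves it. *)
Definition root_spec (stay : T -> set T -> T -> Prop) (root : T -> Prop) (t : T) :=
  [\/ forall s, ~ lt s t,
      limit_height le t /\ (forall x, lt x t -> exists y, [/\ lt x y, lt y t & root y]) |
      exists p, succ le p t /\ forall c, rooted root c p -> ~ stay c (turns root c) t].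

Lemma root_spec_ext stay (r1 r2 : T -> Prop) t : (forall s, lt s t -> r1 s <-> r2 s) ->
  root_spec stay r1 t -> root_spec stay r2 t.
Proof.
move=> h [n|[lt_ cof]|[p [pt np]]]; first exact: Or31.
  apply: Or32; split=> // x xt; have [y [xy yt ry]] := cof x xt.
  by exists y; split=> //; apply/h.
apply: Or33; exists p; split=> // c [cp rc nr].
have pt' := succ_lt Htree pt.
have -> : turns r2 c = turns r1 c.
  apply/seteqP; split=> q [u [qu uc ru]]; exists u; split=> //; apply/h => //;
  exact: (le_lt Htree uc (le_lt Htree cp pt')).
apply: np; split=> // [|y cy yp ry]; first by apply/h => //; exact: (le_lt Htree cp pt').
by apply: (nr y cy yp); apply/h => //; exact: (le_lt Htree yp pt').
Qed.

Lemma root_exists stay : exists root : T -> Prop, forall t, root t <-> root_spec stay root t.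
Proof.
pose F t (rec : forall s, lt s t -> Prop) := root_spec stay (fun s => exists H : lt s t, rec s H) t.
pose root := Fix (tlt_wf Htree) (fun _ => Prop) F.
exists root => t.
have -> : root t = F t (fun s _ => root s).
  rewrite /root Fix_eq // => x f g h; congr (F x _).
  by apply: functional_extensionality_dep => y; apply: functional_extensionality_dep => H.
have e s : lt s t -> root s <-> exists _ : lt s t, root s by move=> st; split=> [|[]//]; exists st.
by rewrite /F; split; apply: root_spec_ext => s st; [apply: iff_sym|]; exact: e.
Qed.

Variables (stay : T -> set T -> T -> Prop) (root : T -> Prop).
Hypothesis hroot : forall t, root t <-> root_spec stay root t.

Lemma rooted_exists t : exists c, rooted root c t.
Proof.
apply: (tlt_ind Htree (P := fun t => exists c, rooted root c t)) => {}t IH.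
case: (pselect (root t)) => [rt|nrt].
  exists t; split=> // [|y ty yt]; first exact: le_refl.
  by case: (lt_nle Htree ty yt).
have ext s c : lt s t -> (forall y, lt s y -> le y t -> ~ root y) -> rooted root c s -> rooted root c t.
  move=> st h [cs rc nr]; split=> // [|y cy yt]; first exact: (le_tr Htree cs (tltW st)).
  case: (pselect (le y s)) => [|ns]; first exact: nr.
  by apply: h => //; exact: (nle_lt Htree yt (tltW st)).
case: (tree_cases Htree t) => [n|[p pt]|lt_].
- by case: nrt; apply/hroot; exact: Or31.
- have [c hc] := IH p (succ_lt Htree pt); exists c.
  apply: ext hc; first exact: succ_lt.
  move=> y py yt; case: (le_eq_lt yt) => [->//|yt'].
  by case: (lt_nle Htree py (succ_le pt yt')).
- have [x [xt hx]] : exists x, lt x t /\ forall y, lt x y -> lt y t -> ~ root y.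
    apply: contrapT => n; apply: nrt; apply/hroot; apply: Or32; split=> // x xt.
    apply: contrapT => n'; apply: n; exists x; split=> // y xy yt ry; apply: n'; by exists y.
  have [c hc] := IH x xt; exists c; apply: ext hc => // y xy yt.
  by case: (le_eq_lt yt) => [->//|]; exact: hx.
Qed.

Lemma rooted_uniq c c' t : rooted root c t -> rooted root c' t -> c = c'.
Proof.
move=> [ct rc nc] [c't rc' nc']; case: (below_total Htree ct c't) => h; case: (le_eq_lt h) => // h'.
  by case: (nc c' h' c't).
by case: (nc' c h' ct).
Qed.

Lemma rooted_ge c t u : rooted root c t -> root u -> le u t -> le u c.
Proof.
move=> [ct rc nc] ru ut; case: (below_total Htree ct ut) => // cu.
by case: (le_eq_lt cu) => [->|cu']; [exact: le_refl|case: (nc u cu' ut)].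
Qed.

Lemma turns_lt c p : turns root c p -> lt p c.
Proof. by move=> [u [pu uc _]]; exact: (lt_le Htree (succ_lt Htree pu) uc). Qed.

Lemma root_limit c : root c -> limit_height le c ->
  forall x, lt x c -> exists y, [/\ lt x y, lt y c & root y].
Proof.
move=> /hroot[n|[]//|[p [pc _]]] lc; first by have [x xc] := lc.1; case: (n x).
by case: (limit_not_succ Htree lc pc).
Qed.

(** The least root above x on the way to c is a successor: a limit root has roots cofinally below
    it, one of which would lie in between. *)
Lemma root_in x c : root c -> lt x c -> exists p u, [/\ succ le p u, le x p, le u c & root u].
Proof.
move=> rc xc.
have [y [[xy yc ry] hy]] : exists y, [/\ lt x y, le y c & root y] /\
    forall z, [/\ lt x z, le z c & root z] -> le y z.
  apply: (ex_least Htree (t := c) (A := [set y | [/\ lt x y, le y c & root y]])).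
    by move=> z [].
  by exists c; split=> //; exact: le_refl.
case: (tree_cases Htree y) => [n|[p py]|ly]; first by case: (n x).
  by exists p, y; split=> //; exact: succ_le py xy.
have [z [xz zy rz]] := root_limit ry ly xy.
case: (lt_nle Htree zy); apply: hy; split=> //.
exact: (le_tr Htree (tltW zy) yc).
Qed.

Lemma turns_cofinal c x : root c -> lt x c -> exists p, turns root c p /\ le x p.
Proof.
by move=> rc xc; have [p [u [pu xp uc ru]]] := root_in rc xc; exists p; split=> //; exists u.
Qed.

Lemma rooted_stay c t p s : rooted root c t -> lt c s -> le s t -> succ le p s ->
  stay c (turns root c) s.
Proof.
move=> [ct rc nc] cs st ps.
have nrs := nc s cs st.
have : ~ root_spec stay root s by move=> h; apply: nrs; exact/hroot.
move=> n; apply: contrapT => ns; apply: n; apply: Or33; exists p; split=> // c' hc'.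
suff -> : c' = c by [].
apply: rooted_uniq hc' _; split=> // [|y cy yp]; first exact: succ_le ps cs.
by apply: nc => //; exact: (le_tr Htree yp (le_tr Htree (tltW (succ_lt Htree ps)) st)).
Qed.

End Roots.

(** * Hereditary codes, and an increasing function counting them *)

Section Coding.
Variables (T : Type) (le : T -> T -> Prop) (Htree : is_tree le).
Local Notation lt := (tlt le).

(** By recursion, the code of t packs [k t] with the codes of the nodes in [d t], all of which lie
    strictly below t. *)
Lemma coding (d : T -> seq T) (k : T -> nat) : (forall t p, List.In p (d t) -> lt p t) ->
  exists code : T -> nat, forall s t, code s = code t ->
    k s = k t /\ map code (d s) = map code (d t).
Proof.
move=> hd.
pose F t (rec : forall s, lt s t -> nat) : nat :=
  pickle (k t, map (fun p => if pselect (lt p t) is left H then rec p H else 0%N) (d t)).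
pose code := Fix (tlt_wf Htree) (fun _ => nat) F.
have codeE t : code t = pickle (k t, map code (d t)).
  have -> : code t = F t (fun s _ => code s).
    rewrite /code Fix_eq // => x f g h; congr (F x _).
    by apply: functional_extensionality_dep => y; apply: functional_extensionality_dep => H.
  rewrite /F; congr (pickle (_, _)).
  have := hd t; elim: (d t) => //= p l IH h; rewrite IH; last by move=> q iq; apply: h; right.
  by case: pselect => // n; case: n; apply: h; left.
exists code => s t; rewrite !codeE => /(pcan_inj pickleK)[-> E]; by split.
Qed.

Variable R : realType.

(** rho t is the sum of 2^-n over the n with [A n t], formed as the supremum of the partial sums;
    passing from outside to inside the upward closed [A n] adds the term 2^-n. *)
Lemma weighted_count (A : nat -> T -> Prop) :
  (forall n s t, le s t -> A n s -> A n t) ->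
  exists rho : T -> R, increasing le rho /\
    forall n s t, le s t -> A n t -> ~ A n s -> rho s + 1 / 2 ^+ n <= rho t.
Proof.
move=> Aup; pose w n t : R := if `[< A n t >] then 1 / 2 ^+ n else 0.
have pw n : 0 < 1 / 2 ^+ n :> R by rewrite divr_gt0 // exprn_gt0.
have w0 n t : 0 <= w n t by rewrite /w; case: asboolP => // _; exact: ltW.
have wmono n s t : le s t -> w n s <= w n t.
  move=> st; rewrite /w; case: asboolP => [As|_]; last exact: w0.
  by rewrite asboolT //; exact: Aup st As.
pose S m t := \sum_(i < m) w i t.
have Sub m t : S m t <= 2 - 2 / 2 ^+ m.
  elim: m => [|m IH]; first by rewrite /S big_ord0 expr0 divr1 subrr.
  rewrite /S big_ord_recr /=; have : w m t <= 1 / 2 ^+ m by rewrite /w; case: asboolP => // _; exact: ltW.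
  have -> : 2 / 2 ^+ m.+1 = 1 / 2 ^+ m :> R by rewrite exprS; field; exact: pow2_neq0.
  have E : 2 / 2 ^+ m = 2 * (1 / 2 ^+ m) :> R by field; exact: pow2_neq0.
  by move: IH; rewrite E -/(S m t); lra.
have Sub2 m t : S m t <= 2.
  by apply: le_trans (Sub m t) _; rewrite gerBl divr_ge0 // exprn_ge0.
have Smono m n t : (m <= n)%N -> S m t <= S n t.
  move=> mn; rewrite -(subnKC mn); elim: (n - m)%N => [|k IH]; first by rewrite addn0.
  by rewrite addnS /S big_ord_recr /=; apply: le_trans IH _; rewrite lerDl.
pose rho t := sup [set S m t | m in [set: nat]].
have hs t : has_sup [set S m t | m in [set: nat]].
  by split; [exists (S 0%N t); exists 0%N|exists 2 => _ [m _ <-]].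
have Sle m t : S m t <= rho t by apply: sup_upper_bound => //; exists m.
exists rho; split=> [s t st|n s t st At nAs].
  apply: ge_sup; first by exists (S 0%N s); exists 0%N.
  move=> _ [m _ <-]; apply: le_trans (Sle m t); apply: ler_sum => i _; exact: wmono.
rewrite -lerBrDr; apply: ge_sup; first by exists (S 0%N s); exists 0%N.
move=> _ [m _ <-]; rewrite lerBrDr.
apply: le_trans (Sle (maxn m n.+1) t).
apply: (le_trans (y := S (maxn m n.+1) s + 1 / 2 ^+ n)).
  by rewrite lerD2r; apply: Smono; exact: leq_maxl.
have nm : (n < maxn m n.+1)%N by rewrite leq_maxr.
rewrite /S (bigD1 (Ordinal nm)) //= [leRHS](bigD1 (Ordinal nm)) //=.
have -> : w n s = 0 by rewrite /w asboolF.
have -> : w n t = 1 / 2 ^+ n by rewrite /w asboolT.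
rewrite add0r [leLHS]addrC lerD2l; apply: ler_sum => i _; exact: wmono.
Qed.

End Coding.

Lemma inv_nat_small (R : realType) (c : R) : 0 < c -> exists e : nat, 4 / e.+1%:R <= c.
Proof.
move=> c0; exists (Num.bound (4 / c)); rewrite ler_pdivrMr ?ltr0n //.
rewrite mulrC -ler_pdivrMr //; apply: ltW; apply: lt_le_trans (archi_boundP _) _.
  by rewrite divr_ge0 // ltW.
by rewrite ler_nat.
Qed.

Lemma ever_branching_above (T : Type) (le : T -> T -> Prop) (G : set T) g : is_tree le ->
  ever_branching le G -> G g -> ever_branching le (G `&` [set x | le g x]).
Proof.
move=> Htree [_ EB] Gg; split; first by exists g; split=> //; exact: (le_refl Htree).
move=> x [Gx gx]; have [u [v [[Gu Gv] xu xv uv vu]]] := EB x Gx.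
by exists u, v; split=> //; split; split=> //; exact: (le_tr Htree gx).
Qed.

(** * The increasing function obtained from a differentiable norm *)

Section FrechetToRho.
Variables (T : Type) (le : T -> T -> Prop) (Htree : is_tree le) (R : realType).
Local Notation lt := (tlt le).
Local Notation C0 := (C0 le).
Variables (N : (T -> R) -> R) (a b : R).
Hypothesis Ntri : forall f g, C0 f -> C0 g -> N (fadd f g) <= N f + N g.
Hypothesis Nscale : forall (c : R) f, C0 f -> N (fscale c f) = `|c| * N f.
Hypothesis a0 : 0 < a.
Hypothesis b0 : 0 < b.
Hypothesis Nlow : forall f, C0 f -> a * supn f <= N f.
Hypothesis Nup : forall f, C0 f -> N f <= b * supn f.
Hypothesis Nfre : frechet_away_from_0 le N.
Local Notation J := (J le N).
Local Notation ext := (@ext T le R).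
Local Notation step := (@step T le R).

Definition has_tame (cP : T * set T) g := approximable le cP.2 cP.1 g /\ tame le N g cP.1.

Variable gsel : T * set T -> T -> R.
Hypothesis gselP : forall cP, (exists g, has_tame cP g) -> has_tame cP (gsel cP).

(** Since c must be a limit, a piece whose root is no limit consists of the root alone. The chosen
    function depends on c and P only, so the whole piece is measured with the same function. *)
Definition stay c P t := [/\ limit_height le c, (exists g, has_tame (c, P) g) &
  J (ext (gsel (c, P)) c t) t = J (gsel (c, P)) c].

Variable root : T -> Prop.
Hypothesis hroot : forall t, root t <-> root_spec le stay root t.
Local Notation rooted := (rooted le root).
Local Notation turns := (turns le root).

Lemma rooted_plateau c t : rooted c t -> c <> t ->
  [/\ limit_height le c, (exists g, has_tame (c, turns c) g) &
      plateau le N (gsel (c, turns c)) c t].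
Proof.
move=> hc nct; have [ct rc nr] := hc.
have [u [cu ut]] := next_ex Htree (conj ct nct).
have [lc hg _] := rooted_stay Htree hroot hc (succ_lt Htree cu) ut cu.
split=> //; split=> // p s cs st ps.
by have [_ _] := rooted_stay Htree hroot hc cs st ps.
Qed.

Lemma rooted_plateau_limit c t : rooted c t -> limit_height le c ->
  (exists g, has_tame (c, turns c) g) -> plateau le N (gsel (c, turns c)) c t.
Proof.
move=> hc lc hg; case: (pselect (c = t)) => [<-|n]; last by have [] := rooted_plateau hc n.
split; first exact: le_refl.
by move=> p s cs /(lt_nle Htree cs).
Qed.

Lemma nonroot_stay t u : succ le t u -> ~ root u -> exists c, rooted c t /\ stay c (turns c) u.
Proof.
move=> tu nru; apply: contrapT => n; apply: nru; apply/hroot; apply: Or33.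
by exists t; split=> // c hc sc; apply: n; exists c.
Qed.

Lemma root_not_stay c t u : rooted c t -> succ le t u -> root u -> ~ stay c (turns c) u.
Proof.
move=> hc tu /hroot[n|[lu _]|[p [pu hp]]].
- by case: (n t); exact: succ_lt.
- by case: (limit_not_succ Htree lu tu).
- by apply: hp; rewrite (succ_pred_uniq Htree pu tu).
Qed.

(* What is recorded at a node: the kind of the root of its plateau, a step
   function on the chain below that root, and rational approximations. *)
Definition record (D : nat * seq (rat * T) * nat * rat) (t : T) :=
  let: (tag, L, e, r) := D in
  let eta : R := 4 / e.+1%:R in
  match tag with
  | 0%N => L = [::] /\ forall s, ~ lt s t
  | 1%N => root t /\ exists p, succ le p t /\ L = [:: (0, p)]
  | 2%N => [/\ root t, limit_height le t, (forall z, List.In z L -> turns t z.2),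
      `|J (step L t) t - ratr r| < eta / 4 &
      exists th : R, forall p, turns t p ->
        J (add_seg le (step L t) (- th) p t) t <= J (step L t) t - eta]
  | _ => exists c, [/\ rooted c t, (forall z, List.In z L -> turns c z.2),
      `|J (step L c) c - ratr r| < eta / 4 &
      forall u, succ le t u -> root u -> J (step L c) c + eta <= J (step L u) u]
  end.

Lemma rat_near (x e : R) : 0 < e -> exists r : rat, `|x - ratr r| < e.
Proof.
move=> e0; have [r] := @rat_in_itvoo R (x - e) (x + e) ltac:(lra).
rewrite in_itv /= => /andP[h1 h2]; exists r.
by rewrite ltr_norml; apply/andP; split; lra.
Qed.

(** Tags 0 and 1 serve minimal and successor roots. Tag 2 serves limit roots without a tame
    function, where [tame_or_droppable] supplies the drop. Tag 3 serves all nodes of a piece with a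
    tame function, whose tameness gives the gap at the successors that are roots. *)
Lemma record_exists t : exists D, record D t.
Proof.
have [c hc] := rooted_exists Htree hroot t; have [ct rc nr] := hc.
have cE : ~ limit_height le c -> c = t.
  by move=> nl; apply: contrapT => n; have [] := rooted_plateau hc n.
case: (tree_cases Htree c) => [n|[p pc]|lc].
- have E := cE (fun l => let: ex_intro s h := l.1 in n s h); subst c.
  by exists (0%N, [::], 0%N, 0).
- have E := cE (fun l => limit_not_succ Htree l pc); subst c.
  by exists (1%N, [:: (0, p)], 0%N, 0); split=> //; exists p.
have Plt p : turns c p -> lt p c by exact: (turns_lt Htree).
have [x xc] := lc.1.
have P0 : turns c !=set0 by have [p [hp _]] := turns_cofinal Htree hroot rc xc; exists p.
have eta0 e : 0 < 4 / e.+1%:R / 4 :> R by rewrite !divr_gt0 // ltr0n.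
case: (pselect (exists g, has_tame (c, turns c) g)) => [hg|nhg]; last first.
  have E : c = t by apply: contrapT => n; have [] := rooted_plateau hc n.
  subst c.
  have [[g hg]|] := tame_or_droppable Htree Ntri Nscale a0 b0 Nlow Nup Nfre Plt P0.
    by case: nhg; exists g.
  move=> [L [th [tau [LP tau0 hd]]]].
  have [e he] := inv_nat_small tau0.
  have [r hr] := rat_near (J (step L t) t) (eta0 e).
  exists (2%N, L, e, r); split=> //; exists th => p Pp; apply: le_trans (hd p Pp) _.
  by rewrite lerD2l lerN2.
have [[hgC ag] [tg _]] := gselP hg; set g := gsel (c, turns c) in hgC ag tg *.
have hpl := rooted_plateau_limit hc lc hg.
have [eta [F [eta1 hF]]] := tg t hpl.
(* A step function within d of g loses b d at c and 2 b d at u, where the value prolonged from c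
   differs too: eta / 4 altogether, so half of the gap survives. *)
pose d := eta / 12 / b.
have d0 : 0 < d by rewrite !divr_gt0.
have bd : b * d = eta / 12 by rewrite /d; field; rewrite gt_eqF.
have [L [LP hL]] := ag d d0.
have Llt z : List.In z L -> lt z.2 c by move=> /LP /Plt.
have [e he] := @inv_nat_small R (eta / 2) (divr_gt0 eta1 (ltr0Sn _ _)).
have [r hr] := rat_near (J (step L c) c) (eta0 e).
exists (3%N, L, e, r); exists c; split=> // u tu ru.
have cu : le c u by exact: (le_tr Htree ct (tltW (succ_lt Htree tu))).
have Ju : J g c + eta <= J (ext g c u) u.
  case: (hF u tu) => [[E _]|//].
  by case: (root_not_stay hc tu ru); split.
have h1 : J (step L c) c <= J g c + b * d.
  apply: (J_lip Htree Ntri a0 b0 Nlow Nup) => //; [exact: C0_step|exact: ltW|].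
  by move=> y; rewrite distrC.
have h2 : J (ext g c u) u <= J (step L u) u + b * (d + d).
  apply: (J_lip Htree Ntri a0 b0 Nlow Nup) => //; [exact: C0_ext_shape|exact: C0_step| |].
    by rewrite addr_ge0 // ltW.
  move=> y; rewrite -(ext_step Htree R u Llt) /ext.
  have -> : g y + g c * (@ind T le R u y - ind le R c y) -
     (step L c y + step L c c * (ind le R u y - ind le R c y)) =
     (g y - step L c y) + (g c - step L c c) * (ind le R u y - ind le R c y) by ring.
  apply: le_trans (ler_normD _ _) _; rewrite lerD // normrM -[leRHS]mulr1.
  by apply: ler_pM => //; exact: seg_le1.
rewrite mulrDr bd in h2; rewrite bd in h1.
move: he; set X := 4 / _ => he; move: he Ju h1 h2 eta1; lra.
Qed.

Variable D : T -> nat * seq (rat * T) * nat * rat.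
Hypothesis hD : forall t, record (D t) t.
Local Notation nodes t := (map snd (D t).1.1.2).
Variable code : T -> nat.
Hypothesis hcode : forall s t, code s = code t ->
  pickle ((D s).1.1.1, map fst (D s).1.1.2, (D s).1.2, (D s).2) =
  pickle ((D t).1.1.1, map fst (D t).1.1.2, (D t).1.2, (D t).2) /\
  map code (nodes s) = map code (nodes t).

Definition turning s t := exists u, [/\ succ le s u, le u t & root u].

Lemma turns_eq c c' t p p' : le c t -> le c' t -> turns c p -> turns c' p' ->
  (~ lt p p' \/ ~ turning p p') -> (~ lt p' p \/ ~ turning p' p) -> p = p'.
Proof.
move=> ct c't hp hp' h h'.
have aux q q' d d' : le d t -> le d' t -> turns d q -> turns d' q' -> lt q q' -> turning q q'.
  move=> dt d't [u [qu ud ru]] hq' qq'; exists u; split=> //.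
  apply: (succ_le_next Htree qu (le_tr Htree ud dt) qq').
  exact: (le_tr Htree (tltW (turns_lt Htree hq')) d't).
have pt : le p t by exact: (le_tr Htree (tltW (turns_lt Htree hp)) ct).
have p't : le p' t by exact: (le_tr Htree (tltW (turns_lt Htree hp')) c't).
case: (below_total Htree pt p't) => l; case: (le_eq_lt l) => // l'.
  by case: h => // n; case: n; exact: aux hp hp' l'.
by case: h' => // n; case: n; exact: aux hp' hp l'.
Qed.

(** Two turns on one branch with equal codes coincide, since the branch to the upper one jumps on
    leaving the lower one, which [key] forbids. Equal records thus mean equal step functions, not
    merely equal codes. *)
Lemma step_data_eq c c' t (L L' : seq (rat * T)) : le c t -> le c' t ->
  (forall z, List.In z L -> turns c z.2) -> (forall z, List.In z L' -> turns c' z.2) ->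
  map fst L = map fst L' -> map code (map snd L) = map code (map snd L') ->
  (forall q q', lt q t -> lt q' t -> lt q q' -> code q = code q' -> ~ turning q q') ->
  L = L'.
Proof.
move=> ct c't; elim: L L' => [|[q p] L IH] [|[q' p'] L'] //= hL hL' [<- E1] [Ep E2] key.
have hp := hL _ (or_introl erefl); have hp' := hL' _ (or_introl erefl).
rewrite (IH L') //; [|by move=> z iz; apply: hL; right|by move=> z iz; apply: hL'; right].
have pt : lt p t by exact: (lt_le Htree (turns_lt Htree hp) ct).
have p't : lt p' t by exact: (lt_le Htree (turns_lt Htree hp') c't).
suff -> : p = p' by [].
apply: (turns_eq ct c't hp hp').
  by case: (pselect (lt p p')) => [l|]; [right; exact: key|left].
by case: (pselect (lt p' p)) => [l|]; [right; exact: key|left].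
Qed.

(** Induction on t. Equal codes give the same tag, rationals and, by the induction hypothesis, the
    same L. Tag 0: t would be minimal. Tag 1: the predecessors of s and t repeat the situation lower
    down. Tag 2: the drop at t along a segment (p,t] with s <= p puts the value of J at s at least
    eta below that at t. Tag 3: the gap at s puts the value of J at the root of t at least eta above
    that at the root of s. In both last cases the two values are within eta / 4 of the same
    rational. *)
Lemma code_not_turning t s : lt s t -> code s = code t -> ~ turning s t.
Proof.
move: t s.
apply: (tlt_ind Htree (P := fun t => forall s, lt s t -> code s = code t -> ~ turning s t)).
move=> t IH s st cst [u [su ut ru]].
have key q q' : lt q t -> lt q' t -> lt q q' -> code q = code q' -> ~ turning q q'.
  by move=> _ q't qq' cqq'; exact: IH.
have [/(pcan_inj pickleK) Ek Em] := hcode cst.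
have := hD s; have := hD t.
case: (D s) Ek Em => [[[tag L] e] r]; case: (D t) => [[[tag' L'] e'] r'] /= [-> EL -> ->] Em.
case: tag' => [|[|[|tag']]] /=.
- by move=> [_ n]; case: (n s).
- move=> [rt [p' [p't EL']]] [rs [p [ps EL2]]]; subst L L'.
  case: Em => Ep.
  have pp' : lt p p' by exact: (lt_le Htree (succ_lt Htree ps) (succ_le p't st)).
  apply: (IH p' (succ_lt Htree p't) p pp' Ep); exists s; split=> //; exact: succ_le p't st.
- move=> [rt lt_ LP' rr' [th hth]] [rs ls LP rr _].
  have E := step_data_eq (tltW st) (le_refl Htree t) LP LP' EL Em key; subst L'.
  have [p [Pp sp]] := turns_cofinal Htree hroot rt st.
  have := hth p Pp; set eta := 4 / _ in rr rr' *.
  have eta0 : 0 < eta by rewrite divr_gt0 // ltr0n.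
  suff : J (step L s) s <= J (add_seg le (step L t) (- th) p t) t.
    by move: rr rr'; rewrite !ltr_norml => /andP[? ?] /andP[? ?]; lra.
  apply: (J_mono Htree a0 Nlow (tltW st)) => [|x nx]; first by apply: C0_add_seg => //; exact: C0_step.
  have Lls z : List.In z L -> lt z.2 s by move=> /LP /(turns_lt Htree).
  rewrite /add_seg (step_agree Htree R Lls (tltW st) nx).
  suff -> : @ind T le R t x - ind le R p x = 0 by rewrite mulr0 addr0.
  case: (pselect (le x p)) => [xp|nxp].
    by rewrite !ind_in ?subrr //; exact: (le_tr Htree xp (tltW (turns_lt Htree Pp))).
  rewrite !ind_out ?subrr // => xt; apply: nx.
  exact: (le_lt Htree sp (nle_lt Htree xt (tltW (turns_lt Htree Pp)) nxp)).
- move=> [c' [hc' LP' rr' _]] [c [hc LP rr gap]].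
  have [ct _ _] := hc; have [c't _ _] := hc'.
  have E := step_data_eq (le_tr Htree ct (tltW st)) c't LP LP' EL Em key; subst L'.
  have uc' : le u c' by exact: (rooted_ge Htree hc' ru ut).
  have := gap u su ru; set eta := 4 / _ in rr rr' *.
  have eta0 : 0 < eta by rewrite divr_gt0 // ltr0n.
  suff : J (step L u) u <= J (step L c') c'.
    by move: rr rr'; rewrite !ltr_norml => /andP[? ?] /andP[? ?]; lra.
  apply: (J_mono Htree a0 Nlow uc') => [|x nx]; first exact: C0_step.
  apply: (step_agree Htree R _ uc' nx) => z /LP /(turns_lt Htree) zc.
  exact: (lt_le Htree zc (le_tr Htree ct (tltW (succ_lt Htree su)))).
Qed.

(** [A n t] says that the branch to t jumps on leaving some node with code n. As the code of p is
    not yet counted at p, rho grows by a fixed amount at each successor of p that is a root; the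
    other successors of p with small gap are finitely many by tameness. On a set where rho is
    constant no root separates comparable members, so an ever-branching one would have an
    ever-branching part in a single tame plateau. *)
Lemma rho_from_code : exists rho : T -> R, [/\ increasing le rho, (forall t, ~ bad le rho t) &
  (forall G, ever_branching le G -> ~ constant_on rho G)].
Proof.
pose A n t := exists p u, [/\ succ le p u, root u, le u t & code p = n].
have Aup n s t : le s t -> A n s -> A n t.
  by move=> st [p [u [pu ru us cp]]]; exists p, u; split=> //; exact: (le_tr Htree us st).
have [rho [inc gap]] := weighted_count R Aup.
have nA p : ~ A (code p) p.
  move=> [q [u [qu ru up cqp]]].
  apply: (code_not_turning (lt_le Htree (succ_lt Htree qu) up) cqp); by exists u.
exists rho; split=> // [t nb|G EB [v hv]].
  apply: nb.
  have [c hc] := rooted_exists Htree hroot t.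
  have [F hF] : exists F : seq T, forall u, succ le t u -> ~ root u -> List.In u F.
    case: (pselect (exists u, succ le t u /\ ~ root u)) => [[u0 [tu0 nru0]]|n]; last first.
      by exists [::] => u tu nru; case: n; exists u.
    have [c0 [hc0 [lc hg _]]] := nonroot_stay tu0 nru0.
    have [_ [tg _]] := gselP hg.
    have [eta [F [eta0 hF]]] := tg t (rooted_plateau_limit hc0 lc hg).
    exists F => u tu nru; have [c1 [hc1 [_ _ E]]] := nonroot_stay tu nru.
    rewrite (rooted_uniq Htree hc1 hc0) in E.
    by case: (hF u tu) => [[]//|]; rewrite E; lra.
  pose F' := [seq u <- F | `[< succ le t u >]].
  have F'P u : List.In u F' <-> List.In u F /\ succ le t u.
    rewrite /F'; elim: (F) => /= [|w F0 IH]; first by split=> // -[].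
    case: ifP => [/asboolP tw|/asboolP ntw] /=; rewrite IH.
      by split=> [[<-|[? ?]]|[[->|?] ?]]; [split=> //; left|split=> //; right|left|right].
    by split=> [[? ?]|[[E|?] ?]]; [split=> //; right|subst w|].
  exists F', (rho t + 1 / 2 ^+ code t); split; first by move=> u /F'P[].
  split=> [|u tu nF]; first by rewrite ltrDl divr_gt0 // exprn_gt0.
  apply: gap (nA t); first exact: tltW (succ_lt Htree tu).
  exists t, u; split=> //; last exact: le_refl.
  by apply: contrapT => nru; apply: nF; apply/F'P; split=> //; exact: hF.
have nor g g' y : G g -> G g' -> lt g y -> le y g' -> ~ root y.
  move=> Gg Gg' gy yg' ry.
  have [p [u [pu gp uy ru]]] := root_in Htree hroot ry gy.
  have h : rho g + 1 / 2 ^+ code p <= rho g'.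
    apply: gap; first exact: (le_tr Htree (tltW gy) yg').
      by exists p, u; split=> //; exact: (le_tr Htree uy yg').
    by move=> Ag; apply: (nA p); exact: Aup gp Ag.
  by move: h; rewrite !hv // gerDl leNgt divr_gt0 // exprn_gt0.
have [[g0 Gg0] hEB] := EB.
have [c hc] := rooted_exists Htree hroot g0.
have hcg g : G g -> le g0 g -> rooted c g.
  move=> Gg g0g; have [cg rc nr] := hc; split=> // [|y cy yg]; first exact: (le_tr Htree cg g0g).
  case: (pselect (le y g0)) => [|nyg]; first exact: nr.
  by apply: (nor g0 g) => //; exact: (nle_lt Htree yg g0g).
have EB' := ever_branching_above Htree EB Gg0.
(* A second node of the piece is needed: only then is the root known to be a limit with a tame
   function. *)
have [g1 [Gg1 g01 ng]] : exists g1, [/\ G g1, le g0 g1 & c <> g1].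
  have [u [w [[Gu Gw] gu gw uw wu]]] := hEB g0 Gg0; exists u; split=> // E; subst u.
  apply: uw; have [cg _ _] := hc; exact: (le_tr Htree cg gw).
have [lc hg _] := rooted_plateau (hcg g1 Gg1 g01) ng.
have [_ [_ nEB]] := gselP hg.
apply: nEB EB' => g [Gg g0g]; exact: rooted_plateau_limit (hcg g Gg g0g) lc hg.
Qed.

End FrechetToRho.

Theorem rho_of_frechet (T : Type) (le : T -> T -> Prop) (R : realType) : is_tree le ->
  forall N : (T -> R) -> R, equiv_norm le N -> frechet_away_from_0 le N ->
  exists rho : T -> R, [/\ increasing le rho, (forall t, ~ bad le rho t) &
  (forall G, ever_branching le G -> ~ constant_on rho G)].
Proof.
move=> Htree N [Ntri Nscale _ [a [b [a0 b0 hab]]]] Nfre.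
have Nlow f : C0 le f -> a * supn f <= N f by move=> /hab[].
have Nup f : C0 le f -> N f <= b * supn f by move=> /hab[].
have /boolp.choice[gsel hgsel] : forall cP : T * set T, exists g, (exists g, has_tame le N cP g) -> has_tame le N cP g.
  move=> cP; case: (pselect (exists g, has_tame le N cP g)) => [[g hg]|n]; first by exists g.
  by exists (fun _ => 0).
have [root hroot] := root_exists Htree (stay le N gsel).
have /boolp.choice[D hD] := record_exists Htree Ntri Nscale a0 b0 Nlow Nup Nfre hgsel hroot.
pose d t := map snd (D t).1.1.2.
pose k t := pickle ((D t).1.1.1, map fst (D t).1.1.2, (D t).1.2, (D t).2).
have [t p|code hcode] := @coding T le Htree d k; last first.
  exact: (rho_from_code Htree a0 Nlow hgsel hroot hD hcode).
have inL (L : seq (rat * T)) c : (forall z, List.In z L -> turns le root c z.2) ->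
    List.In p (map snd L) -> tlt le p c.
  by move=> h ip; have [z [<- iz]] := (List.in_map_iff _ _ _).1 ip; exact: (turns_lt Htree (h z iz)).
rewrite /d; have := hD t; case: (D t) => [[[tag L] e] r] /=.
case: tag => [|[|[|tag]]] /=.
- by move=> [->].
- by move=> [_ [q [qt ->]]] /= [<-|//]; exact: succ_lt.
- by move=> [_ _ hL _ _]; exact: inL.
- move=> [c [[ct _ _] hL _ _]] ip; exact: (lt_le Htree (inL L c hL ip) ct).
Qed.

(** * From an increasing function to a Talagrand operator *)

Section RhoToTalagrand.
Variables (T : Type) (le : T -> T -> Prop) (Htree : is_tree le) (R : realType).
Local Notation lt := (tlt le).
Local Notation C0 := (C0 le).

Definition left_continuous (rho : T -> R) := forall l (e : R), limit_height le l -> 0 < e ->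
  exists s, lt s l /\ rho l - e < rho s.

(** At limits the value becomes the supremum of rho over the nodes below; elsewhere it is kept.
    Goodness survives because values only decrease and successors keep theirs. A set on which the
    new function is constant yields, by [ever_branching_split], successor nodes on which rho is
    constant. *)
Lemma regularize (rho : T -> R) : increasing le rho -> (forall t, ~ bad le rho t) ->
  (forall G, ever_branching le G -> ~ constant_on rho G) ->
  exists rho' : T -> R, [/\ increasing le rho', left_continuous rho',
    (forall t, good le rho' t) & (forall G, ever_branching le G -> ~ constant_on rho' G)].
Proof.
move=> inc nb nEB.
pose S t := [set rho s | s in [set s | lt s t]].
pose rho' t := if `[< limit_height le t >] then sup (S t) else rho t.
have Ssup t : limit_height le t -> has_sup (S t).
  move=> [[s st] _]; split; first by exists (rho s); exists s.
  by exists (rho t) => _ [x xt <-]; apply: inc; exact: tltW xt.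
have rho'_le t : rho' t <= rho t.
  rewrite /rho'; case: asboolP => // /Ssup[ne _]; apply: ge_sup => // _ [s st <-].
  by apply: inc; exact: tltW st.
have rho'_succ p u : succ le p u -> rho' u = rho u.
  by move=> pu; rewrite /rho' asboolF // => l; exact: (limit_not_succ Htree l pu).
have inc' : increasing le rho'.
  move=> s t st; case: (le_eq_lt st) => [->//|st'].
  rewrite [leRHS]/rho'; case: asboolP => [l|_]; last exact: le_trans (rho'_le s) (inc _ _ st).
  by apply: le_trans (rho'_le s) _; apply: sup_upper_bound; [exact: Ssup|exists s].
exists rho'; split=> // [l e ll e0|t|G EB [v hv]].
- have [_ [s sl <-] h] := sup_adherent e0 (Ssup l ll).
  have [s' [ss' s'l]] := ll.2 s sl.
  have [u [su us']] := next_ex Htree ss'.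
  exists u; split; first exact: (le_lt Htree us' s'l).
  rewrite (rho'_succ s u su) {1}/rho' asboolT //; apply: lt_le_trans h _.
  by apply: inc; exact: tltW (succ_lt Htree su).
- have [F [c [hF [tc hc]]]] : good le rho t by apply: contrapT; exact: nb.
  exists F, c; split=> //; split=> [|u tu nu]; first exact: le_lt_trans (rho'_le t) tc.
  by rewrite (rho'_succ t u tu); exact: hc.
- apply: (nEB _ (ever_branching_split Htree EB)); exists v => u [p [x [y [Gx Gy xp pu uy]]]].
  rewrite -(rho'_succ p u pu); apply/eqP; rewrite eq_le -{1}(hv y Gy) -(hv x Gx).
  rewrite !inc' //; exact: (le_tr Htree xp (tltW (succ_lt Htree pu))).
Qed.

Variable rho : T -> R.
Hypothesis inc : increasing le rho.
Hypothesis lc : left_continuous rho.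
Hypothesis gd : forall t, good le rho t.
Hypothesis nEB : forall G, ever_branching le G -> ~ constant_on rho G.

Lemma rho_between x y z : le x y -> le y z -> rho x = rho z -> rho y = rho z.
Proof.
move=> xy yz E; apply/eqP; rewrite eq_le inc //= -E; exact: inc.
Qed.

(** * Successor choices that follow every branch of a level up to finitely many nodes *)

Definition on_course (g : T -> T) t m := succ le t (g t) /\ le (g t) m.

Definition steers s (g : T -> T) := forall m, le s m -> rho m = rho s ->
  exists ts : seq T, forall t, le s t -> lt t m -> ~ on_course g t m -> List.In t ts.

Lemma steers_above s t g : le s t -> rho t = rho s -> steers s g -> steers t g.
Proof.
move=> st E h m tm Em; have [ts hts] := h m (le_tr Htree st tm) (etrans Em E).
by exists ts => x tx; apply: hts; exact: (le_tr Htree st tx).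
Qed.

(* If some points had no steering function, they would form an ever-branching
   set: where they form a chain, one may steer along the chain and then follow
   the steering function of the first point off it. *)
Lemma steers_exists s : exists g, steers s g.
Proof.
pose nice x := exists g, steers x g.
apply: contrapT => ns0.
have nice_up x y : le x y -> rho y = rho x -> nice x -> nice y.
  by move=> xy E [g hg]; exists g; exact: steers_above hg.
have [gg hgg] : exists gg : T -> T -> T, forall x, nice x -> steers x (gg x).
  have /boolp.choice[gg hgg] : forall x, exists g, nice x -> steers x g; last by exists gg.
  by move=> x; case: (pselect (nice x)) => [[g hg]|n]; [exists g|exists id].
apply: (nEB (G := [set x | [/\ ~ nice x, le s x & rho x = rho s]])); last first.
  by exists (rho s) => x [].
split; first by exists s; split=> //; exact: le_refl.
move=> x [nx sx Ex]; apply: contrapT => nbr; apply: nx.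
have chain y z : ~ nice y -> ~ nice z -> le x y -> le x z -> rho y = rho x -> rho z = rho x ->
    le y z \/ le z y.
  move=> ny nz xy xz Ey Ez; apply: contrapT => /not_orP[n1 n2]; apply: nbr; exists y, z.
  by split=> //; split; split=> //; (try exact: (le_tr Htree sx)); rewrite ?Ey ?Ez.
(* [h y] is the first nice node between x and y. Nodes of the level beyond it on one branch share
   it, so they use one and the same steering function. *)
have /boolp.choice[h hh] : forall y, exists z, le x y -> nice y ->
    [/\ le x z, le z y, nice z & forall w, le x w -> le w y -> nice w -> le z w].
  move=> y; case: (pselect (le x y /\ nice y)) => [[xy ny]|n]; last by exists x => ? ?; case: n.
  have [z [[xz zy nz] hz]] : exists m, [/\ le x m, le m y & nice m] /\
      forall a, [/\ le x a, le a y & nice a] -> le m a.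
    apply: (ex_least Htree (t := y) (A := [set a | [/\ le x a, le a y & nice a]])); first by move=> a [].
    by exists y; split=> //; exact: le_refl.
  by exists z => _ _; split=> // w xw wy nw; exact: hz.
(* The nodes without steering function above x form a chain within the level, so a single successor
   of t leads to all of them above t. *)
have /boolp.choice[bn hbn] : forall t, exists u, forall y, le x t -> lt t y -> rho y = rho x -> ~ nice y ->
    succ le t u /\ le u y.
  move=> t; case: (pselect (exists y, [/\ le x t, lt t y, rho y = rho x & ~ nice y])); last first.
    by move=> n; exists t => y *; case: n; exists y.
  move=> [y [xt ty Ey ny]]; have [u [tu uy]] := next_ex Htree ty.
  exists u => z _ tz Ez nz; split=> //.
  case: (chain y z ny nz (le_tr Htree xt (tltW ty)) (le_tr Htree xt (tltW tz)) Ey Ez) => yz.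
    exact: (le_tr Htree uy yz).
  exact: (succ_le_next Htree tu uy tz yz).
exists (fun t => if `[< nice t >] then gg (h t) t else bn t) => m xm Em.
case: (pselect (nice m)) => [nm|nnm]; last first.
  exists [::] => t xt tm; rewrite /on_course.
  have Et : rho t = rho x by rewrite (rho_between xt (tltW tm) (esym Em)).
  rewrite asboolF; last by apply: contra_not nnm; apply: nice_up; [exact: tltW|rewrite Et].
  by case; exact: hbn.
have [xy ym ny hy] := hh m xm nm; set y := h m in xy ym ny hy.
have Ey : rho y = rho x by rewrite (rho_between xy ym (esym Em)).
have [ts hts] := hgg y ny m ym (etrans Em (esym Ey)).
(* A predecessor of y is a further exception: the chain of nodes without steering function may
   continue there towards another successor than y. *)
have [qs hqs] : exists qs : seq T, forall p, succ le p y -> List.In p qs.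
  case: (pselect (exists p, succ le p y)) => [[p py]|n]; last first.
    by exists [::] => p py; case: n; exists p.
  by exists [:: p] => q qy; left; exact: (succ_pred_uniq Htree py qy).
exists (qs ++ ts) => t xt tm; rewrite /on_course List.in_app_iff.
have Et : rho t = rho x by rewrite (rho_between xt (tltW tm) (esym Em)).
case: asboolP => [nt|nnt] noc.
  have yt : le y t by apply: hy => //; exact: tltW.
  have [xh ht nh hht] := hh t xt nt.
  right; apply: hts => //; suff <- : h t = y by [].
  apply: (le_anti Htree); first exact: hht.
  by apply: hy => //; exact: (le_tr Htree ht (tltW tm)).
have ty : lt t y.
  apply: (nle_lt Htree ym (tltW tm)) => yt; apply: nnt; apply: nice_up yt _ ny.
  by rewrite Et Ey.
have [u [tu uy]] := next_ex Htree ty.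
case: (le_eq_lt uy) => [E|uy']; first by left; apply: hqs; rewrite -E.
have xu : le x u by exact: (le_tr Htree xt (tltW (succ_lt Htree tu))).
have Eu : rho u = rho x by rewrite (rho_between xu uy (esym Ey)).
have nnu : ~ nice u.
  move=> nu; apply: (lt_nle Htree uy'); apply: hy => //; exact: (le_tr Htree uy ym).
case: noc; have [h1 h2] := hbn t u xt (succ_lt Htree tu) Eu nnu; split=> //.
exact: (le_tr Htree h2 (le_tr Htree uy ym)).
Qed.

(** Each node uses the steering function of the least node of its level below it; nodes t < m of one
    level share this node, so the local choices fit together. *)
Lemma nxt_exists : exists nxt : T -> T, forall m, exists ts : seq T,
  forall t, lt t m -> rho t = rho m -> ~ on_course nxt t m -> List.In t ts.
Proof.
have /boolp.choice[gg hgg] := steers_exists.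
have /boolp.choice[h hh] : forall x, exists z, [/\ le z x, rho z = rho x &
    forall w, le w x -> rho w = rho x -> le z w].
  move=> x.
  have [z [[zx Ez] hz]] : exists m, (le m x /\ rho m = rho x) /\
      forall a, (le a x /\ rho a = rho x) -> le m a.
    apply: (ex_least Htree (t := x) (A := [set a | le a x /\ rho a = rho x])); first by move=> a [].
    by exists x; split=> //; exact: le_refl.
  by exists z; split=> // w wx Ew; exact: hz.
exists (fun t => gg (h t) t) => m; have [ym Ey hy] := hh m.
have [ts hts] := hgg (h m) m ym (esym Ey).
exists ts => t tm Et; rewrite /on_course => noc.
have yt : le (h m) t by apply: hy => //; exact: tltW.
apply: hts => //; suff <- : h t = h m by [].
have [ht Eh hht] := hh t.
apply: (le_anti Htree); first by apply: hht => //; rewrite Ey Et.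
apply: hy; first exact: (le_tr Htree ht (tltW tm)).
by rewrite Eh.
Qed.

Lemma In_mem (x : {classic T}) (s : seq {classic T}) : List.In x s <-> x \in s.
Proof.
elim: s => //= y s IH; rewrite in_cons; split=> [[->|/IH ->]|/orP[/eqP ->|/IH h]].
- by rewrite eqxx.
- by rewrite orbT.
- by left.
- by right.
Qed.

Lemma uniq_filter (K : eqType) (s : seq K) (P : K -> Prop) :
  exists s', uniq s' /\ forall u, u \in s' <-> P u /\ u \in s.
Proof.
exists (undup [seq u <- s | `[< P u >]]); split=> [|u]; first exact: undup_uniq.
rewrite mem_undup mem_filter; split=> [/andP[/asboolP]//|[Pu us]].
by rewrite us andbT; exact/asboolP.
Qed.

(** The exceptional set from goodness is trimmed to exactly the successors of equal value. The
    second component is the gap to all other successors; its cap at 1 keeps the operator bounded. *)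
Lemma flat_exists m : exists Fe : seq {classic T} * R, [/\ uniq Fe.1, 0 < Fe.2, Fe.2 <= 1,
  (forall u, u \in Fe.1 <-> succ le m u /\ rho u = rho m) &
  (forall u, succ le m u -> u \notin Fe.1 -> rho m + Fe.2 <= rho u)].
Proof.
have [F [c [_ [mc hF]]]] := gd m.
have [eta [e0 [e1 e2]]] : exists eta : R, 0 < eta /\ eta <= 1 /\
    forall u, List.In u F -> succ le m u -> rho u <> rho m -> rho m + eta <= rho u.
  elim: (F) => [|v F' [d [d0 [d1 d2]]]]; first by exists 1; split.
  case: (pselect (succ le m v /\ rho v <> rho m)) => [[mv nv]|n]; last first.
    exists d; split=> //; split=> // u [<- mv nv|]; [by case: n|exact: d2].
  have gap : 0 < rho v - rho m.
    by rewrite subr_gt0 lt_neqAle eq_sym; apply/andP; split; [exact/eqP|exact: inc (tltW (succ_lt Htree mv))].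
  exists (Order.min d (rho v - rho m)); split; first by rewrite lt_min d0.
  split=> [|u [<- _ _|iu mu nu]]; first by rewrite ge_min d1.
    by rewrite -lerBrDl ge_min lexx orbT.
  by apply: le_trans (d2 u iu mu nu); rewrite lerD2l ge_min lexx.
have [F' [uF' hF']] := @uniq_filter {classic T} F (fun u => succ le m u /\ rho u = rho m).
exists (F', Order.min eta (c - rho m)); split=> /=.
- exact: uF'.
- by rewrite lt_min e0 subr_gt0.
- by rewrite ge_min e1.
- move=> u; split=> [/hF'[]//|h]; apply/hF'; split=> //.
  apply/In_mem; apply: contrapT => nu; have := hF u h.1 nu; rewrite h.2; lra.
- move=> u mu /negP nuF; case: (pselect (List.In u F)) => [iu|nu].
    apply: le_trans (e2 u iu mu _); first by rewrite lerD2l ge_min lexx.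
    by move=> E; apply: nuF; apply/hF'; split=> //; exact/In_mem.
  by apply: le_trans (hF u mu nu); rewrite -lerBrDl ge_min lexx orbT.
Qed.

(** * Weighted differences and the Talagrand operator *)

Variables (F : T -> seq {classic T}) (eta : T -> R) (nxt : T -> T).
Hypothesis hFu : forall m, uniq (F m).
Hypothesis eta0 : forall m, 0 < eta m.
Hypothesis eta1 : forall m, eta m <= 1.
Hypothesis hF : forall m u, u \in F m <-> succ le m u /\ rho u = rho m.
Hypothesis hFn : forall m u, succ le m u -> u \notin F m -> rho m + eta m <= rho u.
Hypothesis hnxt : forall m, exists ts : seq T,
  forall t, lt t m -> rho t = rho m -> ~ on_course nxt t m -> List.In t ts.

(** The factor [eta m] makes the difference small where the gap of rho is small, as [defect_limit]
    needs; the denominator compensates the number of terms in [defect]. *)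
Definition weight m : R := eta m / (size (F m)).+1%:R.
Definition defect (f : T -> R) m : R := weight m * (f m - \sum_(u <- F m) f u).

Lemma weight_gt0 m : 0 < weight m.
Proof. by rewrite divr_gt0 // ltr0n. Qed.

Lemma weightK m B : weight m * ((size (F m)).+1%:R * B) = eta m * B.
Proof. by rewrite /weight mulrA divfK // pnatr_eq0. Qed.

Lemma defect_bound f m B : `|f m| <= B -> (forall u, u \in F m -> `|f u| <= B) ->
  `|defect f m| <= eta m * B.
Proof.
move=> hm hu; rewrite /defect normrM gtr0_norm ?weight_gt0 //.
have h : `|f m - \sum_(u <- F m) f u| <= (size (F m)).+1%:R * B.
  apply: le_trans (ler_normB _ _) _; rewrite -natr1 mulrDl mul1r addrC lerD //.
  apply: le_trans (ler_norm_sum _ _ _) _.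
  rewrite big_seq; apply: le_trans (ler_sum _ hu) _.
  by rewrite -big_seq big_const_seq count_predT iter_addr_0 mulr_natl.
apply: le_trans (ler_wpM2l (ltW (weight_gt0 m)) h) _.
by rewrite weightK.
Qed.

(** Let v be the successor of m towards l. If v has the value of m, then f m - f v is small by
    continuity and the other terms are small because, near l, they leave the finitely many segments
    carrying large values of f. Otherwise [eta m] is at most rho v - rho m, which is small by left
    continuity of rho. *)
Lemma defect_limit f l (e : R) : C0 f -> limit_height le l -> 0 < e ->
  exists r, lt r l /\ forall m, lt r m -> lt m l -> `|defect f m| < e.
Proof.
move=> hf ll e0.
have e4 : 0 < e / 4 by rewrite divr_gt0.
have [r1 [r1l h1]] := C0_left Htree hf e4 ll.
have [_ bf] := (C0P Htree f).1 hf.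
have [ts hts] := bf (e / 4) e4.
have [r2 [r2l h2]] := seq_sep Htree ts ll.
have [B hB] := C0_bounded Htree hf.
have B0 : 0 <= B by exact: le_trans (normr_ge0 (f l)) (hB l).
have k0 : 0 < e / (B + 1) by rewrite divr_gt0 // ltr_wpDl.
have [r3 [r3l h3]] := lc ll k0.
have [r4 [r4l r14 r24]] := max_below Htree r1l r2l.
have [r [rl r4r r3r]] := max_below Htree r4l r3l.
exists r; split=> // m rm ml.
have r1m : lt r1 m by exact: (le_lt Htree (le_tr Htree r14 r4r) rm).
have [v [mv vl]] := next_ex Htree ml.
have others u : succ le m u -> u <> v -> `|f u| <= e / 4.
  move=> mu nuv; rewrite leNgt; apply/negP => /ltW /hts[t [it ut]].
  case: (pselect (le l t)) => [lt_|nlt].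
    by apply: nuv; exact: (succ_next_uniq Htree mu mv ut (le_tr Htree vl lt_)).
  apply: (h2 t it nlt); apply: (le_tr Htree (le_tr Htree r24 r4r)).
  exact: (le_tr Htree (tltW rm) (le_tr Htree (tltW (succ_lt Htree mu)) ut)).
case: (boolP ((v : {classic T}) \in F m)) => iv.
  have hv := (hF m v).1 iv.
  have d1 : `|f m - f v| <= e / 2.
    have := h1 m r1m (tltW ml).
    have := h1 v (lt_tr Htree r1m (succ_lt Htree mv)) vl.
    rewrite !ltr_norml ler_norml => /andP[? ?] /andP[? ?]; apply/andP; split; lra.
  rewrite /defect normrM gtr0_norm ?weight_gt0 //.
  have h : `|f m - \sum_(u <- F m) f u| <= (size (F m)).+1%:R * (e / 2).
    rewrite (bigD1_seq (I := {classic T}) v) //= opprD addrA.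
    apply: le_trans (ler_normB _ _) _; rewrite -natr1 mulrDl mul1r [leLHS]addrC lerD //.
    apply: le_trans (ler_norm_sum _ _ _) _.
    apply: (le_trans (y := \sum_(u <- F m) e / 2)); last first.
      by rewrite big_const_seq count_predT iter_addr_0 mulr_natl.
    rewrite big_mkcond big_seq [leRHS]big_seq; apply: ler_sum => u iu.
    case: eqP => /= nuv; first by rewrite divr_ge0 // ltW.
    have := others u ((hF m u).1 iu).1 nuv; lra.
  apply: le_lt_trans (ler_wpM2l (ltW (weight_gt0 m)) h) _.
  rewrite weightK.
  by have := eta1 m; have := eta0 m; nra.
apply: le_lt_trans (@defect_bound f m B (hB m) (fun u _ => hB u)) _.
have hh := hFn mv iv.
have : rho v <= rho l by exact: inc.
have : rho r3 <= rho m by apply: inc; exact: (le_tr Htree r3r (tltW rm)).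
move=> h5 h6.
have : eta m < e / (B + 1) by lra.
rewrite ltr_pdivlMr ?ltr_wpDl // => h7; apply: le_lt_trans h7.
by rewrite ler_pM2l // lerDl.
Qed.

(** On a segment (0,t] this follows by induction on t, with [defect_limit] at limits. Off the
    finitely many segments carrying the values |f| > e/2, both m and its successors have small
    values. *)
Lemma defect_small f (e : R) : C0 f -> 0 < e ->
  exists ts : seq T, forall m, e <= `|defect f m| -> List.In m ts.
Proof.
move=> hf e0.
have hdown : forall t, exists ts : seq T, forall m, le m t -> e <= `|defect f m| -> List.In m ts.
  apply: (tlt_ind Htree) => t IH; case: (tree_cases Htree t) => [n|[p pt]|ll].
  - exists [:: t] => m mt _; left; case: (le_eq_lt mt) => [//|mt']; by case: (n m).
  - have [ts hts] := IH p (succ_lt Htree pt); exists (t :: ts) => m mt hm.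
    case: (le_eq_lt mt) => [->|mt']; first by left.
    by right; apply: hts => //; exact: (succ_le pt mt').
  - have [r [rt hr]] := defect_limit hf ll e0.
    have [ts hts] := IH r rt; exists (t :: ts) => m mt hm.
    case: (le_eq_lt mt) => [->|mt']; first by left.
    right; apply: hts => //; apply: contrapT => nmr.
    have := hr m (nle_lt Htree mt (tltW rt) nmr) mt'; by rewrite ltNge hm.
have [_ bf] := (C0P Htree f).1 hf.
have [us hus] := bf (e / 2) (divr_gt0 e0 (ltr0Sn _ _)).
have [ts hts] : exists ts : seq T, forall t, List.In t us -> forall m, le m t ->
    e <= `|defect f m| -> List.In m ts.
  elim: (us) => [|t us' [ts hts]]; first by exists [::].
  have [ts' hts'] := hdown t; exists (ts' ++ ts) => s [<-|is_] m ms hm; rewrite List.in_app_iff.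
    by left; exact: hts'.
  by right; exact: hts ms hm.
exists ts => m hm; apply: contrapT => nm.
have out x : le m x -> `|f x| <= e / 2.
  move=> mx; rewrite leNgt; apply/negP => /ltW /hus[t [it xt]].
  by apply: nm; apply: hts it _ _ hm; exact: (le_tr Htree mx xt).
have := @defect_bound f m (e / 2) (out m (le_refl Htree m))
  (fun u iu => out u (tltW (succ_lt Htree ((hF m u).1 iu).1))).
have := eta1 m; have := eta0 m; nra.
Qed.

Definition linked t m := t = m \/ [/\ lt t m, rho t = rho m & ~ on_course nxt t m].

Definition tal (f : T -> R) (p : T * T) : R :=
  if `[< linked p.1 p.2 >] then defect f p.2 else 0.

Lemma finite_In (S : Type) (L : seq S) : finite_set [set x | List.In x L].
Proof.
elim: L => [|x L IH]; first by rewrite (_ : [set x | _] = set0) //; apply/seteqP; split.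
rewrite (_ : [set y | _] = [set x] `|` [set y | List.In y L]); last first.
  by apply/seteqP; split=> y /= [->|h]; [left|right|left|right].
by rewrite finite_setU; split=> //; exact: finite_set1.
Qed.

Lemma tal_c0 f : C0 f -> c0 (tal f).
Proof.
move=> hf e e0; have [ts hts] := defect_small hf e0.
have /boolp.choice[L hL] : forall m, exists L : seq (T * T), forall t, linked t m -> List.In (t, m) L.
  move=> m; have [us hus] := hnxt m; exists ((m, m) :: map (fun t => (t, m)) us) => t [->|[tm Et noc]].
    by left.
  by right; apply: (List.in_map (fun t => (t, m))); exact: hus.
apply: (sub_finite_set (B := [set x | List.In x (List.concat (List.map L ts))])); last exact: finite_In.
move=> [t m] /=; rewrite /tal /=; case: asboolP => [h|_]; last by rewrite normr0 leNgt e0.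
move=> /hts im; apply/List.in_concat; exists (L m); split; last exact: hL.
exact: List.in_map.
Qed.

Lemma tal_lin c f g p : tal (fadd (fscale c f) g) p = c * tal f p + tal g p.
Proof.
rewrite /tal; case: asboolP => _; last by rewrite mulr0 addr0.
rewrite /defect /fadd /fscale big_split /= -mulr_sumr; ring.
Qed.

Lemma tal_bound f : C0 f -> supn (tal f) <= 1 * supn f.
Proof.
move=> hf; rewrite mul1r; apply: supn_le => [|p]; first exact: supn_ge0.
rewrite /tal; case: asboolP => _; last by rewrite normr0 supn_ge0.
apply: le_trans (@defect_bound f p.2 (supn f) _ _) _; rewrite ?(C0_le_supn Htree) //.
  by move=> u _; exact: (C0_le_supn Htree).
by rewrite -[leRHS]mul1r; apply: ler_wpM2r => //; exact: supn_ge0.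
Qed.

(** An application of [C0_max]: left continuity of rho and continuity of f keep level and value at
    limits. *)
Lemma flat_max (f : T -> R) t : C0 f -> f t != 0 -> exists m, [/\ le t m, rho m = rho t, f m = f t &
  forall x, le m x -> rho x = rho t -> f x = f t -> x = m].
Proof.
move=> hf nz.
have [|||l ll hl|m [[tm Em fm] hm]] :=
  @C0_max T le Htree R f `|f t| [set x | [/\ le t x, rho x = rho t & f x = f t]] hf _ _ _ _.
- by rewrite normr_gt0.
- by move=> x [_ _ ->].
- by exists t; split=> //; exact: le_refl.
- have [s [sl _]] : exists s, lt s l /\ True by have [s sl] := ll.1; exists s.
  have [x0 [[tx0 _ _] _ x0l]] := hl s sl.
  split; first exact: (le_tr Htree tx0 (tltW x0l)).
    apply/eqP; rewrite eq_le; apply/andP; split; last first.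
      by apply: inc; exact: (le_tr Htree tx0 (tltW x0l)).
    apply/ler_addgt0Pr => e e0; have [r [rl hr]] := lc ll e0.
    have [x [[_ Ex _] rx _]] := hl r rl.
    have := inc (tltW rx); rewrite Ex; lra.
  apply/eqP; rewrite -subr_eq0 -normr_le0; apply/ler_addgt0Pr => e e0.
  have [r [rl hr]] := C0_left Htree hf e0 ll.
  have [x [[_ _ fx] rx xl]] := hl r rl.
  by have := hr x rx (tltW xl); rewrite fx distrC add0r => /ltW.
- exists m; split=> // x mx Ex fx; apply: hm => //; split=> //.
  exact: (le_tr Htree tm mx).
Qed.

Lemma defect0 f m : defect f m = 0 -> f m = \sum_(u <- F m) f u.
Proof.
move=> /eqP; rewrite /defect mulf_eq0 (gt_eqF (weight_gt0 m)) /= subr_eq0.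
by move=> /eqP.
Qed.

Lemma sum_single (f : T -> R) m v : (forall u, u \in F m -> u <> v -> f u = 0) ->
  \sum_(u <- F m) f u <> 0 -> v \in F m /\ \sum_(u <- F m) f u = f v.
Proof.
move=> h nz; case: (boolP (v \in F m)) => iv.
  split=> //; rewrite (bigD1_seq v) //= big_seq_cond big1 ?addr0 // => u /andP[iu /eqP nuv].
  exact: h.
case: nz; rewrite big_seq big1 // => u iu; apply: h => // E.
by move: iv; rewrite -E iu.
Qed.

(** Let t be maximal in its level with a value of largest modulus, and suppose all coordinates (t,m)
    vanish. Then f t is the sum of f over [F t]. The terms other than [nxt t] are 0, so f takes the
    value f t again at [nxt t], against maximality. *)
Lemma tal_nonvanishing f : C0 f -> nonzero f ->
  exists t u, `|f t| = supn f /\ tal f (t, u) != 0.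
Proof.
move=> hf nf; apply: contrapT => nex.
have [t0 ft0] := C0_supn_attained Htree hf nf.
have nz : f t0 != 0 by rewrite -normr_gt0 ft0; exact: (C0_supn_gt0 Htree).
have [t [t0t Et ft hmax]] := flat_max hf nz.
have zero m : linked t m -> f m = \sum_(u <- F m) f u.
  move=> lk; apply: defect0; apply/eqP; apply: contrapT => /negP h; apply: nex.
  by exists t, m; rewrite ft ft0; split=> //; rewrite /tal /= asboolT.
have f0 (u : {classic T}) : u \in F t -> u <> nxt t -> f u = 0.
  move=> iu nu; have [tu Eu] := (hF t u).1 iu; apply: contrapT => fu.
  have zero' m : le u m -> rho m = rho u -> f m = \sum_(v <- F m) f v.
    move=> um Em; apply: zero; right; split; last 1 first.
    - move=> [tn nm]; apply: nu; exact: (succ_next_uniq Htree tu tn um nm).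
    - exact: (lt_le Htree (succ_lt Htree tu) um).
    - by rewrite Em Eu.
  (* If f u were non-zero, the nodes above u in its level where f is non-zero would be
     ever-branching: at a maximal node x keeping the value f m, the sum over [F x] cannot reduce to
     one term, which would repeat that value. *)
  apply: (nEB (G := [set m | [/\ le u m, rho m = rho u & f m <> 0]])); last first.
    by exists (rho u) => x [].
  split; first by exists u; split=> //; exact: le_refl.
  move=> m [um Em fm]; apply: contrapT => nbr.
  have [x [mx Ex fx hx]] := flat_max hf (introN eqP fm).
  have ux : le u x by exact: (le_tr Htree um mx).
  have Exu : rho x = rho u by rewrite Ex Em.
  have fx0 : f x <> 0 by rewrite fx.
  have [v [iv fv]] : exists v, v \in F x /\ f v <> 0.
    apply: contrapT => nv; apply: fx0; rewrite zero' // big_seq big1 // => v iv.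
    by apply: contrapT => fv; apply: nv; exists v.
  have only (w : {classic T}) : w \in F x -> w <> v -> f w = 0.
    move=> iw nwv; apply: contrapT => fw; apply: nbr; exists v, w.
    have [xv Ev] := (hF x v).1 iv; have [xw Ew] := (hF x w).1 iw.
    have xv' := tltW (succ_lt Htree xv); have xw' := tltW (succ_lt Htree xw).
    split; [split; split|..].
    - exact: (le_tr Htree ux xv').
    - by rewrite Ev Exu.
    - by [].
    - exact: (le_tr Htree ux xw').
    - by rewrite Ew Exu.
    - by [].
    - exact: (le_tr Htree mx xv').
    - exact: (le_tr Htree mx xw').
    - move=> vw; apply: nwv; symmetry.
      exact: (succ_next_uniq Htree xv xw vw (le_refl Htree w)).
    - move=> wv; apply: nwv.
      exact: (succ_next_uniq Htree xw xv wv (le_refl Htree v)).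
  have [_ E] := sum_single only (eq_ind _ (fun z => z <> 0) fx0 _ (zero' x ux Exu)).
  have [xv Ev] := (hF x v).1 iv.
  have xE : v = x.
    apply: hx; first exact: tltW (succ_lt Htree xv).
      by rewrite Ev.
    by rewrite -E -zero'.
  by apply: (lt_irr (le := le) (t := x)); rewrite -{2}xE; exact: succ_lt.
have zt : f t = \sum_(u <- F t) f u by apply: zero; left.
have ft0' : \sum_(u <- F t) f u <> 0 by rewrite -zt ft; exact/eqP.
have [iv E] := sum_single f0 ft0'.
have [tv Ev] := (hF t (nxt t)).1 iv.
have tE : nxt t = t.
  apply: hmax; first exact: tltW (succ_lt Htree tv).
    by rewrite Ev Et.
  by rewrite -E -zt ft.
by apply: (lt_irr (le := le) (t := t)); rewrite -{2}tE; exact: succ_lt.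
Qed.

End RhoToTalagrand.

Theorem talagrand_of_rho (T : Type) (le : T -> T -> Prop) (R : realType) : is_tree le ->
  forall rho : T -> R, increasing le rho -> (forall t, ~ bad le rho t) ->
  (forall G, ever_branching le G -> ~ constant_on rho G) -> admits_talagrand_operator R le.
Proof.
move=> Htree rho0 inc0 nb0 nEB0.
have [rho [inc lc gd nEB]] := regularize Htree inc0 nb0 nEB0.
have /boolp.choice[Fe hFe] := flat_exists Htree inc gd.
have [nxt hnxt] := nxt_exists Htree inc nEB.
pose F m := (Fe m).1; pose eta m := (Fe m).2.
have hFu m : uniq (F m) by have [] := hFe m.
have eta0 m : 0 < eta m by have [] := hFe m.
have eta1 m : eta m <= 1 by have [] := hFe m.
have hF m u : u \in F m <-> succ le m u /\ rho u = rho m by have [_ _ _ h _] := hFe m; exact: h.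
have hFn m u : succ le m u -> u \notin F m -> rho m + eta m <= rho u by have [_ _ _ _ h] := hFe m; exact: h.
exists T, (tal le rho F eta nxt); split=> [f hf|c f g _ _ p||f hf nf].
- exact: tal_c0.
- exact: tal_lin.
- by exists 1 => f hf; exact: tal_bound.
- exact: tal_nonvanishing.
Qed.

(** * From a Talagrand operator to a smooth norm *)

Section Differential.
Variable R : realType.

(* L need not be linear: increments of an unknown function are allowed, which
   is what makes the implicit differentiation of the norm below possible. *)
Definition dif (H : Type) (dom : set H) (nu : H -> R) (u : H -> R) (u0 : R) (L : H -> R) :=
  (exists K : R, 0 <= K /\ forall h, dom h -> `|L h| <= K * nu h) /\
  forall e : R, 0 < e -> exists d : R, 0 < d /\
    forall h, dom h -> nu h < d -> `|u h - u0 - L h| <= e * nu h.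

Section Rules.
Variables (H : Type) (dom : set H) (nu : H -> R).
Hypothesis nu0 : forall h, 0 <= nu h.
Local Notation dif := (dif dom nu).

Lemma dif_const c : dif (fun _ => c) c (fun _ => 0).
Proof.
split; first by exists 0; split=> // h _; rewrite normr0 mul0r.
by move=> e e0; exists 1; split=> // h _ _; rewrite !subrr normr0 mulr_ge0 // ltW.
Qed.

Lemma dif_exact (u : H -> R) u0 K : 0 <= K -> (forall h, dom h -> `|u h - u0| <= K * nu h) ->
  dif u u0 (fun h => u h - u0).
Proof.
move=> K0 hK; split; first by exists K.
by move=> e e0; exists 1; split=> // h _ _; rewrite subrr normr0 mulr_ge0 // ltW.
Qed.

Lemma dif_near u u' u0 L : (exists d : R, 0 < d /\ forall h, dom h -> nu h < d -> u h = u' h) ->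
  dif u u0 L -> dif u' u0 L.
Proof.
move=> [d [d0 hd]] [bL hu]; split=> // e e0; have [d' [d'0 hd']] := hu e e0.
exists (Order.min d d'); split=> [|h dh]; first by rewrite lt_min d0.
by rewrite lt_min => /andP[h1 h2]; rewrite -hd //; exact: hd'.
Qed.

Lemma dif_eqL u u0 L L' : (forall h, dom h -> L h = L' h) -> dif u u0 L -> dif u u0 L'.
Proof.
move=> E [[K [K0 hK]] hu]; split; first by exists K; split=> // h dh; rewrite -E //; exact: hK.
move=> e e0; have [d [d0 hd]] := hu e e0; exists d; split=> // h dh hh.
by rewrite -E //; exact: hd.
Qed.

Lemma dif_small u u0 L (e : R) : dif u u0 L -> 0 < e ->
  exists d : R, 0 < d /\ forall h, dom h -> nu h < d -> `|u h - u0| < e.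
Proof.
move=> [[K [K0 hK]] hu] e0; have [d [d0 hd]] := hu 1 ltr01.
have K1 : 0 < K + 1 by rewrite ltr_wpDl.
exists (Order.min d (e / (K + 1))); split=> [|h dh]; first by rewrite lt_min d0 divr_gt0.
rewrite lt_min ltr_pdivlMr // => /andP[h1 h2].
have := hd h dh h1; have := hK h dh; have := ler_normD (u h - u0 - L h) (L h).
rewrite subrK; have := nu0 h; lra.
Qed.

Lemma dif_add u u0 L v v0 M : dif u u0 L -> dif v v0 M ->
  dif (fun h => u h + v h) (u0 + v0) (fun h => L h + M h).
Proof.
move=> [[K [K0 hK]] hu] [[K' [K'0 hK']] hv]; split.
  exists (K + K'); split=> [|h dh]; first exact: addr_ge0.
  by rewrite mulrDl; apply: le_trans (ler_normD _ _) _; rewrite lerD ?hK ?hK'.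
move=> e e0; have e2 : 0 < e / 2 by rewrite divr_gt0.
have [d [d0 hd]] := hu _ e2; have [d' [d'0 hd']] := hv _ e2.
exists (Order.min d d'); split=> [|h dh]; first by rewrite lt_min d0.
rewrite lt_min => /andP[h1 h2].
have -> : u h + v h - (u0 + v0) - (L h + M h) = (u h - u0 - L h) + (v h - v0 - M h) by ring.
apply: le_trans (ler_normD _ _) _; have := hd h dh h1; have := hd' h dh h2; lra.
Qed.

Lemma dif_comp u u0 L (phi : R -> R) (p : R) : dif u u0 L ->
  (forall e : R, 0 < e -> exists d : R, 0 < d /\
     forall r, `|r| < d -> `|phi (u0 + r) - phi u0 - p * r| <= e * `|r|) ->
  dif (fun h => phi (u h)) (phi u0) (fun h => p * L h).
Proof.
move=> du hphi; have [[K [K0 hK]] hu] := du; split.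
  exists (`|p| * K); split=> [|h dh]; first exact: mulr_ge0.
  by rewrite normrM -mulrA ler_wpM2l // hK.
move=> e e0.
have K1 : 0 < K + 1 by rewrite ltr_wpDl.
have p1 : 0 < `|p| + 1 by rewrite ltr_wpDl.
have [d [d0 hd]] := hphi (e / 2 / (K + 1)) (divr_gt0 (divr_gt0 e0 (ltr0Sn _ _)) K1).
have [d1 [d10 hd1]] := dif_small du d0.
have [d2 [d20 hd2]] := hu 1 ltr01.
have [d3 [d30 hd3]] := hu (e / 2 / (`|p| + 1)) (divr_gt0 (divr_gt0 e0 (ltr0Sn _ _)) p1).
exists (Order.min d1 (Order.min d2 d3)); split=> [|h dh]; first by rewrite !lt_min d10 d20.
rewrite !lt_min => /and3P[h1 h2 h3].
have r1 : `|u h - u0| <= (K + 1) * nu h.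
  have := hd2 h dh h2; have := hK h dh; have := ler_normD (u h - u0 - L h) (L h).
  rewrite subrK; have := nu0 h; lra.
have := hd (u h - u0) (hd1 h dh h1); rewrite subrKC => h4.
have -> : phi (u h) - phi u0 - p * L h =
  (phi (u h) - phi u0 - p * (u h - u0)) + p * (u h - u0 - L h) by ring.
apply: le_trans (ler_normD _ _) _; rewrite normrM.
have h5 : e / 2 / (K + 1) * `|u h - u0| <= e / 2 * nu h.
  have -> : e / 2 * nu h = e / 2 / (K + 1) * ((K + 1) * nu h) by field; rewrite gt_eqF.
  by rewrite ler_wpM2l // !divr_ge0 // ltW.
have h6 : `|p| * `|u h - u0 - L h| <= e / 2 * nu h.
  apply: (le_trans (y := (`|p| + 1) * (e / 2 / (`|p| + 1) * nu h))).
    apply: ler_pM => //; [by rewrite lerDl|exact: hd3].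
  have -> : (`|p| + 1) * (e / 2 / (`|p| + 1) * nu h) = e / 2 * nu h by field; rewrite gt_eqF.
  by [].
lra.
Qed.

Lemma dif_scale c u u0 L : dif u u0 L -> dif (fun h => c * u h) (c * u0) (fun h => c * L h).
Proof.
move=> du; apply: (dif_comp (phi := fun x => c * x) du) => e e0; exists 1; split=> // r _.
have -> : c * (u0 + r) - c * u0 - c * r = 0 by ring.
by rewrite normr0 mulr_ge0 // ltW.
Qed.

Lemma dif_sqr u u0 L : dif u u0 L -> dif (fun h => u h * u h) (u0 * u0) (fun h => (2 * u0) * L h).
Proof.
move=> du; apply: (dif_comp (phi := fun x => x * x) du) => e e0; exists e; split=> // r hr.
have -> : (u0 + r) * (u0 + r) - u0 * u0 - 2 * u0 * r = r * r by ring.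
by rewrite normrM ler_wpM2r // ltW.
Qed.

(* By polarisation. *)
Lemma dif_mul u u0 L v v0 M : dif u u0 L -> dif v v0 M ->
  dif (fun h => u h * v h) (u0 * v0) (fun h => L h * v0 + u0 * M h).
Proof.
move=> du dv.
have h1 := dif_sqr (dif_add du dv); have h2 := dif_sqr (dif_add du (dif_scale (-1) dv)).
have := dif_add (dif_scale (1 / 4) h1) (dif_scale (- (1 / 4)) h2).
set w := fun h => _; set w0 := _ + _; set W := fun h => _ => h3.
have -> : u0 * v0 = w0 by rewrite /w0; field.
apply: dif_eqL (dif_near _ h3) => [h _|]; first by rewrite /W; field.
by exists 1; split=> // h _ _; rewrite /w; field.
Qed.

Lemma dif_inv u u0 L : u0 != 0 -> dif u u0 L ->
  dif (fun h => (u h)^-1) u0^-1 (fun h => - (u0^-1 * u0^-1) * L h).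
Proof.
move=> n0 du; apply: (dif_comp (phi := fun x => x^-1) du) => e e0.
have p0 : 0 < `|u0| by rewrite normr_gt0.
have p3 : 0 < `|u0| ^+ 3 by rewrite exprn_gt0.
exists (Order.min (`|u0| / 2) (e * `|u0| ^+ 3 / 2)); split=> [|r].
  by rewrite lt_min !divr_gt0 // mulr_gt0.
rewrite lt_min => /andP[r1 r2].
have s1 : `|u0| / 2 <= `|u0 + r|.
  have := ler_normB (u0 + r) r; rewrite addrK; lra.
have s0 : u0 + r != 0 by rewrite -normr_gt0; apply: lt_le_trans s1; rewrite divr_gt0.
have -> : (u0 + r)^-1 - u0^-1 - - (u0^-1 * u0^-1) * r = r * r / (u0 * u0 * (u0 + r)).
  by field; rewrite n0 s0.
rewrite normrM normfV !normrM ler_pdivrMr ?mulr_gt0 ?normr_gt0 //.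
have : e * `|u0| ^+ 3 / 2 <= e * (`|u0| * `|u0| * `|u0 + r|).
  have -> : e * `|u0| ^+ 3 / 2 = e * (`|u0| * `|u0| * (`|u0| / 2)) by field.
  by rewrite ler_pM2l // ler_pM2l // mulr_gt0.
move=> h; have -> : e * `|r| * (`|u0| * `|u0| * `|u0 + r|) = `|r| * (e * (`|u0| * `|u0| * `|u0 + r|)) by ring.
apply: ler_wpM2l => //; exact: ltW (lt_le_trans r2 h).
Qed.

Lemma dif_exp u u0 L : dif u u0 L -> dif (fun h => expR (u h)) (expR u0) (fun h => expR u0 * L h).
Proof.
move=> du; apply: (dif_comp du) => e e0.
have E0 := expR_gt0 u0.
exists (Order.min (1 / 2) (e / (expR u0 * 2))); split=> [|r].
  by rewrite lt_min !divr_gt0 // mulr_gt0.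
rewrite lt_min => /andP[r1]; rewrite ltr_pdivlMr ?mulr_gt0 // => r2.
have -> : expR (u0 + r) - expR u0 - expR u0 * r = expR u0 * (expR r - 1 - r) by rewrite expRD; ring.
have h1 := expR_ge1Dx r; have h2 := expR_ge1Dx (- r); rewrite expRN in h2.
have Er := expR_gt0 r.
have h3 : (1 - r) * expR r <= 1 by rewrite -ler_pdivlMr // mul1r.
move: r1; rewrite ltr_norml => /andP[ra rb].
have h4 : expR r <= 1 + r + 2 * (r * r).
  have : (1 - r) * expR r <= (1 - r) * (1 + r + 2 * (r * r)).
    apply: le_trans h3 _.
    have -> : (1 - r) * (1 + r + 2 * (r * r)) = 1 + (r * r) * (1 - 2 * r) by ring.
    by rewrite lerDl mulr_ge0 // -?expr2 ?sqr_ge0 //; lra.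
  by rewrite ler_pM2l //; lra.
rewrite normrM gtr0_norm // ger0_norm; last by lra.
have h5 : expR u0 * (expR r - 1 - r) <= expR u0 * (2 * (`|r| * `|r|)).
  have -> : `|r| * `|r| = r * r by rewrite -!expr2 real_normK // num_real.
  by rewrite ler_pM2l //; lra.
apply: le_trans h5 _.
have -> : expR u0 * (2 * (`|r| * `|r|)) = `|r| * (expR u0 * 2) * `|r| by ring.
by rewrite ler_wpM2r // ltW.
Qed.

End Rules.

(** * Smooth functions that vanish on the negative half-line *)

Section Flat.
Implicit Types (x v w r : R) (n : nat).

(** The powers of 1/v make the family closed under differentiation: the derivative of [flat n] is
    [flat n.+2 - n%:R * flat n.+1]. *)
Definition flat n v : R := if 0 < v then v^-1 ^+ n * expR (- v^-1) else 0.

Lemma flat_le0 n v : v <= 0 -> flat n v = 0.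
Proof. by move=> h; rewrite /flat ltNge h. Qed.

Lemma flat_ge0 n v : 0 <= flat n v.
Proof.
rewrite /flat; case: ifP => // v0; apply: mulr_ge0; last exact: expR_ge0.
by rewrite exprn_ge0 // invr_ge0 ltW.
Qed.

Lemma flatS n v : v * flat n.+1 v = flat n v.
Proof.
rewrite /flat; case: ifP => [v0|_]; last by rewrite mulr0.
by rewrite exprS !mulrA divff ?gt_eqF // mul1r.
Qed.

Lemma flat_small n v : 0 < v -> flat n v <= (n.+2%:R ^+ n.+2) * (v * v).
Proof.
move=> v0; rewrite /flat v0; set w := v^-1.
have w0 : 0 < w by rewrite invr_gt0.
have m0 : 0 < n.+2%:R :> R by rewrite ltr0n.
have h : w ^+ n.+2 <= n.+2%:R ^+ n.+2 * expR w.
  have -> : expR w = expR (w / n.+2%:R) ^+ n.+2.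
    by rewrite -expRM_natl mulrC divfK // gt_eqF.
  rewrite -exprMn; apply: lerXn2r; [exact: ltW|by rewrite nnegrE ltW // mulr_gt0 // expR_gt0|].
  rewrite [leRHS]mulrC -ler_pdivrMr //; apply: le_trans (expR_ge1Dx _).
  by rewrite lerDr.
rewrite expRN -ler_pdivlMr ?invr_gt0 ?expR_gt0 // invrK.
have -> : n.+2%:R ^+ n.+2 * (v * v) * expR w = n.+2%:R ^+ n.+2 * expR w / w ^+ 2.
  by rewrite /w -exprVn invrK expr2; ring.
by rewrite ler_pdivlMr ?exprn_gt0 // -exprD addn2.
Qed.

Lemma flat_dif n v : forall e : R, 0 < e -> exists d : R, 0 < d /\
  forall r, `|r| < d ->
    `|flat n (v + r) - flat n v - (flat n.+2 v - n%:R * flat n.+1 v) * r| <= e * `|r|.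
Proof.
case: (ltgtP v 0) => [vn|vp|->] e e0.
- exists (- v); split=> [|r]; first by rewrite oppr_gt0.
  rewrite ltr_norml opprK => /andP[_ h].
  have vr : v + r <= 0 by lra.
  by rewrite !flat_le0 ?(ltW vn) // mulr0 !subr0 mul0r subr0 normr0 mulr_ge0 // ltW.
- have id0 : dif [set: R] (fun r => `|r|) (fun r => v + r) v (fun r => r).
    split; first by exists 1; split=> // r _; rewrite mul1r.
    move=> c c0; exists 1; split=> // r _ _.
    have -> : v + r - v - r = 0 by ring.
    by rewrite normr0 mulr_ge0 // ltW.
  have nu0 r : 0 <= `|r| by [].
  have di := dif_inv nu0 (lt0r_neq0 vp) id0.
  have dpow m : dif [set: R] (fun r => `|r|) (fun r => (v + r)^-1 ^+ m) (v^-1 ^+ m)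
      (fun r => - (m%:R * v^-1 ^+ m.+1) * r).
    elim: m => [|m IH].
      apply: dif_eqL (dif_const _ nu0 1) => r _; by rewrite mul0r oppr0 mul0r.
    have := dif_mul nu0 di IH; rewrite -exprS => h.
    apply: dif_eqL (dif_near (u' := fun r => (v + r)^-1 ^+ m.+1) _ h) => [r _|].
      by rewrite -natr1 !exprS; ring.
    by exists 1; split=> // r _ _; rewrite exprS.
  have de := dif_exp nu0 (dif_scale nu0 (-1) di).
  have [_ h] := dif_mul nu0 (dpow n) de.
  have [d [d0 hd]] := h e e0.
  exists (Order.min d v); split=> [|r]; first by rewrite lt_min d0.
  rewrite lt_min => /andP[r1 r2].
  have vr : 0 < v + r by move: r2; rewrite ltr_norml => /andP[? _]; lra.
  have := hd r I r1; rewrite /flat vr vp !mulN1r.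
  congr (`|_ - _| <= _); rewrite !exprS; ring.
- have nC0 : 0 < n.+2%:R ^+ n.+2 :> R by rewrite exprn_gt0 // ltr0n.
  exists (e / n.+2%:R ^+ n.+2); split=> [|r]; first exact: divr_gt0.
  rewrite ltr_pdivlMr // add0r !(flat_le0 _ (lexx 0)) mulr0 !subr0 mul0r subr0 => hr.
  rewrite ger0_norm ?flat_ge0 //; case: (leP r 0) => [r0|r0].
    by rewrite flat_le0 // mulr_ge0 // ltW.
  apply: le_trans (flat_small n r0) _; rewrite gtr0_norm // in hr *.
  by rewrite mulrA ler_pM2r // mulrC ltW.
Qed.

Definition psi v := v * flat 0 v.
Definition dpsi v := flat 0 v + flat 1 v.

Lemma psi_le0 v : v <= 0 -> psi v = 0.
Proof. by move=> h; rewrite /psi flat_le0 // mulr0. Qed.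

Lemma psi_ge0 v : 0 <= psi v.
Proof.
case: (leP v 0) => h; first by rewrite psi_le0.
by rewrite mulr_ge0 ?flat_ge0 // ltW.
Qed.

Lemma dpsi_ge0 v : 0 <= dpsi v. Proof. by rewrite addr_ge0 // flat_ge0. Qed.

Lemma dpsi_gt0 v : 0 < v -> 0 < dpsi v.
Proof.
move=> h; rewrite /dpsi ltr_pwDl ?flat_ge0 // /flat h expr0 mul1r; exact: expR_gt0.
Qed.

(* Divided by exp(-1/u), this is exp(x) >= 1 + x for x = 1/u - 1/v. *)
Lemma psi_tangent u v : psi u + dpsi u * (v - u) <= psi v.
Proof.
case: (leP u 0) => u0.
  by rewrite psi_le0 // /dpsi !flat_le0 // addr0 mul0r addr0 psi_ge0.
have E0 := expR_gt0 (- u^-1).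
have -> : psi u + dpsi u * (v - u) = expR (- u^-1) * (v * (1 + u^-1) - 1).
  by rewrite /psi /dpsi /flat u0 expr0 expr1; field; rewrite gt_eqF.
have iu0 : 0 < u^-1 by rewrite invr_gt0.
case: (leP v 0) => v0.
  rewrite psi_le0 // pmulr_rle0 //.
  have : v * (1 + u^-1) <= 0 by rewrite mulr_le0_ge0 // addr_ge0 // ltW.
  lra.
have -> : psi v = expR (- u^-1) * (v * expR (u^-1 - v^-1)).
  by rewrite /psi /flat v0 expr0 mul1r mulrCA -expRD addrA addNr add0r.
rewrite ler_pM2l //.
have -> : v * (1 + u^-1) - 1 = v * (1 + (u^-1 - v^-1)) by field; rewrite !gt_eqF.
by rewrite ler_pM2l // expR_ge1Dx.
Qed.

Lemma psi_mono u v : u <= v -> psi u <= psi v.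
Proof.
move=> uv; apply: le_trans (psi_tangent u v).
by rewrite lerDl mulr_ge0 ?dpsi_ge0 // subr_ge0.
Qed.

Lemma psi_convex l m u v : 0 < l -> 0 < m ->
  psi ((l * u + m * v) / (l + m)) <= (l * psi u + m * psi v) / (l + m).
Proof.
move=> l0 m0; set w := _ / _.
have lm : 0 < l + m by rewrite addr_gt0.
rewrite ler_pdivlMr //.
have h1 : l * (psi w + dpsi w * (u - w)) <= l * psi u by rewrite ler_pM2l // psi_tangent.
have h2 : m * (psi w + dpsi w * (v - w)) <= m * psi v by rewrite ler_pM2l // psi_tangent.
have : l * (psi w + dpsi w * (u - w)) + m * (psi w + dpsi w * (v - w)) = psi w * (l + m).
  by rewrite /w; field; rewrite gt_eqF.
lra.
Qed.

(** Linear growth: a single excess above 2 already gives a term above 1. *)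
Lemma psi_ge v : v - 1 <= psi v.
Proof.
case: (leP v 0) => v0; first by rewrite psi_le0 //; lra.
rewrite /psi /flat v0 expr0 mul1r.
have h := expR_ge1Dx (- v^-1).
have : v * (1 - v^-1) <= v * expR (- v^-1) by rewrite ler_pM2l.
by rewrite mulrBr mulr1 divff // gt_eqF.
Qed.

End Flat.

End Differential.

(** * Joint convexity of the excess, and its derivative *)

Section Perspective.
Variable R : realType.
Implicit Types a b l m x y : R.

(** Joint convexity of a^2 / x for x > 0; the difference of the two sides is a square over x y. *)
Lemma sqrD_div_le x y a b : 0 < x -> 0 < y ->
  (a + b) ^+ 2 <= (x + y) * (a ^+ 2 / x + b ^+ 2 / y).
Proof.
move=> x0 y0; rewrite -subr_ge0.
have -> : (x + y) * (a ^+ 2 / x + b ^+ 2 / y) - (a + b) ^+ 2 = (a * y - b * x) ^+ 2 / (x * y).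
  by field; rewrite !gt_eqF.
by rewrite divr_ge0 ?sqr_ge0 // mulr_ge0 // ltW.
Qed.

(** For |a| < l it is positive exactly when a^2 + b^2 > l^2. *)
Definition excess l a b := b ^+ 2 / (l ^+ 2 - a ^+ 2) - 1.

Lemma sqr_gap l a : `|a| < l -> 0 < l ^+ 2 - a ^+ 2.
Proof.
move=> h; rewrite subr_gt0 -(real_normK (num_real a)) ltr_pXn2r ?nnegrE //.
exact: le_trans (ltW h).
Qed.

(* Joint convexity of (a, b, l) |-> l * excess l a b. *)
Lemma excess_add l m a a' b b' : `|a| < l -> `|a'| < m ->
  excess (l + m) (a + a') (b + b') <= (l * excess l a b + m * excess m a' b') / (l + m).
Proof.
move=> la ma; have l0 : 0 < l := le_lt_trans (normr_ge0 _) la.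
have m0 : 0 < m := le_lt_trans (normr_ge0 _) ma.
have X0 := sqr_gap la; have X'0 := sqr_gap ma.
have Z0 : 0 < (l + m) ^+ 2 - (a + a') ^+ 2.
  by apply: sqr_gap; apply: le_lt_trans (ler_normD _ _) _; rewrite ltrD.
rewrite /excess; set X := l ^+ 2 - a ^+ 2 in X0 *; set X' := m ^+ 2 - a' ^+ 2 in X'0 *.
set Z := _ - (a + a') ^+ 2 in Z0 *.
have Y0 : 0 < X / l by rewrite divr_gt0.
have Y'0 : 0 < X' / m by rewrite divr_gt0.
have lm : 0 < l + m by rewrite addr_gt0.
have h1 : (l + m) * (X / l + X' / m) <= Z.
  have := sqrD_div_le a a' l0 m0; rewrite /Z /X /X'.
  have -> : (l + m) * ((l ^+ 2 - a ^+ 2) / l + (m ^+ 2 - a' ^+ 2) / m) =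
    (l + m) ^+ 2 - (l + m) * (a ^+ 2 / l + a' ^+ 2 / m) by field; rewrite !gt_eqF.
  lra.
have h2 := sqrD_div_le b b' Y0 Y'0.
have -> : (l * (b ^+ 2 / X - 1) + m * (b' ^+ 2 / X' - 1)) / (l + m) =
  (b ^+ 2 / (X / l) + b' ^+ 2 / (X' / m)) / (l + m) - 1.
  by field; rewrite !gt_eqF //.
rewrite lerD2r ler_pdivrMr // mulrAC ler_pdivlMr //.
set S := b ^+ 2 / (X / l) + _ in h2 *.
have S0 : 0 <= S by rewrite addr_ge0 // divr_ge0 ?sqr_ge0 // ltW.
have : (b + b') ^+ 2 * (l + m) <= (X / l + X' / m) * S * (l + m) by rewrite ler_pM2r.
have : S * ((l + m) * (X / l + X' / m)) <= S * Z by rewrite ler_wpM2l.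
lra.
Qed.

Lemma excess_anti l l' a b : `|a| < l -> l <= l' -> excess l' a b <= excess l a b.
Proof.
move=> la ll'; rewrite /excess lerD2r ler_wpM2l ?sqr_ge0 //.
have X0 := sqr_gap la; have X'0 := sqr_gap (lt_le_trans la ll').
have l0 := le_trans (normr_ge0 _) (ltW la).
by rewrite lef_pV2 ?posrE // lerD2r ler_pXn2r ?nnegrE // (le_trans l0).
Qed.

Lemma excess_le0 l a b : `|a| < l -> b ^+ 2 <= l ^+ 2 - a ^+ 2 -> excess l a b <= 0.
Proof. by move=> la h; rewrite /excess subr_le0 ler_pdivrMr ?sqr_gap // mul1r. Qed.

Lemma excess_scale c l a b : 0 < `|c| -> `|a| < l -> excess (`|c| * l) (c * a) (c * b) = excess l a b.
Proof.
move=> c0 la; have X0 := sqr_gap la; rewrite /excess !exprMn.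
have -> : `|c| ^+ 2 = c ^+ 2 by rewrite real_normK ?num_real.
have cn : c != 0 by rewrite -normr_gt0.
rewrite -mulrBr; field; rewrite cn gt_eqF //.
Qed.

Lemma sqr_le_norm x y : `|x| <= y -> x ^+ 2 <= y ^+ 2.
Proof.
move=> h; rewrite -(real_normK (num_real x)) ler_pXn2r ?nnegrE //.
exact: le_trans h.
Qed.

Section Dif.
Variables (H : Type) (dom : set H) (nu : H -> R).
Hypothesis nu0 : forall h, 0 <= nu h.
Local Notation dif := (dif dom nu).

Lemma dif_flat n u u0 L : dif u u0 L ->
  dif (fun h => flat n (u h)) (flat n u0) (fun h => (flat n.+2 u0 - n%:R * flat n.+1 u0) * L h).
Proof. by move=> du; apply: (dif_comp nu0 du); exact: flat_dif. Qed.

Lemma dif_psi u u0 L : dif u u0 L ->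
  dif (fun h => psi (u h)) (psi u0) (fun h => dpsi u0 * L h).
Proof.
move=> du; apply: dif_eqL (dif_mul nu0 du (dif_flat 0 du)) => h _.
by rewrite mul0r subr0 mulrA flatS /dpsi; ring.
Qed.

Lemma dif_excess ul l Ll ua a La ub b Lb : `|a| < l ->
  dif ul l Ll -> dif ua a La -> dif ub b Lb ->
  dif (fun h => excess (ul h) (ua h) (ub h)) (excess l a b)
    (fun h => (- 2 * l * b ^+ 2 / (l ^+ 2 - a ^+ 2) ^+ 2) * Ll h +
      ((2 * a * b ^+ 2 / (l ^+ 2 - a ^+ 2) ^+ 2) * La h + (2 * b / (l ^+ 2 - a ^+ 2)) * Lb h)).
Proof.
move=> la dl da db; have X0 := sqr_gap la.
have dy := dif_add (dif_sqr nu0 dl) (dif_scale nu0 (-1) (dif_sqr nu0 da)).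
have yE x y : x * x + -1 * (y * y) = x ^+ 2 - y ^+ 2 by rewrite mulN1r.
have := dif_add (dif_mul nu0 (dif_sqr nu0 db) (dif_inv nu0 _ dy)) (dif_const dom nu0 (-1)).
rewrite yE -expr2 gt_eqF // => /(_ isT) h.
apply: dif_eqL (dif_near _ h) => [k _|]; first by field; rewrite gt_eqF.
by exists 1; split=> // k _ _; rewrite yE /excess expr2.
Qed.

Lemma dif_sum (I : Type) (s : seq I) (u : I -> H -> R) (u0 : I -> R) (L : I -> H -> R) :
  (forall i, dif (u i) (u0 i) (L i)) ->
  dif (fun h => \sum_(i <- s) u i h) (\sum_(i <- s) u0 i) (fun h => \sum_(i <- s) L i h).
Proof.
move=> du; elim: s => [|i s IH].
  rewrite big_nil; apply: dif_eqL (dif_near _ (dif_const dom nu0 0)) => [h _|].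
    by rewrite big_nil.
  by exists 1; split=> // h _ _; rewrite big_nil.
rewrite big_cons; apply: dif_eqL (dif_near _ (dif_add (du i) IH)) => [h _|].
  by rewrite big_cons.
by exists 1; split=> // h _ _; rewrite big_cons.
Qed.

End Dif.
End Perspective.

(** * The norm defined by a Talagrand operator *)

Section TalagrandNorm.
Variables (T : Type) (le : T -> T -> Prop).
Hypothesis Htree : is_tree le.
Variables (R : realType) (M : Type) (Op : (T -> R) -> ((T * M)%type -> R)).
Local Notation C0 := (@C0 T le R).
Local Notation P := {classic (T * M)%type}.
Local Notation V := (T -> R).
Local Notation idx := (bool * P)%type.
Hypothesis Op_c0 : forall f, C0 f -> c0 (Op f).
Hypothesis Op_lin : forall a f g, C0 f -> C0 g -> forall p,
  Op (fadd (fscale a f) g) p = a * Op f p + Op g p.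
Variable C : R.
Hypothesis C_ge0 : 0 <= C.
Hypothesis Op_le : forall f, C0 f -> forall p, `|Op f p| <= C * supn f.
Hypothesis Op_tal : forall f, C0 f -> nonzero f ->
  exists t u, `|f t| = supn f /\ Op f (t, u) != 0.
Implicit Types (f h : T -> R) (p : P) (l m : R).

Definition at1 f p : R := f (fst (p : T * M)).

Definition mass (s : seq P) l f := \sum_(p <- s) psi (excess l (at1 f p) (Op f p)).

(** The strict inequality keeps all denominators l^2 - f(t)^2 positive; bounding every finite
    partial sum replaces the sum over all pairs. *)
Definition admissible f l := supn f < l /\ forall s, uniq s -> mass s l f <= 1.

Definition tnorm f := inf [set l | admissible f l].

Lemma Op_add f g p : C0 f -> C0 g -> Op (fadd f g) p = Op f p + Op g p.
Proof.
move=> hf hg; rewrite -[Op f p]mul1r -Op_lin //; congr (Op _ p).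
by apply: funext => x; rewrite /fadd /fscale mul1r.
Qed.

Lemma Op_scale a f p : C0 f -> Op (fscale a f) p = a * Op f p.
Proof.
move=> hf; have Z := C0_0 Htree R.
have O : Op (fun=> 0) p = 0.
  have := Op_add p Z Z; rewrite (_ : fadd _ _ = fun=> 0); last by apply: funext => x; rewrite /fadd addr0.
  lra.
rewrite -[RHS]addr0 -[in RHS]O -Op_lin //; congr (Op _ p).
by apply: funext => x; rewrite /fadd addr0.
Qed.

Lemma at1_lt f p l : C0 f -> supn f < l -> `|at1 f p| < l.
Proof. by move=> hf; apply: le_lt_trans; exact: (C0_le_supn Htree _ hf). Qed.

Lemma mass_anti s f l m : C0 f -> supn f < l -> l <= m -> mass s m f <= mass s l f.
Proof.
move=> hf fl lm; apply: ler_sum => p _; apply: psi_mono; apply: excess_anti => //.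
exact: at1_lt.
Qed.

Lemma admissible_up f l m : C0 f -> admissible f l -> l <= m -> admissible f m.
Proof.
move=> hf [h1 h2] lm; split; first exact: lt_le_trans lm.
by move=> s us; apply: le_trans (h2 s us); exact: mass_anti.
Qed.

Lemma admissible_big f l : C0 f -> (1 + C) * supn f < l -> admissible f l.
Proof.
move=> hf hl; have s0 := supn_ge0 f.
have fl : supn f < l by apply: le_lt_trans hl; rewrite mulrDl mul1r lerDl mulr_ge0.
split=> // s _; rewrite /mass big1 ?ler01 // => p _; apply: psi_le0.
apply: excess_le0; first exact: at1_lt.
have h1 := sqr_le_norm (Op_le hf p).
have h2 : at1 f p ^+ 2 <= supn f ^+ 2 by apply: sqr_le_norm; exact: (C0_le_supn Htree _ hf).
have h3 : ((1 + C) * supn f) ^+ 2 <= l ^+ 2.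
  apply: sqr_le_norm; rewrite ger0_norm; first exact: ltW.
  by rewrite mulr_ge0 // addr_ge0.
have : 0 <= C * supn f ^+ 2 by rewrite mulr_ge0 // exprn_ge0.
move: h1 h3; rewrite !exprMn; lra.
Qed.

Lemma has_inf_admissible f : C0 f -> has_inf [set l | admissible f l].
Proof.
move=> hf; split; last by exists (supn f) => l [/ltW].
by exists ((1 + C) * supn f + 1); apply: admissible_big => //; rewrite ltrDl.
Qed.

Lemma tnorm_le f l : C0 f -> admissible f l -> tnorm f <= l.
Proof. by move=> hf hl; apply: ge_inf => //; have [] := has_inf_admissible hf. Qed.

Lemma tnorm_lt f l : C0 f -> tnorm f < l -> admissible f l.
Proof.
move=> hf hl; have e0 : 0 < l - tnorm f by rewrite subr_gt0.
have [m hm] := inf_adherent e0 (has_inf_admissible hf).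
by rewrite subrKC => /ltW; exact: admissible_up.
Qed.

Lemma supn_le_tnorm f : C0 f -> supn f <= tnorm f.
Proof.
move=> hf; apply: lb_le_inf; first by have [] := has_inf_admissible hf.
by move=> l [/ltW].
Qed.

Lemma tnorm_le_supn f : C0 f -> tnorm f <= (1 + C) * supn f.
Proof.
move=> hf; apply/ler_addgt0Pl => e e0; apply: tnorm_le => //.
by apply: admissible_big => //; rewrite ltrDr.
Qed.

Lemma admissible_add f g l m : C0 f -> C0 g -> admissible f l -> admissible g m ->
  admissible (fadd f g) (l + m).
Proof.
move=> hf hg [f1 f2] [g1 g2]; split; first by apply: le_lt_trans (supn_add Htree hf hg) _; rewrite ltrD.
move=> s us.
have l0 : 0 < l := le_lt_trans (supn_ge0 f) f1.
have m0 : 0 < m := le_lt_trans (supn_ge0 g) g1.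
have lm : 0 < l + m by rewrite addr_gt0.
apply: (le_trans (y := (l * mass s l f + m * mass s m g) / (l + m))).
  rewrite /mass !mulr_sumr -big_split mulr_suml; apply: ler_sum => p _.
  apply: le_trans (psi_convex _ _ l0 m0); apply: psi_mono; rewrite Op_add //.
  by apply: excess_add; exact: at1_lt.
rewrite ler_pdivrMr // mul1r.
have : l * mass s l f <= l * 1 by rewrite ler_pM2l // f2.
have : m * mass s m g <= m * 1 by rewrite ler_pM2l // g2.
lra.
Qed.

Lemma tnorm_add f g : C0 f -> C0 g -> tnorm (fadd f g) <= tnorm f + tnorm g.
Proof.
move=> hf hg; apply/ler_addgt0Pl => e e0.
have -> : e + (tnorm f + tnorm g) = (tnorm f + e / 2) + (tnorm g + e / 2) by field.
have e2 : 0 < e / 2 by rewrite divr_gt0.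
apply: tnorm_le; first exact: C0_add.
by apply: admissible_add => //; apply: tnorm_lt => //; rewrite ltrDl.
Qed.

Lemma tnorm_scale a f : C0 f -> tnorm (fscale a f) = `|a| * tnorm f.
Proof.
have aux b g : b != 0 -> C0 g -> tnorm (fscale b g) <= `|b| * tnorm g.
  move=> bn hg; have b0 : 0 < `|b| by rewrite normr_gt0.
  rewrite mulrC -ler_pdivrMr //; apply/ler_addgt0Pl => e e0; rewrite ler_pdivrMr // mulrC.
  apply: tnorm_le; first exact: C0_scale.
  have [h1 h2] : admissible g (e + tnorm g) by apply: tnorm_lt => //; rewrite ltrDr.
  split=> [|s us]; first by rewrite (supn_scale Htree) // ltr_pM2l.
  apply: le_trans (h2 s us); apply: ler_sum => p _.
  by rewrite Op_scale // /at1 /fscale excess_scale //; exact: at1_lt.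
move=> hf; have [->|an] := eqVneq a 0.
  rewrite normr0 mul0r; apply/eqP; rewrite eq_le; apply/andP; split.
    apply: le_trans (tnorm_le_supn _) _; first exact: C0_scale.
    by rewrite (supn_scale Htree) // normr0 mul0r mulr0.
  apply: le_trans (supn_ge0 _) (supn_le_tnorm _); exact: C0_scale.
apply/eqP; rewrite eq_le; apply/andP; split; first exact: aux.
have ai : a^-1 != 0 by rewrite invr_eq0.
have := aux a^-1 (fscale a f) ai (C0_scale Htree a hf).
have -> : fscale a^-1 (fscale a f) = f by apply: funext => x; rewrite /fscale mulKf.
by rewrite normfV mulrC ler_pdivlMr ?normr_gt0 // mulrC.
Qed.

Lemma tnorm_equiv : equiv_norm le tnorm.
Proof.
split; [exact: tnorm_add|exact: tnorm_scale| |].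
- move=> f hf f0 t; apply/eqP; rewrite -normr_le0 -f0.
  exact: le_trans (C0_le_supn Htree t hf) (supn_le_tnorm hf).
- exists 1, (1 + C); split=> //; first by rewrite ltr_wpDr.
  by move=> f hf; rewrite mul1r; split; [exact: supn_le_tnorm|exact: tnorm_le_supn].
Qed.

Lemma tnorm_lip f h : C0 f -> C0 h -> `|tnorm (fadd f h) - tnorm f| <= (1 + C) * supn h.
Proof.
move=> hf hh; have hs := tnorm_le_supn hh.
have h1 := tnorm_add hf hh.
have h2 := tnorm_add (C0_add Htree hf hh) (C0_scale Htree (-1) hh).
rewrite (_ : fadd (fadd f h) _ = f) in h2; last first.
  by apply: funext => x; rewrite /fadd /fscale mulN1r addrK.
by move: h2; rewrite tnorm_scale // normrN1 mul1r => h2; rewrite ler_norml; apply/andP; split; lra.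
Qed.

(** The only use of the Talagrand property: as l decreases to the supremum norm, the denominator at
    a pair (t,u) with |f t| maximal tends to 0 while its numerator does not, so l stops being
    admissible. *)
Lemma supn_lt_tnorm f : C0 f -> nonzero f -> supn f < tnorm f.
Proof.
move=> hf nf; have s0 := C0_supn_gt0 Htree hf nf.
have [t [u [ft b0]]] := Op_tal hf nf.
have E : tnorm f = supn f -> False.
  move=> E; set b := Op f (t, u) in b0; have bb : 0 < b ^+ 2 by rewrite exprn_even_gt0.
  have s1 : 0 < 2 * supn f + 1 by lra.
  (* Chosen so that three times the denominator stays below b^2: the excess is then above 2 and its
     psi above 1. *)
  set d := Order.min 1 (b ^+ 2 / (4 * (2 * supn f + 1))).
  have d0 : 0 < d by rewrite lt_min ltr01 divr_gt0 // mulr_gt0.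
  have [dl1 dl2] : d <= 1 /\ d * (4 * (2 * supn f + 1)) <= b ^+ 2.
    split; first by rewrite ge_min lexx.
    by rewrite -ler_pdivlMr ?mulr_gt0 // ge_min lexx orbT.
  have [h1 /(_ [:: (t, u) : P] isT)] : admissible f (supn f + d) by apply: tnorm_lt => //; rewrite E ltrDl.
  rewrite /mass big_seq1 /at1 /= -/b leNgt => /negP; apply.
  have a1 : `|f t| < supn f + d by rewrite ft.
  have y0 := sqr_gap a1.
  have y1 : ((supn f + d) ^+ 2 - f t ^+ 2) * 3 < b ^+ 2.
    have -> : f t ^+ 2 = supn f ^+ 2 by rewrite -ft real_normK ?num_real.
    have : d * d <= d * 1 by rewrite ler_pM2l.
    have -> : (supn f + d) ^+ 2 - supn f ^+ 2 = d * (2 * supn f) + d * d by ring.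
    have : 0 < d * (2 * supn f) by rewrite !mulr_gt0.
    lra.
  apply: lt_le_trans (psi_ge _); rewrite /excess.
  have : 3 < b ^+ 2 / ((supn f + d) ^+ 2 - f t ^+ 2) by rewrite ltr_pdivlMr // mulrC.
  lra.
by rewrite lt_neqAle supn_le_tnorm // andbT; apply/eqP => /esym.
Qed.


(* Near a non-zero function, only finitely many terms of the masses that define
   the norm are non-zero. *)
Definition finitary (U : set (T -> R)) (s0 : seq P) (l2 : R) : Prop :=
  [/\ uniq s0, U `<=` C0,
      (forall f, U f -> exists d : R, 0 < d /\ forall h, C0 h -> supn h < d -> U (fadd f h)),
      (forall f, U f -> supn f < l2 /\ l2 < tnorm f) &
      (forall f p l, U f -> p \notin s0 -> l2 < l -> excess l (at1 f p) (Op f p) <= 0)].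

(** With w a third of the gap between the two norms at f0, nearby f satisfy |f| < supn f0 + w, and
    |Op f p| <= w for all but finitely many p. For those p the excess is at most 0, as (supn f0 +
    w)^2 + w^2 <= (supn f0 + 2w)^2. *)
Lemma finitary_ex f0 : C0 f0 -> nonzero f0 -> exists U s0 l2, finitary U s0 l2 /\ U f0.
Proof.
move=> hf0 nf0; have gap := supn_lt_tnorm hf0 nf0.
set w := (tnorm f0 - supn f0) / 3.
have w0 : 0 < w by rewrite divr_gt0 // subr_gt0.
have C1 : 0 < 1 + C by rewrite ltr_wpDr.
set d := w / (2 * (1 + C)).
have d0 : 0 < d by rewrite divr_gt0 // mulr_gt0.
have dw : (1 + C) * d = w / 2 by rewrite /d; field; rewrite gt_eqF.
have dw1 : d <= w / 2 by rewrite -dw mulrDl mul1r lerDl mulr_ge0 // ltW.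
have w2 : 0 < w / 2 by rewrite divr_gt0.
have [s sP] : exists s : seq P, [set p | w / 2 <= `|Op f0 p|] = [set` s].
  by have /(@finite_seqP P) := Op_c0 hf0 w2.
pose df f := fadd f (fscale (-1) f0).
have hdf f : C0 f -> C0 (df f) by move=> hf; exact: C0_add Htree _ _ _ hf (C0_scale Htree (-1) hf0).
have dfE f : fadd f0 (df f) = f.
  by apply: funext => x; rewrite /fadd /df /fscale /fadd; ring.
exists [set f | C0 f /\ supn (df f) < d], (undup s), (supn f0 + 2 * w); split; last first.
  split=> //; rewrite (_ : df f0 = fun=> 0); last first.
    by apply: funext => x; rewrite /df /fadd /fscale; ring.
  apply: le_lt_trans d0; apply: supn_le => // x; by rewrite normr0.
have near f : C0 f -> supn (df f) < d -> supn f < supn f0 + w.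
  move=> hf hd; have := supn_add Htree hf0 (hdf f hf); rewrite dfE; lra.
split; first exact: undup_uniq.
- by move=> f [].
- move=> f [hf hd]; exists (d - supn (df f)); split=> [|h hh hs]; first by rewrite subr_gt0.
  split; first exact: C0_add.
  have -> : df (fadd f h) = fadd (df f) h.
    by apply: funext => x; rewrite /df /fadd /fscale; ring.
  have := supn_add Htree (hdf f hf) hh; lra.
- move=> f [hf hd]; split; first by have := near f hf hd; lra.
  have := tnorm_lip hf0 (hdf f hf); rewrite dfE ler_norml => /andP[h1 _].
  have : (1 + C) * supn (df f) < (1 + C) * d by rewrite ltr_pM2l.
  rewrite dw; have : tnorm f0 = supn f0 + 3 * w by rewrite /w; field.
  lra.
- move=> f p l [hf hd] ps hl; have sf := near f hf hd.
  have hp : `|Op f0 p| < w / 2.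
    rewrite ltNge; apply/negP => hp; move: ps; rewrite mem_undup => /negP; apply.
    have : [set` s] p by rewrite -sP.
    by [].
  have bp : `|Op f p| <= w.
    have -> : Op f p = Op f0 p + Op (df f) p by rewrite -Op_add ?dfE //; exact: hdf.
    apply: le_trans (ler_normD _ _) _.
    have := Op_le (hdf f hf) p.
    have : C * supn (df f) <= C * d by rewrite ler_wpM2l // ltW.
    have : C * d <= (1 + C) * d by rewrite mulrDl mul1r lerDr ltW.
    rewrite dw; lra.
  have sl : supn f < l by lra.
  apply: excess_le0; first exact: at1_lt.
  have h1 := sqr_le_norm bp.
  have h2 : at1 f p ^+ 2 <= (supn f0 + w) ^+ 2.
    apply: sqr_le_norm; apply: le_trans (ltW sf); exact: (C0_le_supn Htree _ hf).
  have f00 := supn_ge0 f0.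
  have h3 : (supn f0 + 2 * w) ^+ 2 <= l ^+ 2.
    apply: sqr_le_norm; rewrite ger0_norm; first exact: ltW.
    by rewrite addr_ge0 // mulr_ge0 // ltW.
  have : 0 <= w * supn f0 by rewrite mulr_ge0 // ltW.
  move: h1 h2 h3; have : 0 <= w ^+ 2 by rewrite sqr_ge0.
  lra.
Qed.

(** * Smoothness of the norm near a fixed non-zero function *)

Section Local.
Variables (U : set (T -> R)) (s0 : seq P) (l2 : R).
Hypothesis Hfin : finitary U s0 l2.

Let uniq_s0 : uniq s0. Proof. by have [] := Hfin. Qed.
Let UC0 f : U f -> C0 f. Proof. by have [_ h _ _ _] := Hfin; exact: h. Qed.
Let Uopen f : U f -> exists d : R, 0 < d /\ forall h, C0 h -> supn h < d -> U (fadd f h).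
Proof. by have [_ _ h _ _] := Hfin; exact: h. Qed.
Let Ul2 f : U f -> supn f < l2 /\ l2 < tnorm f.
Proof. by have [_ _ _ h _] := Hfin; exact: h. Qed.
Let Uout f p l : U f -> p \notin s0 -> l2 < l -> excess l (at1 f p) (Op f p) <= 0.
Proof. by have [_ _ _ _ h] := Hfin; exact: h. Qed.

Let at1N f p : U f -> `|at1 f p| < tnorm f.
Proof. by move=> Uf; have [h1 h2] := Ul2 Uf; apply: at1_lt (lt_trans h1 h2); exact: UC0. Qed.

Lemma mass_cont f : U f -> forall e : R, 0 < e -> exists d : R, 0 < d /\
  forall r, `|r| < d -> `|mass s0 (tnorm f + r) f - mass s0 (tnorm f) f| < e.
Proof.
move=> Uf e e0; pose nu (r : R) : R := `|r|.
have nu0 r : 0 <= nu r by exact: normr_ge0.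
have dl : dif [set: R] nu (fun r => tnorm f + r) (tnorm f) (fun r => r).
  split; first by exists 1; split=> // r _; rewrite mul1r.
  move=> e' e'0; exists 1; split=> // r _ _; rewrite (_ : _ + r - _ - r = 0); last by ring.
  by rewrite normr0 mulr_ge0 // ltW.
have dm := dif_sum nu0 s0 (fun p => dif_psi nu0 (dif_excess nu0 (at1N p Uf) dl
  (dif_const _ nu0 (at1 f p)) (dif_const _ nu0 (Op f p)))).
have [d [d0 hd]] := dif_small nu0 dm e0.
exists d; split=> // r hr; exact: (hd r I hr).
Qed.

(** Beyond l2 the terms outside s0 vanish, so the sum over s0 alone decides. *)
Lemma mass_le1 f l : U f -> l2 < l -> mass s0 l f <= 1 -> admissible f l.
Proof.
move=> Uf hl h; have [fl _] := Ul2 Uf; split=> [|s us]; first exact: lt_trans hl.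
apply: le_trans h; rewrite /mass.
rewrite (bigID (fun p => p \in s0)) /= [X in _ + X]big1 ?addr0; last first.
  by move=> p ps; apply: psi_le0; exact: Uout.
rewrite -big_filter.
have pe : perm_eq [seq p <- s | p \in s0] [seq p <- s0 | p \in s].
  apply: uniq_perm; rewrite ?filter_uniq // => p; by rewrite !mem_filter andbC.
rewrite (perm_big _ pe) big_filter [leRHS](bigID (fun p => p \in s)) /= lerDl.
by apply: sumr_ge0 => p _; exact: psi_ge0.
Qed.

(** By continuity in l, a mass above 1 would persist at slightly larger, admissible l; a mass below
    1 would make some smaller l > l2 admissible. *)
Lemma mass_tnorm f : U f -> mass s0 (tnorm f) f = 1.
Proof.
move=> Uf; have hf := UC0 Uf; have [h1 h2] := Ul2 Uf.
have hc := mass_cont Uf; apply/eqP; rewrite eq_le; apply/andP; split; rewrite leNgt; apply/negP => h3.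
  have [d [d0 hd]] := hc _ (eq_ind_r is_true h3 (subr_gt0 _ _)).
  have d2 : 0 < d / 2 by rewrite divr_gt0.
  have := hd (d / 2); rewrite gtr0_norm // ltr_norml => /(_ _)/andP[|+ _]; first by lra.
  have [_ /(_ s0 uniq_s0)] : admissible f (tnorm f + d / 2) by apply: tnorm_lt => //; rewrite ltrDl.
  lra.
have [d [d0 hd]] := hc _ (eq_ind_r is_true h3 (subr_gt0 _ _)).
set r := Order.min (d / 2) ((tnorm f - l2) / 2).
have r0 : 0 < r by rewrite lt_min !divr_gt0 // subr_gt0.
have [r1 r2] : r <= d / 2 /\ r <= (tnorm f - l2) / 2 by rewrite !ge_min !lexx orbT.
have := hd (- r); rewrite normrN gtr0_norm // ltr_norml => /(_ _)/andP[|_ h4]; first by lra.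
have : tnorm f <= tnorm f - r.
  apply: tnorm_le => //; apply: mass_le1 => //; first by lra.
  by lra.
lra.
Qed.


Local Notation difat g f L := (dif C0 (@supn R T) (fun h : V => g (fadd f h)) (g f) L).
Let nu0 (h : V) : 0 <= supn h := supn_ge0 h.

Definition coord (i : idx) (f : V) : R := if i.1 then Op f i.2 else at1 f i.2.

Lemma coord_add i f g : C0 f -> C0 g -> coord i (fadd f g) = coord i f + coord i g.
Proof. by move=> hf hg; rewrite /coord; case: ifP => // _; exact: Op_add. Qed.

Lemma coord_scale i a f : C0 f -> coord i (fscale a f) = a * coord i f.
Proof. by move=> hf; rewrite /coord; case: ifP => // _; exact: Op_scale. Qed.

Lemma coord_le i f : C0 f -> `|coord i f| <= (1 + C) * supn f.
Proof.
move=> hf; rewrite mulrDl mul1r /coord; case: ifP => _.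
  by apply: le_trans (Op_le hf _) _; rewrite lerDr.
by apply: le_trans (C0_le_supn Htree _ hf) _; rewrite lerDl mulr_ge0.
Qed.

Fixpoint every (X : Type) (Q : X -> Prop) (s : seq X) : Prop :=
  if s is x :: s' then Q x /\ every Q s' else True.

Lemma every_cat (X : Type) (Q : X -> Prop) s t : every Q s -> every Q t -> every Q (s ++ t).
Proof. by elim: s => //= x s IH [h1 h2] ht; split=> //; exact: IH. Qed.

Lemma every_map (X Y : Type) (Q : X -> Prop) (Q' : Y -> Prop) (k : X -> Y) s :
  (forall x, Q x -> Q' (k x)) -> every Q s -> every Q' (map k s).
Proof. by move=> h; elim: s => //= x s IH [h1 h2]; split; [exact: h|exact: IH]. Qed.

Lemma every_all (X : Type) (Q : X -> Prop) s : (forall x, Q x) -> every Q s.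
Proof. by move=> h; elim: s => //= x s IH; split. Qed.

(** A class containing the norm and closed under differentiation, by [elem_diffable]: derivatives
    are finite sums of coefficients in the class times the linear functionals [coord]. [elem_ext]
    makes values off U immaterial. *)
Inductive elem : (V -> R) -> Prop :=
| elem_cst c : elem (fun=> c)
| elem_coord i : elem (coord i)
| elem_tnorm : elem tnorm
| elem_add g g' : elem g -> elem g' -> elem (fun f => g f + g' f)
| elem_mul g g' : elem g -> elem g' -> elem (fun f => g f * g' f)
| elem_inv g : elem g -> (forall f, U f -> g f != 0) -> elem (fun f => (g f)^-1)
| elem_flat n g : elem g -> elem (fun f => flat n (g f))
| elem_ext g g' : elem g -> (forall f, U f -> g f = g' f) -> elem g'.

Lemma elem_sum (X : Type) (s : seq X) (g : X -> V -> R) : (forall x, elem (g x)) ->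
  elem (fun f => \sum_(x <- s) g x f).
Proof.
move=> hg; elim: s => [|x s IH].
  by apply: elem_ext (elem_cst 0) _ => f _; rewrite big_nil.
by apply: elem_ext (elem_add (hg x) IH) _ => f _; rewrite big_cons.
Qed.

Definition lform (ds : seq ((V -> R) * idx)) (f h : V) : R := \sum_(d <- ds) d.1 f * coord d.2 h.
Definition elems (ds : seq ((V -> R) * idx)) := every (fun d => elem d.1) ds.
Definition diffable (g : V -> R) :=
  exists ds, elems ds /\ forall f, U f -> difat g f (lform ds f).

Lemma lform_cat ds ds' f h : lform (ds ++ ds') f h = lform ds f h + lform ds' f h.
Proof. exact: big_cat. Qed.

Definition lscale (k : V -> R) (ds : seq ((V -> R) * idx)) :=
  [seq ((fun f => k f * d.1 f), d.2) | d <- ds].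

Lemma lform_scale k ds f h : lform (lscale k ds) f h = k f * lform ds f h.
Proof. by rewrite /lform /lscale big_map mulr_sumr; apply: eq_bigr => d _ /=; rewrite mulrA. Qed.

Lemma elems_scale k ds : elem k -> elems ds -> elems (lscale k ds).
Proof. by move=> hk; apply: every_map => d hd /=; exact: elem_mul. Qed.

Lemma lform_le ds f : exists K : R, 0 <= K /\ forall h, C0 h -> `|lform ds f h| <= K * supn h.
Proof.
elim: ds => [|d ds [K [K0 hK]]].
  by exists 0; split=> // h _; rewrite /lform big_nil normr0 mul0r.
exists (`|d.1 f| * (1 + C) + K); split=> [|h hh].
  by rewrite addr_ge0 // mulr_ge0 // addr_ge0.
rewrite /lform big_cons mulrDl; apply: le_trans (ler_normD _ _) _; apply: lerD; last exact: hK.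
by rewrite normrM -mulrA ler_wpM2l // coord_le.
Qed.

Lemma difat_coord i f : C0 f -> difat (coord i) f (coord i).
Proof.
move=> hf; have h0 : 0 <= 1 + C by rewrite addr_ge0.
have E h : C0 h -> coord i (fadd f h) - coord i f = coord i h.
  by move=> hh; rewrite coord_add // addrC addKr.
apply: (dif_eqL E (dif_exact nu0 h0 _)) => h hh; rewrite E //; exact: coord_le.
Qed.

Lemma diffable_comp (phi dphi : R -> R) g : diffable g -> elem (fun f => dphi (g f)) ->
  (forall f, U f -> forall L, difat g f L ->
     dif C0 (@supn R T) (fun h => phi (g (fadd f h))) (phi (g f)) (fun h => dphi (g f) * L h)) ->
  diffable (fun f => phi (g f)).
Proof.
move=> [ds [eds hds]] ek hd; exists (lscale (fun f => dphi (g f)) ds); split; first exact: elems_scale.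
by move=> f Uf; apply: dif_eqL (hd f Uf _ (hds f Uf)) => h _; rewrite lform_scale.
Qed.

(** These definitions rewrite one term of the mass and its partial derivatives in terms of the
    operations of [elem]. [dnorm] is the partial derivative in the norm with its sign reversed;
    [dat1] and [dOp] are those in f(t) and in the operator. *)
Definition den p f := tnorm f * tnorm f + -1 * (at1 f p * at1 f p).
Definition exc p f := Op f p * Op f p * (den p f)^-1 + -1.
Definition wgt p f := flat 0 (exc p f) + flat 1 (exc p f).
Definition dnorm p f := wgt p f * (2 * (tnorm f * (Op f p * Op f p * ((den p f)^-1 * (den p f)^-1)))).
Definition dat1 p f := wgt p f * (2 * (at1 f p * (Op f p * Op f p * ((den p f)^-1 * (den p f)^-1)))).
Definition dOp p f := wgt p f * (2 * (Op f p * (den p f)^-1)).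
Definition dtot f := \sum_(p <- s0) dnorm p f.

Lemma den_gt0 p f : U f -> 0 < den p f.
Proof.
by move=> Uf; have := sqr_gap (at1N p Uf); rewrite !expr2 /den mulN1r.
Qed.

Lemma excE p f : exc p f = excess (tnorm f) (at1 f p) (Op f p).
Proof. by rewrite /exc /excess /den !expr2 mulN1r. Qed.

(** As the mass is 1, some term has positive excess; its weight and its operator coordinate are then
    non-zero. This is the condition for implicit differentiation. *)
Lemma dtot_gt0 f : U f -> 0 < dtot f.
Proof.
move=> Uf; have N0 p : 0 < tnorm f := le_lt_trans (normr_ge0 _) (at1N p Uf).
have w0 p : 0 <= wgt p f by rewrite addr_ge0 // flat_ge0.
have t0 p : 0 <= dnorm p f.
  have y0 := den_gt0 p Uf.
  by rewrite mulr_ge0 // mulr_ge0 // mulr_ge0 ?(ltW (N0 p)) // mulr_ge0 -?expr2 ?sqr_ge0.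
rewrite lt_neqAle sumr_ge0 // andbT eq_sym; apply/negP.
rewrite psumr_eq0 // => /allP hz.
have := mass_tnorm Uf; rewrite /mass big_seq big1 => [/esym/eqP|p ps]; first by rewrite oner_eq0.
case: (leP (excess (tnorm f) (at1 f p) (Op f p)) 0) => [|e0]; first exact: psi_le0.
have y0 := den_gt0 p Uf.
have k0 : 0 < wgt p f by have := dpsi_gt0 e0; rewrite -excE.
have b0 : 0 < Op f p * Op f p.
  rewrite lt_neqAle -{2}expr2 sqr_ge0 andbT eq_sym; apply/negP => /eqP z.
  by move: e0; rewrite -excE /exc z mul0r add0r oppr_gt0 ltr10.
have := hz p ps; rewrite gt_eqF // mulr_gt0 // mulr_gt0 // mulr_gt0 ?(N0 p) //.
by rewrite mulr_gt0 // mulr_gt0 // invr_gt0.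
Qed.

Lemma elem_at1 p : elem (fun f => at1 f p). Proof. exact: (elem_coord (false, p)). Qed.
Lemma elem_Op p : elem (fun f => Op f p). Proof. exact: (elem_coord (true, p)). Qed.

Lemma elem_den p : elem (den p).
Proof.
apply: elem_add; first exact: elem_mul elem_tnorm elem_tnorm.
apply: elem_mul (elem_cst _) (elem_mul _ _); exact: elem_at1.
Qed.

Lemma elem_iden p : elem (fun f => (den p f)^-1).
Proof. by apply: elem_inv (elem_den p) _ => f Uf; rewrite gt_eqF // den_gt0. Qed.

Lemma elem_sqOp p : elem (fun f => Op f p * Op f p).
Proof. exact: elem_mul (elem_Op p) (elem_Op p). Qed.

Lemma elem_wgt p : elem (wgt p).
Proof.
have h : elem (exc p).
  by apply: elem_add (elem_cst _); apply: elem_mul (elem_iden p); exact: elem_sqOp.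
apply: elem_add; exact: elem_flat.
Qed.

Lemma elem_dnorm p : elem (dnorm p).
Proof.
apply: elem_mul (elem_wgt p) _; apply: elem_mul (elem_cst 2) _; apply: elem_mul elem_tnorm _.
exact: elem_mul (elem_sqOp p) (elem_mul (elem_iden p) (elem_iden p)).
Qed.

Lemma elem_dat1 p : elem (dat1 p).
Proof.
apply: elem_mul (elem_wgt p) _; apply: elem_mul (elem_cst 2) _; apply: elem_mul (elem_at1 p) _.
exact: elem_mul (elem_sqOp p) (elem_mul (elem_iden p) (elem_iden p)).
Qed.

Lemma elem_dOp p : elem (dOp p).
Proof.
apply: elem_mul (elem_wgt p) _; apply: elem_mul (elem_cst 2) _.
exact: elem_mul (elem_Op p) (elem_iden p).
Qed.

Lemma elem_idtot : elem (fun f => (dtot f)^-1).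
Proof.
apply: elem_inv => [|f Uf]; last by rewrite gt_eqF // dtot_gt0.
apply: elem_sum => p; exact: elem_dnorm.
Qed.

(* Implicit differentiation of [mass s0 (tnorm f) f = 1], the increment of
   [tnorm] itself being used as its own differential in the first step. *)
Lemma diffable_tnorm : diffable tnorm.
Proof.
pose ds := lscale (fun f => (dtot f)^-1)
  ([seq (dat1 p, (false, p)) | p <- s0] ++ [seq (dOp p, (true, p)) | p <- s0]).
exists ds; split.
  apply: elems_scale; first exact: elem_idtot.
  apply: every_cat.
    by apply: (every_map (Q := fun=> True)) (every_all _ (fun=> I)) => p _; exact: elem_dat1.
  by apply: (every_map (Q := fun=> True)) (every_all _ (fun=> I)) => p _; exact: elem_dOp.
move=> f Uf; have hf := UC0 Uf.
split; first exact: lform_le.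
have h0 : 0 <= 1 + C by rewrite addr_ge0.
have dN := dif_exact nu0 h0 (fun h (hh : C0 h) => tnorm_lip hf hh).
have dm := dif_sum nu0 s0 (fun p => dif_psi nu0 (dif_excess nu0 (at1N p Uf) dN
  (difat_coord (false, p) hf) (difat_coord (true, p) hf))).
have D0 := dtot_gt0 Uf.
move=> e e0; have [_ hm] := dm.
have [d [d1 hd]] := hm (e * dtot f) (mulr_gt0 e0 D0).
have [d' [d'0 hd']] := Uopen Uf.
exists (Order.min d d'); split=> [|h hh]; first by rewrite lt_min d1.
rewrite lt_min => /andP[h1 h2].
have := hd h hh h1.
have := mass_tnorm (hd' h hh h2); rewrite /mass => ->.
have := mass_tnorm Uf; rewrite /mass => ->.
rewrite subrr sub0r normrN.
set L := tnorm (fadd f h) - tnorm f.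
set S := \sum_(p <- s0) _.
have -> : S = - dtot f * (L - lform ds f h).
  rewrite /ds lform_scale; set X := lform (_ ++ _) f h.
  have -> : - dtot f * (L - (dtot f)^-1 * X) = X - dtot f * L by field; rewrite gt_eqF.
  rewrite /X lform_cat /lform !big_map /= /dtot mulr_suml -sumrN -!big_split; apply: eq_bigr => p _ /=.
  have y0 := den_gt0 p Uf.
  rewrite /dnorm /dat1 /dOp /coord /=.
  have -> : dpsi (excess (tnorm f) (at1 f p) (Op f p)) = wgt p f by rewrite -excE.
  have -> : tnorm f ^+ 2 - at1 f p ^+ 2 = den p f by rewrite /den !expr2 mulN1r.
  by field; rewrite gt_eqF.
rewrite normrM normrN (gtr0_norm D0).
have -> : e * dtot f * supn h = dtot f * (e * supn h) by ring.
by rewrite ler_pM2l.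
Qed.

Lemma elem_diffable g : elem g -> diffable g.
Proof.
elim=> {g} [c|i||g g' eg [ds [e1 d1]] eg' [ds' [e2 d2]]|g g' eg [ds [e1 d1]] eg' [ds' [e2 d2]]
           |g eg dg g0|n g eg dg|g g' eg [ds [e1 d1]] E].
- exists [::]; split=> // f Uf; apply: dif_eqL (dif_const _ nu0 c) => h _; by rewrite /lform big_nil.
- exists [:: (fun=> 1, i)]; split=> [|f Uf]; first by split=> //; exact: elem_cst.
  apply: dif_eqL (difat_coord i (UC0 Uf)) => h _; by rewrite /lform big_seq1 mul1r.
- exact: diffable_tnorm.
- exists (ds ++ ds'); split=> [|f Uf]; first exact: every_cat.
  by apply: dif_eqL (dif_add (d1 f Uf) (d2 f Uf)) => h _; rewrite lform_cat.
- exists (lscale g' ds ++ lscale g ds'); split=> [|f Uf].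
    by apply: every_cat; exact: elems_scale.
  apply: dif_eqL (dif_mul nu0 (d1 f Uf) (d2 f Uf)) => h _.
  by rewrite lform_cat !lform_scale mulrC.
- apply: (@diffable_comp (fun x => x^-1) (fun x => - (x^-1 * x^-1))) => //.
    apply: elem_ext (elem_mul (elem_cst (-1)) (elem_mul (elem_inv eg g0) (elem_inv eg g0))) _ => f _.
    by rewrite mulN1r.
  by move=> f Uf L dL; apply: dif_inv dL => //; exact: g0.
- apply: (@diffable_comp (flat n) (fun x => flat n.+2 x - n%:R * flat n.+1 x)) => //.
    apply: elem_ext (elem_add (elem_flat n.+2 eg) (elem_mul (elem_cst (- n%:R)) (elem_flat n.+1 eg))) _.
    by move=> f _; rewrite mulNr.
  by move=> f Uf L dL; exact: dif_flat.
- exists ds; split=> // f Uf; rewrite -E //; apply: dif_near (d1 f Uf).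
  by have [d [d0 hd]] := Uopen Uf; exists d; split=> // h hh hs; apply: E; exact: hd.
Qed.


(** * Higher derivatives as multilinear forms *)

Fixpoint monomial (ls : seq idx) (hs : seq V) : R :=
  if ls is l :: ls' then if hs is h :: hs' then coord l h * monomial ls' hs' else 1 else 1.

Definition mform (rs : seq ((V -> R) * seq idx)) f hs := \sum_(r <- rs) r.1 f * monomial r.2 hs.

Definition mform_of k (rs : seq ((V -> R) * seq idx)) := every (fun r => elem r.1 /\ size r.2 = k) rs.

Lemma every_In (X : Type) (Q : X -> Prop) s : (forall x, List.In x s -> Q x) -> every Q s.
Proof. by elim: s => //= x s IH h; split; [apply: h; left|apply: IH => y ys; apply: h; right]. Qed.

Lemma prod_supn_ge0 (hs : seq V) : 0 <= \prod_(h <- hs) supn h.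
Proof. by apply: prodr_ge0 => h _; exact: supn_ge0. Qed.

Lemma monomial_le ls hs : size ls = size hs -> every C0 hs ->
  `|monomial ls hs| <= (1 + C) ^+ size ls * \prod_(h <- hs) supn h.
Proof.
elim: ls hs => [|l ls IH] [|h hs] //=; first by rewrite big_nil normr1 expr0 mulr1.
move=> [sz] [hh hhs]; rewrite big_cons normrM exprS mulrACA.
by apply: ler_pM => //; [exact: coord_le|exact: IH].
Qed.

Lemma monomial_lin ls pre post a x y : size ls = (size pre + size post + 1)%N ->
  C0 x -> C0 y -> monomial ls (pre ++ fadd (fscale a x) y :: post) =
    a * monomial ls (pre ++ x :: post) + monomial ls (pre ++ y :: post).
Proof.
move=> + hx hy; elim: pre ls => [|h pre IH] [|l ls] //=; first by rewrite addn1.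
  by move=> _; rewrite coord_add ?coord_scale //; [ring|exact: C0_scale].
by rewrite !addSn => -[sz]; rewrite IH //; ring.
Qed.

Lemma mform_lin k rs f pre post a x y : mform_of k rs -> (size pre + size post + 1)%N = k ->
  C0 x -> C0 y -> mform rs f (pre ++ fadd (fscale a x) y :: post) =
    a * mform rs f (pre ++ x :: post) + mform rs f (pre ++ y :: post).
Proof.
move=> + sz hx hy; rewrite /mform; elim: rs => [|r rs IH] /=.
  by rewrite !big_nil mulr0 addr0.
by move=> [[_ rk] hrs]; rewrite !big_cons IH // monomial_lin ?rk //; ring.
Qed.

Lemma mform_le k rs f : mform_of k rs -> exists K : R, forall hs, size hs = k -> every C0 hs ->
  `|mform rs f hs| <= K * \prod_(h <- hs) supn h.
Proof.
rewrite /mform; elim: rs => [|r rs IH] /=.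
  by exists 0 => hs _ _; rewrite big_nil normr0 mul0r.
move=> [[_ rk] /IH[K hK]]; exists (`|r.1 f| * (1 + C) ^+ k + K) => hs sz hhs.
rewrite big_cons mulrDl; apply: le_trans (ler_normD _ _) _; apply: lerD; last exact: hK.
by rewrite normrM -mulrA ler_wpM2l // -rk monomial_le // rk.
Qed.

Definition mform_deriv k rs rs' := forall f, U f -> forall e : R, 0 < e -> exists d : R, 0 < d /\
  forall h, C0 h -> supn h < d -> forall hs, size hs = k -> every C0 hs ->
  `|mform rs (fadd f h) hs - mform rs f hs - mform rs' f (h :: hs)|
     <= e * supn h * \prod_(g <- hs) supn g.

(** Only the coefficients depend on f, so differentiating them by [elem_diffable] suffices; the new
    direction enters as the first argument. *)
Lemma mform_deriv_ex k rs : mform_of k rs -> exists rs', mform_of k.+1 rs' /\ mform_deriv k rs rs'.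
Proof.
elim: rs => [_|r rs IH /= [[er rk] /IH[rs' [hrs' drs']]]].
  exists [::]; split=> // f _ e e0; exists 1; split=> // h hh _ hs _ _.
  by rewrite /mform !big_nil !subrr normr0 mulr_ge0 ?prod_supn_ge0 // mulr_ge0 ?supn_ge0 // ltW.
have [ds [eds dds]] := elem_diffable er.
exists ([seq (d.1, d.2 :: r.2) | d <- ds] ++ rs'); split.
  apply: every_cat => //; apply: every_map eds => d ed /=; by rewrite rk.
move=> f Uf e e0.
have B0 : 0 < (1 + C) ^+ k by rewrite exprn_gt0 // ltr_wpDr.
have e2 : 0 < e / 2 by rewrite divr_gt0.
have [_ hd1] := dds f Uf; have [d1 [d10 {}hd1]] := hd1 _ (divr_gt0 e2 B0).
have [d2 [d20 hd2]] := drs' f Uf _ e2.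
exists (Order.min d1 d2); split=> [|h hh]; first by rewrite lt_min d10.
rewrite lt_min => /andP[h1 h2] hs sz hhs.
have {}hd1 := hd1 h hh h1; have {}hd2 := hd2 h hh h2 hs sz hhs.
have E : mform ([seq (d.1, d.2 :: r.2) | d <- ds] ++ rs') f (h :: hs) =
    lform ds f h * monomial r.2 hs + mform rs' f (h :: hs).
  rewrite /mform big_cat big_map /= /lform mulr_suml; congr (_ + _).
  by apply: eq_bigr => d _; rewrite mulrA.
rewrite E; rewrite /mform !big_cons -!/(mform _ _ _).
set m := monomial r.2 hs; set w := lform ds f h in hd1 *.
set u := r.1 (fadd f h) in hd1 *; set u0 := r.1 f in hd1 *.
set X := mform rs (fadd f h) hs in hd2 *; set Y := mform rs f hs in hd2 *.
set Z := mform rs' f (h :: hs) in hd2 *.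
have -> : u * m + X - (u0 * m + Y) - (w * m + Z) = (u - u0 - w) * m + (X - Y - Z) by ring.
apply: le_trans (ler_normD _ _) _.
have Q0 := prod_supn_ge0 hs; set Q := \prod_(g <- hs) _ in hd2 Q0 *.
have hm : `|m| <= (1 + C) ^+ k * Q by rewrite -rk monomial_le // rk.
have h3 : `|(u - u0 - w) * m| <= e / 2 * supn h * Q.
  rewrite normrM; apply: le_trans (ler_pM _ _ hd1 hm) _ => //.
  rewrite le_eqVlt; apply/orP; left; apply/eqP; field; exact: lt0r_neq0.
lra.
Qed.

Definition dirder (u : R -> R) (d : R) := forall e : R, 0 < e -> exists r : R, 0 < r /\
  forall t, `|t| < r -> `|u t - u 0 - d * t| <= e * `|t|.

Lemma dirder_uniq u d d' : dirder u d -> dirder u d' -> d' = d.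
Proof.
move=> h h'; apply/eqP; rewrite -subr_eq0 -normr_le0; apply/ler_addgt0Pl => e e0; rewrite addr0.
have e2 : 0 < e / 2 by rewrite divr_gt0.
have [r [r0 hr]] := h _ e2; have [r' [r'0 hr']] := h' _ e2.
set t := Order.min r r' / 2.
have m0 : 0 < Order.min r r' by rewrite lt_min r0.
have t0 : 0 < t by rewrite divr_gt0.
have [tr tr'] : t < r /\ t < r'.
  have : t < Order.min r r' by rewrite /t; lra.
  by rewrite lt_min => /andP.
have := hr t; have := hr' t; rewrite gtr0_norm // => /(_ tr') h1 /(_ tr) h2.
rewrite -(ler_pM2r t0) -{1}(gtr0_norm t0) -normrM.
have -> : (d' - d) * t = (u t - u 0 - d * t) - (u t - u 0 - d' * t) by ring.
apply: le_trans (ler_normB _ _) _; lra.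
Qed.

(** Smoothness asks for one global family of derivatives, whereas the explicit forms depend on the
    neighbourhood and on s0. Iterated directional derivatives are intrinsic and agree with the local
    forms. *)
Fixpoint nderiv (N : V -> R) k f (hs : seq V) : R :=
  if k is k'.+1 then
    if hs is h :: hs' then xget 0 [set d | dirder (fun t => nderiv N k' (fadd f (fscale t h)) hs') d]
    else 0
  else N f.

(** U is open, so near f the k-th directional derivative is the given form; its Frechet derivative
    is then the unique directional derivative. *)
Lemma nderiv_step k rs rs' : mform_of k.+1 rs' -> mform_deriv k rs rs' ->
  (forall f hs, U f -> size hs = k -> every C0 hs -> nderiv tnorm k f hs = mform rs f hs) ->
  forall f hs, U f -> size hs = k.+1 -> every C0 hs -> nderiv tnorm k.+1 f hs = mform rs' f hs.
Proof.
move=> hrs' hd hN f [|h hs] // Uf [sz] [hh hhs] /=.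
have f0 : fadd f (fscale 0 h) = f by apply: funext => x; rewrite /fadd /fscale mul0r addr0.
have E : dirder (fun t => nderiv tnorm k (fadd f (fscale t h)) hs) (mform rs' f (h :: hs)).
  move=> e e0; have [d [d0 hd0]] := Uopen Uf.
  have s0' := supn_ge0 h; have Q0 := prod_supn_ge0 hs.
  set K := supn h * \prod_(g <- hs) supn g.
  have K0 : 0 <= K by rewrite mulr_ge0.
  have K1 : 0 < K + 1 by rewrite ltr_wpDl.
  have [d' [d'0 hd']] := hd f Uf (e / (K + 1)) (divr_gt0 e0 K1).
  have s1 : 0 < supn h + 1 by rewrite ltr_wpDl.
  exists (Order.min d d' / (supn h + 1)); split=> [|t]; first by rewrite divr_gt0 // lt_min d0.
  rewrite ltr_pdivlMr // => ht.
  have : `|t| * supn h < Order.min d d'.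
    by apply: le_lt_trans ht; rewrite ler_wpM2l // lerDl.
  rewrite lt_min => /andP[h1 h2].
  have hth : C0 (fscale t h) by exact: C0_scale.
  have sth : supn (fscale t h) = `|t| * supn h by exact: supn_scale Htree _ _ _ hh.
  rewrite f0 !hN //; last by apply: hd0; rewrite // sth.
  have {hd'} := hd' (fscale t h) hth; rewrite sth => /(_ h2 hs sz hhs).
  have -> : mform rs' f (fscale t h :: hs) = mform rs' f (h :: hs) * t.
    have Z := C0_0 Htree R.
    have szE : (size ([::] : seq V) + size hs + 1)%N = k.+1 by rewrite addnC -sz.
    have := mform_lin f t hrs' szE hh Z; have := mform_lin f (- 1) hrs' szE Z Z; rewrite !cat0s.
    have -> : fadd (fscale (- 1) (fun=> 0)) (fun=> 0) = (fun=> 0) :> V.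
      by apply: funext => x; rewrite /fadd /fscale mulr0 addr0.
    have -> : fadd (fscale t h) (fun=> 0) = fscale t h by apply: funext => x; rewrite /fadd addr0.
    by rewrite mulN1r addNr => -> ->; rewrite addr0 mulrC.
  move=> h3; apply: le_trans h3 _.
  have -> : e / (K + 1) * (`|t| * supn h) * \prod_(g <- hs) supn g = e * `|t| * (K / (K + 1)).
    by rewrite /K; field; rewrite gt_eqF.
  apply: ler_piMr; first by rewrite mulr_ge0 // ltW.
  by rewrite ler_pdivrMr // mul1r lerDl.
by apply: xget_unique => // d hd'; exact: dirder_uniq hd'.
Qed.

Lemma nderiv_mform k : exists rs, mform_of k rs /\
  forall f hs, U f -> size hs = k -> every C0 hs -> nderiv tnorm k f hs = mform rs f hs.
Proof.
elim: k => [|k [rs [hrs hN]]].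
  exists [:: (tnorm, [::])]; split; first by split=> //; split=> //; exact: elem_tnorm.
  by move=> f hs _ _ _; rewrite /mform big_seq1 mulr1.
have [rs' [hrs' d]] := mform_deriv_ex hrs.
exists rs'; split=> //; exact: nderiv_step d hN.
Qed.

Lemma nderiv_multilinear k f : U f -> bounded_multilinear le k (nderiv tnorm k f).
Proof.
move=> Uf; have [rs [hrs hN]] := nderiv_mform k; split.
  move=> pre post a x y szR hpre hpost hx hy.
  have sz : (size pre + size post + 1)%N = k := szR.
  have ev z : C0 z -> every C0 (pre ++ z :: post).
    by move=> hz; apply: every_cat; [exact: every_In|split=> //; exact: every_In].
  have szE z : size (pre ++ z :: post) = k by rewrite size_cat /= addnS -sz addn1.
  rewrite !hN //; try exact: ev; last by apply: ev; exact: C0_lin.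
  exact: mform_lin hrs sz hx hy.
have [K hK] := mform_le f hrs; exists K => hs sz hhs.
by rewrite hN //; [apply: hK => //|]; exact: every_In.
Qed.

Lemma nderiv_frechet k f : U f -> forall e : R, 0 < e -> exists d : R, 0 < d /\
  forall h, C0 h -> supn h < d -> forall hs, size hs = k -> (forall g, List.In g hs -> C0 g) ->
  `|nderiv tnorm k (fadd f h) hs - nderiv tnorm k f hs - nderiv tnorm k.+1 f (h :: hs)|
     <= e * supn h * \prod_(g <- hs) supn g.
Proof.
move=> Uf e e0; have [rs [hrs hN]] := nderiv_mform k.
have [rs' [hrs' d]] := mform_deriv_ex hrs.
have hN' := nderiv_step hrs' d hN.
have [r [r0 hr]] := Uopen Uf; have [r' [r'0 hr']] := d f Uf e e0.
exists (Order.min r r'); split=> [|h hh]; first by rewrite lt_min r0.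
rewrite lt_min => /andP[h1 h2] hs sz /every_In hhs.
rewrite !hN //; last exact: hr.
rewrite hN' //=; first exact: hr'.
by rewrite sz.
Qed.

End Local.

Lemma tnorm_smooth : smooth_away_from_0 le tnorm.
Proof.
have loc f : C0 f -> nonzero f -> exists U s0 l2, finitary U s0 l2 /\ U f := @finitary_ex f.
exists (nderiv tnorm); split=> // k f hf nf; have [U [s0 [l2 [hU Uf]]]] := loc f hf nf.
  exact: nderiv_multilinear hU k f Uf.
exact: nderiv_frechet hU k f Uf.
Qed.

End TalagrandNorm.

Lemma c0_bounded (R : realType) (S : Type) (g : S -> R) : c0 g -> exists B : R, forall s, `|g s| <= B.
Proof.
move=> /(_ 1 ltr01)/(@finite_seqP {classic S})[s sP].
exists (1 + \sum_(x <- s) `|g x|) => x; case: (leP 1 `|g x|) => [h|/ltW h].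
  have xs : (x : {classic S}) \in s by have : [set x | 1 <= `|g x|] x by []; rewrite sP.
  rewrite (big_rem (x : {classic S})) //=.
  by rewrite addrCA lerDl addr_ge0 // sumr_ge0.
by rewrite (le_trans h) // lerDl sumr_ge0.
Qed.

Theorem smooth_of_talagrand (T : Type) (le : T -> T -> Prop) (Htree : is_tree le) (R : realType) :
  admits_talagrand_operator R le ->
  exists N : (T -> R) -> R, equiv_norm le N /\ smooth_away_from_0 le N.
Proof.
move=> [M [Op [Oc0 Olin [C hC] Otal]]].
(* The operator bound concerns [supn], which by convention is 0 on an unbounded function, so
   boundedness is established first. The absolute value of C is taken because its sign is not
   given. *)
have Ole f : C0 le f -> forall p, `|Op f p| <= `|C| * supn f.
  move=> hf p; have [B hB] := c0_bounded (Oc0 f hf).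
  apply: le_trans (supn_ub p hB) (le_trans (hC f hf) _).
  by rewrite ler_wpM2r ?supn_ge0 // ler_norm.
exists (tnorm Op); split.
  exact: (tnorm_equiv Htree Olin (normr_ge0 C) Ole).
exact: (tnorm_smooth Htree Oc0 Olin (normr_ge0 C) Ole Otal).
Qed.

(** * Closing the cycle of implications *)

Lemma frechet_of_smooth (T : Type) (le : T -> T -> Prop) (Htree : is_tree le) (R : realType)
  (N : (T -> R) -> R) : smooth_away_from_0 le N -> frechet_away_from_0 le N.
Proof.
move=> [D [D0 Dlin Dder]] f hf nf.
have [lin [B hB]] := Dlin 1%N f hf nf.
exists (fun h => D 1%N f [:: h]); split; first split.
- by move=> a g h hg hh; apply: (lin [::] [::]).
- by exists B => h hh; have := hB [:: h]; rewrite big_seq1; apply=> // g [<-|[]].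
move=> e e0; have [d [d0 hd]] := Dder 0%N f hf nf e e0.
(* Below supn f a perturbation cannot cancel f at a point of maximal modulus, so f + h is non-zero
   and [D 0] still equals N there. *)
exists (Order.min d (supn f)); split=> [|h hh]; first by rewrite lt_min d0 (C0_supn_gt0 Htree).
rewrite lt_min => /andP[h1 h2].
have := hd h hh h1 [::] erefl (fun _ (F : List.In _ [::]) => False_ind _ F).
rewrite big_nil mulr1 !D0 //; first exact: C0_add.
have [t ft] := C0_supn_attained Htree hf nf; exists t.
rewrite /fadd; apply/eqP => /eqP; rewrite addr_eq0 => /eqP E.
have := C0_le_supn Htree t hh; rewrite -normrN -E ft leNgt => /negP; exact.
Qed.

Theorem theorem8p1 (T : Type) (le : T -> T -> Prop) (Htree : is_tree le) :
  [/\ (exists N : (T -> Rdefinitions.R) -> Rdefinitions.R,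
          equiv_norm le N /\ smooth_away_from_0 le N)
        <-> (exists N : (T -> Rdefinitions.R) -> Rdefinitions.R,
               equiv_norm le N /\ frechet_away_from_0 le N),
      (exists N : (T -> Rdefinitions.R) -> Rdefinitions.R,
          equiv_norm le N /\ frechet_away_from_0 le N)
        <-> (exists rho : T -> Rdefinitions.R,
               [/\ increasing le rho, (forall t, ~ bad le rho t) &
                   (forall G, ever_branching le G -> ~ constant_on rho G)]) &
      (exists rho : T -> Rdefinitions.R,
          [/\ increasing le rho, (forall t, ~ bad le rho t) &
              (forall G, ever_branching le G -> ~ constant_on rho G)])
        <-> admits_talagrand_operator Rdefinitions.R le].
Proof.
have fs : (exists N : (T -> Rdefinitions.R) -> Rdefinitions.R,
    equiv_norm le N /\ smooth_away_from_0 le N) ->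
    exists N : (T -> Rdefinitions.R) -> Rdefinitions.R, equiv_norm le N /\ frechet_away_from_0 le N.
  by move=> [N [hN sN]]; exists N; split=> //; exact: frechet_of_smooth.
have rf := fun H : (exists N : (T -> Rdefinitions.R) -> Rdefinitions.R,
    equiv_norm le N /\ frechet_away_from_0 le N) =>
  let: ex_intro N (conj hN fN) := H in rho_of_frechet Htree hN fN.
have tr := fun H : (exists rho : T -> Rdefinitions.R, [/\ increasing le rho, (forall t, ~ bad le rho t) &
    (forall G, ever_branching le G -> ~ constant_on rho G)]) =>
  let: ex_intro rho (And3 h1 h2 h3) := H in talagrand_of_rho Htree h1 h2 h3.
have st := @smooth_of_talagrand T le Htree Rdefinitions.R.
by split; split=> h; [exact: fs|exact: st (tr (rf h))|exact: rf|exact: fs (st (tr h))|exact: tr|exact: rf (fs (st h))].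
Qed.
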